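(* Let $d\ge 2$ be an integer and let $P_d(x)=\sum_{k=2}^d a_k x^k$ be a real polynomial of degree $d$. Let $\{X_i\}_{i\ge 0}$ be a sequence of independent real random variables such that $$\mathbf{E}(X_i)=0,\quad \mathbf{E}(X_i^2)=1\ \text{ for all } i\ge 0,\qquad \sup_{i\ge 0}\mathbf{E}(|X_i|^k)=\alpha_k<\infty\ \text{ for all integers } k\ge 3.$$ For each $n\ge 1$ let $C_n$ be the $n\times n$ random circulant matrix with input sequence $\{X_i/\sqrt n\}_{i\ge 0}$. Then, as $n\to\infty$, $$\frac{\mathrm{Tr}[P_d(C_n)]-\mathbf{E}\,\mathrm{Tr}[P_d(C_n)]}{\sqrt n}\ \stackrel{d}{\longrightarrow}\ N(0,\sigma_{p_d}^2),$$ where $$\sigma_{p_d}^2=\sum_{\ell=2}^d a_\ell^2\,\ell!\sum_{s=0}^{\ell-1}f_\ell(s),\qquad f_\ell(s)=\frac{1}{(\ell-1)!}\sum_{k=0}^{s}(-1)^k\binom{\ell}{k}(s-k)^{\ell-1}.$$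
   Context: The circulant matrix with input sequence $\{x_i\}_{i\ge 0}$ is the $n\times n$ matrix $C_n$ whose $(i,j)$-th entry, $1\le i,j\le n$, is $x_{(j-i) \bmod n}$, where the residue is taken in $\{0,1,\dots,n-1\}$. Thus its first row is $(x_0,x_1,\dots,x_{n-1})$ and each subsequent row is the right circular shift by one position of the previous row. Here $x_i=X_i/\sqrt n$, so the $(i,j)$ entry is $X_{(j-i)\bmod n}/\sqrt n$. $\mathrm{Tr}$ denotes the (unnormalized) trace, $\mathbf{E}$ the expectation, $\stackrel{d}{\longrightarrow}$ convergence in distribution, and $N(0,\sigma^2)$ the normal distribution with mean $0$ and variance $\sigma^2$. *)

(* Defs.v *)
From HB Require Import structures.
From mathcomp Require Import all_boot all_order all_algebra finmap.
From mathcomp Require Import all_classical all_reals all_analysis.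
From mathcomp Require Import measurable_realfun.

Set Implicit Arguments.
Unset Strict Implicit.
Unset Printing Implicit Defensive.

Import Order.TTheory GRing.Theory Num.Theory.
Import numFieldNormedType.Exports.

Local Open Scope classical_set_scope.
Local Open Scope ring_scope.

Definition independent_RVs (d : measure_display) (T : measurableType d)
    (R : realType) (P : probability T R) (I : choiceType)
    (X : I -> {RV P >-> R}) : Prop :=
  forall (J : {fset I}) (B : I -> set R),
    (forall i, i \in J -> measurable (B i)) ->
    P (\bigcap_(i in [set` J]) X i @^-1` B i) =
    (\prod_(i <- J) P (X i @^-1` B i))%E.

(* Convergence of the distribution functions at every continuity point of the
   limiting one. *)
Definition cvg_in_distribution (d : measure_display) (T : measurableType d)
    (R : realType) (P : probability T R) (Y : nat -> {RV P >-> R})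
    (nu : probability (measurableTypeR R) R) : Prop :=
  forall x : R, {for x, continuous (fun t : R => nu `]-oo, t]%classic)} ->
    cdf (Y n) x @[n --> \oo] --> nu `]-oo, x]%classic.

(* Since [i < n], the natural number [(j + (n - i)) %% n] is the residue of
   [j - i] modulo [n]. *)
Definition circulant_mx (R : Type) (n : nat) (x : nat -> R) : 'M[R]_n :=
  \matrix_(i < n, j < n) x ((j + (n - i)) %% n)%N.

Definition poly_ge2 (R : nzRingType) (D : nat) (a : nat -> R) : {poly R} :=
  \sum_(2 <= k < D.+1) a k *: 'X^k.

Section circulant_statistic.
Context (d : measure_display) (T : measurableType d) (R : realType)
  (P : probability T R).
Implicit Types (X : nat -> {RV P >-> R}) (p : {poly R}).

(* Sizes are shifted by one: index [n] stands for the (n+1) x (n+1) matrix, so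
   that all sizes >= 1 are covered and [horner_mx] applies. *)
Definition random_circulant X (n : nat) (w : T) : 'M[R]_n.+1 :=
  circulant_mx n.+1 (fun i => X i w / Num.sqrt n.+1%:R).

Definition trace_stat X p (n : nat) (w : T) : R :=
  \tr (horner_mx (random_circulant X n w) p).

Definition normalized_trace_stat X p (n : nat) (w : T) : R :=
  (trace_stat X p n w - fine 'E_P[trace_stat X p n]) / Num.sqrt n.+1%:R.

Lemma measurable_trace_stat X p n : measurable_fun setT (trace_stat X p n).
Proof.
suff H i j : measurable_fun setT
    (fun w => horner_mx (random_circulant X n w) p i j).
  by rewrite /trace_stat /mxtrace; apply: measurable_sum => i.
elim/poly_ind: p i j => [|p c IH] i j.
  by under eq_fun do rewrite rmorph0 mxE; exact: measurable_cst.
under eq_fun do rewrite rmorphD rmorphM /= horner_mx_X horner_mx_C mxE.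
apply: measurable_funD; last exact: measurable_cst.
under eq_fun do rewrite mxE.
apply: measurable_sum => k; apply: measurable_funM; first exact: IH.
rewrite /random_circulant /circulant_mx.
under eq_fun do rewrite mxE.
by apply: measurable_funM.
Qed.

Lemma measurable_normalized_trace_stat X p n :
  measurable_fun setT (normalized_trace_stat X p n).
Proof.
apply: measurable_funM; last exact: measurable_cst.
by apply: measurable_funB; [exact: measurable_trace_stat|exact: measurable_cst].
Qed.

HB.instance Definition _ X p n := isMeasurableFun.Build _ _ _ _
  (trace_stat X p n) (measurable_trace_stat X p n).

HB.instance Definition _ X p n := isMeasurableFun.Build _ _ _ _
  (normalized_trace_stat X p n) (measurable_normalized_trace_stat X p n).

End circulant_statistic.

Definition f_coef (R : realType) (l s : nat) : R :=
  (l.-1)`!%:R^-1 *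
  \sum_(0 <= k < s.+1) (-1) ^+ k * 'C(l, k)%:R * (s%:R - k%:R) ^+ l.-1.

(* This is positive as soon as [2 <= D] and [a D != 0], so the junk value of
   [normal_prob] at standard deviation 0 (the uniform law on [0, 1]) is never
   reached. *)
Definition limit_variance (R : realType) (D : nat) (a : nat -> R) : R :=
  \sum_(2 <= l < D.+1) a l ^+ 2 * l`!%:R * \sum_(0 <= s < l) f_coef R l s.

(* Main.v *)
(** Write [N = n + 1] for the size. Since the circulant matrix is a polynomial in
    the cyclic shift, [Tr (C ^ k)] is [N] times the sum of [x_(f 1) ... x_(f k)]
    over the words [f] in Z/N with zero sum. The non-injective words contribute
    o(1) in L^2, because each repetition costs a free index. The injective words
    give a multilinear polynomial [W = sum_A c_A X_A] in the independent
    variables, to which Stein's method applies: with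
    [U = sum_A (c_A / |A|) X_A] one has [W = sum_i X_i (d_i U)], and a
    leave-one-out expansion gives [E (W f(W)) ~ E (G f'(W))] with
    [G = sum_i (d_i U) (d_i W)]. Here [E G = sum_A c_A ^ 2] tends to the
    limiting variance, while [Var G] and [sum_i E (d_i W) ^ 4] are sums over
    quadruples of sets in which every element is covered at least twice; these are
    counted through the linear constraints modulo [N]. Taking for [f] the solution
    of the Stein equation of a piecewise linear approximation of an indicator,
    which is controlled by the Mills ratio, yields the distribution functions. *)
Require Import Defs.
From HB Require Import structures.
From mathcomp Require Import all_boot all_order all_algebra finmap.
From mathcomp Require Import zify ring lra.

Set Implicit Arguments.
Unset Strict Implicit.
Unset Printing Implicit Defensive.

Import Order.TTheory GRing.Theory Num.Theory.

(** * Counting words *)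

(** By an identity for Eulerian numbers the inner sums of the limiting variance equal 1, so this
    variance is [sum_l a_l ^ 2 l!]. All counts need constants independent of [N], while the
    congruences carry multiplicities: [c x = b] modulo [N] does not determine [x] when [c] and [N]
    have a common factor. Storing the quotient of [c x] by [N], which is bounded, removes the
    ambiguity. With [s = sqrt N], a family of sets of total size [m] has weight [s ^- m]. Coverage
    at least twice leaves [m / 2] free values, which only gives O(1). The decisive case is exact
    double coverage, where a congruence must contain some element with coefficient one. For [Var G]
    it exists because pairs with disjoint supports have zero covariance; for the fourth moments,
    because the four sets have congruent sums and are nonempty, the polynomial having no term of
    degree below 2. The resulting errors are O(1/s). Absolute values are bounded by
    [2 |y| <= e + y ^ 2 / e], and the weight [e = s ^ (- 1/2)] yields the rate [N ^ (- 1/4)]. *)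

Section words.
Variables (N : nat) (Pos : finType).
Hypothesis N0 : 0 < N.
Implicit Types (h : {ffun Pos -> 'I_N}) (S : {set Pos}).

Definition pattern h : {ffun Pos * Pos -> bool} :=
  [ffun pq => h pq.1 == h pq.2].

(* Modulo [N], the value [c * x] determines [x] once the quotient of [c * x] by
   [N] is known; this records the quotients for all possible multiplicities. *)
Definition quotients h : {ffun 'I_#|Pos|.+1 * Pos -> 'I_#|Pos|.+1} :=
  [ffun cp : 'I_#|Pos|.+1 * Pos => inord (nat_of_ord cp.1 * h cp.2 %/ N)].

Definition fibre h p : {set Pos} := [set q | h q == h p].

Lemma pattern_eq h h' p q : pattern h = pattern h' -> (h p == h q) = (h' p == h' q).
Proof. by move=> /ffunP/(_ (p, q)); rewrite !ffunE. Qed.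

(** Each word of [H] is encoded injectively by its code, its determining set [D] and its restriction
    to [D]; these take at most [#|K|], [2 ^ #|Pos|] and [N ^ e] values. *)
Lemma card_words_determined (K : finType) (code : {ffun Pos -> 'I_N} -> K)
    (H : {set {ffun Pos -> 'I_N}}) (e : nat) :
  (forall h, h \in H -> exists2 D : {set Pos}, #|D| <= e &
     forall h', h' \in H -> code h = code h' -> {in D, h =1 h'} -> h = h') ->
  #|H| <= #|K| * 2 ^ #|Pos| * N ^ e.
Proof.
move=> HD; pose i0 : 'I_N := Ordinal N0.
pose okD h (D : {set Pos}) := (#|D| <= e) && [forall h' in H,
  (code h == code h') ==> [forall p in D, h p == h' p] ==> (h == h')].
pose D h := odflt set0 [pick D | okD h D].
have DP h : h \in H -> okD h (D h).
  move=> hH; rewrite /D; case: pickP => //= abs.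
  have [D0 D0e D0P] := HD h hH; move: (abs D0); rewrite /okD D0e /= => /negP[].
  apply/forall_inP => h' h'H; apply/implyP => /eqP ch; apply/implyP => /forall_inP eh.
  by apply/eqP; apply: D0P => // p pD; apply/eqP/eh.
(* Off [D h] the word is overwritten by the default letter [i0], so that all restrictions live in
   one type. *)
pose F h := (code h, D h, [ffun p => if p \in D h then h p else i0]).
have Finj : {in H &, injective F}.
  move=> h h' hH h'H [ch Dh /ffunP rh].
  have /andP[_ /forall_inP/(_ _ h'H)] := DP _ hH.
  rewrite ch eqxx /= => /implyP H1; apply/eqP/H1; apply/forall_inP => p pD.
  by have := rh p; rewrite !ffunE -Dh pD => ->.
rewrite -(card_in_imset Finj).
pose G (kD : K * {set Pos}) := [set (kD, g) | g in pffun_on i0 kD.2 predT].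
have sub : F @: H \subset \bigcup_(kD : K * {set Pos} | #|kD.2| <= e) G kD.
  apply/subsetP => _ /imsetP[h hH ->]; apply/bigcupP; exists (code h, D h).
    by case/andP: (DP _ hH).
  apply/imsetP; exists [ffun p => if p \in D h then h p else i0] => //.
  apply/pffun_onP; split => //.
  apply/subsetP => p; rewrite inE ffunE; case: ifP => //; by rewrite eqxx.
apply: leq_trans (subset_leq_card sub) _.
apply: (@leq_trans (\sum_(kD : K * {set Pos} | #|kD.2| <= e) N ^ e)).
  idtac.
  apply: leq_trans (_ : \sum_(kD : K * {set Pos} | #|kD.2| <= e) #|G kD| <= _).
    elim/big_rec2: _ => [|kD n A _ IH]; first by rewrite cards0.
    by apply: leq_trans (leq_card_setU _ _) _; rewrite leq_add2l.
  apply: leq_sum => kD kDe.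
  apply: leq_trans (leq_imset_card _ _) _.
  rewrite card_pffun_on card_ord; exact: leq_pexp2l.
rewrite sum_nat_const leq_mul2r; apply/orP; right.
apply: leq_trans (max_card _) _.
by rewrite card_prod -(cardsT {set Pos}) -powersetT card_powerset cardsT.
Qed.

(** [D] keeps one position, the one returned by [pick], in each fibre whose value lies outside [B];
    the pattern carries this value to the rest of the fibre. [B] is meant for the values to be
    recovered from congruences. *)
Lemma representatives h (B : {set 'I_N}) :
  exists2 D : {set Pos}, #|D| <= #|(h @: [set: Pos]) :\: B| &
    forall h', pattern h = pattern h' -> {in D, h =1 h'} ->
      forall p, h p \notin B -> h p = h' p.
Proof.
pose s (v : 'I_N) := [pick q | h q == v].
pose D := [set p | (s (h p) == Some p) && (h p \notin B)].
exists D.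
  have hD : {in D &, injective h}.
    move=> p q; rewrite !inE => /andP[/eqP Ep _] /andP[/eqP Eq _] hpq.
    by move: Ep; rewrite hpq Eq => -[].
  rewrite -(card_in_imset hD); apply: subset_leq_card.
  apply/subsetP => _ /imsetP[p pD ->]; move: pD; rewrite !inE => /andP[_ ->] /=.
  exact: imset_f.
move=> h' pat eqD p pB.
have [r Er hr] : exists2 r, s (h p) = Some r & h r = h p.
  rewrite /s; case: pickP => [r /eqP|/(_ p)]; first by exists r.
  by rewrite eqxx.
rewrite -hr eqD ?inE ?hr ?Er ?eqxx //; apply/eqP.
by rewrite -(pattern_eq r p pat) hr.
Qed.

(** The fibres partition the positions, so 2 is compared with the size of the fibre for each value;
    the equality case is that of a termwise inequality. *)
Lemma leq_card_fibres h : (forall p, 1 < #|fibre h p|) ->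
  (#|h @: [set: Pos]|.*2 <= #|Pos| ?= iff [forall p, #|fibre h p| == 2])%N.
Proof.
move=> h2.
have E : #|Pos| = \sum_(v in h @: [set: Pos]) #|[set q | h q == v]|.
  rewrite -cardsT -sum1_card (partition_big_imset h) /=.
  apply: eq_bigr => v _; rewrite -sum1_card; apply: eq_bigl => q.
  by rewrite !inE.
rewrite E -muln2 -sum_nat_const.
have -> : [forall p, #|fibre h p| == 2] =
    [forall (v | v \in h @: [set: Pos]), 2 == #|[set q | h q == v]|].
  apply/forallP/forall_inP => [H v /imsetP[p _ ->]|H p].
    by rewrite eq_sym; exact: (H p).
  by rewrite eq_sym; apply: H; apply: imset_f.
apply: leqif_sum => v /imsetP[p _ ->]; split=> //; exact: (h2 p).
Qed.

Lemma eq_modn_mull c a b : 0 < c -> a < N -> b < N ->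
  c * a = c * b %[mod N] -> c * a %/ N = c * b %/ N -> a = b.
Proof.
move=> c0 aN bN em ed.
have : c * a = c * b by rewrite (divn_eq (c * a) N) em ed -divn_eq.
by move=> /eqP; rewrite eqn_mul2l (gtn_eqF c0) /= => /eqP.
Qed.

(** Splitting [S] along the fibre of [p0] turns the congruence into [c * h p0 + r = 0] modulo [N],
    where [c] counts the positions of the fibre in [S] and the rest [r] is common to both words.
    Since [c] may fail to be invertible, the recorded quotient of [c * h p0] by [N] is used too. *)
Lemma solve_fibre h h' S p0 :
  pattern h = pattern h' -> quotients h = quotients h' -> p0 \in S ->
  (forall p, p \in S -> h p != h p0 -> h p = h' p) ->
  N %| \sum_(p in S) h p -> N %| \sum_(p in S) h' p -> h p0 = h' p0.
Proof.
move=> pat quo p0S eqh.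
rewrite (bigID (fun p => h p == h p0)) [in X in _ -> X -> _](bigID (fun p => h p == h p0)) /=.
set A := [set p in S | h p == h p0].
have -> : \sum_(p in S | h p == h p0) h p = #|A| * h p0.
  rewrite -sum_nat_const; apply: eq_big => [p|p /andP[_ /eqP ->]] //.
  by rewrite inE.
have -> : \sum_(p in S | h p == h p0) h' p = #|A| * h' p0.
  rewrite -sum_nat_const; apply: eq_big => [p|p /andP[_]]; first by rewrite inE.
  by rewrite (pattern_eq _ _ pat) => /eqP ->.
rewrite -(@eq_bigr _ _ _ _ _ _ (fun p => nat_of_ord (h p)) (fun p => nat_of_ord (h' p))); last first.
  by move=> p /andP[pS hp]; rewrite eqh.
move: (\sum_(_ in S | _) _) => s d1 d2.
have A0 : 0 < #|A| by apply/card_gt0P; exists p0; rewrite inE p0S eqxx.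
have AP : #|A| < #|Pos|.+1 by rewrite ltnS max_card.
have bnd (i : 'I_N) : #|A| * i %/ N < #|Pos|.+1.
  rewrite ltn_divLR //; apply: (@leq_ltn_trans (#|A| * N)); last by rewrite ltn_mul2r N0.
  by rewrite leq_mul2l (ltnW (ltn_ord i)) orbT.
apply/val_inj/(@eq_modn_mull #|A|) => //; try exact: ltn_ord.
  apply/eqP; rewrite -(eqn_modDr s); apply/eqP.
  by move: d1 d2; rewrite /dvdn => /eqP -> /eqP ->.
move/ffunP: quo => /(_ (Ordinal AP, p0)); rewrite !ffunE /=.
by move=> /(congr1 val); rewrite /= !inordK.
Qed.

(** Here [p0] enters the congruence with coefficient one, so everything else can be cancelled
    directly. *)
Lemma solve_singleton h h' S S' p0 :
  p0 \in S -> p0 \notin S' ->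
  (forall p, p \in S :|: S' -> p != p0 -> h p = h' p) ->
  \sum_(p in S) h p = \sum_(p in S') h p %[mod N] ->
  \sum_(p in S) h' p = \sum_(p in S') h' p %[mod N] -> h p0 = h' p0.
Proof.
move=> p0S p0S' eqh; rewrite !(big_setD1 p0 p0S) /=.
have -> : \sum_(p in S') h p = \sum_(p in S') h' p.
  apply: eq_bigr => p pS'; rewrite eqh ?inE ?pS' ?orbT //.
  by apply: contraNneq p0S' => <-.
have -> : \sum_(p in S :\ p0) h p = \sum_(p in S :\ p0) h' p.
  by apply: eq_bigr => p; rewrite !inE => /andP[pp pS]; rewrite eqh // inE pS.
move=> <- /esym/eqP; rewrite eqn_modDr !modn_small // => /eqP e.
exact/val_inj.
Qed.


(** The number of codes times the number of sets of determining positions. It depends on [Pos]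
    alone, so the bounds below are uniform in [N]. *)
Definition word_const : nat :=
  #|{: {ffun Pos * Pos -> bool} *
       {ffun 'I_#|Pos|.+1 * Pos -> 'I_#|Pos|.+1}}| * 2 ^ #|Pos|.

(** [B] collects the values forced by the congruences; only the other values of [h] count as free
    indices. *)
Lemma card_words_free (H : {set {ffun Pos -> 'I_N}}) (e : nat) :
  (forall h, h \in H -> exists B : {set 'I_N},
     #|(h @: [set: Pos]) :\: B| <= e /\
     forall h', h' \in H -> pattern h = pattern h' ->
       quotients h = quotients h' -> (forall p, h p \notin B -> h p = h' p) ->
       forall p, h p \in B -> h p = h' p) ->
  #|H| <= word_const * N ^ e.
Proof.
move=> HB; apply: (card_words_determined (code := fun h => (pattern h, quotients h))).
move=> h hH; have [B [Be BP]] := HB h hH.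
have [D De DP] := representatives h B.
exists D; first exact: leq_trans De Be.
move=> h' h'H [pat quo] eD; have e1 := DP _ pat eD.
apply/ffunP => p; have [pB|pB] := boolP (h p \in B); last exact: e1.
exact: BP.
Qed.

(** A repetition leaves at most [#|Pos| - 1] distinct values, and the congruence is solved for one
    of them. *)
Lemma card_noninjective_words :
  #|[set h : {ffun Pos -> 'I_N} | ~~ injectiveb h & N %| \sum_p h p]|
    <= word_const * N ^ (#|Pos| - 2).
Proof.
apply: card_words_free => h; rewrite inE => /andP[ninj hN].
have [p0 [q0 pq0 hpq0]] : exists p, exists2 q, p != q & h p = h q.
  by have /injectivePn[p [q pq E]] := ninj; exists p, q.
exists [set h p0]; split.
  have := cardsD1 (h p0) (h @: [set: Pos]); rewrite imset_f ?inE // => E.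
  suff : #|h @: [set: Pos]| < #|Pos| by move: E; lia.
  rewrite ltn_neqAle -cardsT leq_imset_card andbT.
  apply/negP => /imset_injP inj; move/negP: pq0; apply.
  by apply/eqP/inj; rewrite ?inE.
move=> h'; rewrite inE => /andP[_ h'N] pat quo eB p.
rewrite inE => /eqP hp.
have E0 : h p0 = h' p0.
  apply: (@solve_fibre h h' [set: Pos]) => //; rewrite ?inE //.
  - by move=> r _ hr; apply: eB; rewrite inE.
  - by under eq_bigl do rewrite inE.
  - by under eq_bigl do rewrite inE.
by rewrite hp E0; apply/eqP; rewrite -(pattern_eq _ _ pat) hp.
Qed.

(* With all fibres of size at least 2 there are at most [#|Pos| / 2] values. When
   this is attained all fibres have size 2, and the congruence then determines
   the value carried by [p0] from the others. *)
Lemma card_even_words (H : {set {ffun Pos -> 'I_N}}) :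
  (forall h, h \in H -> forall p, 1 < #|fibre h p|) ->
  (forall h, h \in H -> (forall p, #|fibre h p| = 2) ->
    exists S S' p0, [/\ p0 \in S, p0 \notin S',
      forall p, p \in S :|: S' -> h p = h p0 -> p = p0 &
      forall h', h' \in H ->
        \sum_(p in S) h' p = \sum_(p in S') h' p %[mod N]]) ->
  #|H| <= word_const * N ^ #|Pos|.-1./2.
Proof.
move=> H2 HS; apply: card_words_free => h hH.
have := leq_card_fibres (H2 _ hH).
have [/forallP all2|nall] := boolP [forall p, #|fibre h p| == 2]; last first.
  move=> /leqifP; move=> lt; exists set0.
  split; first by rewrite setD0; lia.
  by move=> h' _ _ _ _ p; rewrite inE.
move=> [_ /eqP cardV].
have [S [S' [p0 [p0S p0S' sing con]]]] := HS _ hH (fun p => eqP (all2 p)).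
exists [set h p0]; split.
  have := cardsD1 (h p0) (h @: [set: Pos]); rewrite imset_f ?inE //; lia.
move=> h' h'H pat quo eB p; rewrite inE => /eqP hp.
have E0 : h p0 = h' p0.
  apply: (@solve_singleton h h' S S') => //; last 2 first.
  - exact: con.
  - exact: con.
  move=> r rS rp; apply: eB; rewrite inE; apply: contra_neqN rp => /eqP.
  exact: sing.
by rewrite hp E0; apply/eqP; rewrite -(pattern_eq _ _ pat) hp.
Qed.

End words.

(** The two words have [2 k] positions, hence at most [k] values. If some fibre has more than 2
    elements, at most [k - 1] values occur and a single congruence removes one more. If all fibres
    have size 2, each word contains a whole fibre, and the two congruences remove one value each. *)
Lemma card_noninjective_pairs (N k : nat) : 0 < N ->
  #|[set h : {ffun bool * 'I_k -> 'I_N} |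
     [&& [forall p, 1 < #|fibre h p|],
         [forall b, ~~ injectiveb [ffun j => h (b, j)]] &
         [forall b, N %| \sum_j h (b, j)]]]|
    <= word_const (bool * 'I_k)%type * N ^ (k - 2).
Proof.
move=> N0; apply: card_words_free => // h.
rewrite inE => /and3P[/forallP h2 /forallP hinj /forallP hN].
have cardP : #|{: bool * 'I_k}| = k.*2 by rewrite card_prod card_bool card_ord mul2n.
have := leq_card_fibres h2; rewrite [X in _ <= X ?= iff _ -> _]cardP.
pose S b : {set bool * 'I_k} := [set p | p.1 == b].
have sumS (g : {ffun bool * 'I_k -> 'I_N}) b :
    \sum_(p in S b) g p = \sum_j g (b, j).
  rewrite (reindex_onto (pair b) snd) /=; last by case=> b' j; rewrite inE /= => /eqP ->.
  by apply: eq_bigl => j; rewrite inE !eqxx.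
have [p [q [pq hpq]]] : exists p q : bool -> 'I_k, (forall b, p b != q b) /\
    forall b, h (b, p b) = h (b, q b).
  have ex b : {pq | (pq.1 != pq.2) && (h (b, pq.1) == h (b, pq.2))}.
    apply: sigW; have /injectivePn[p [q pq]] := hinj b.
    by rewrite !ffunE => E; exists (p, q); rewrite pq E eqxx.
  exists (fun b => (sval (ex b)).1), (fun b => (sval (ex b)).2).
  by split=> b; case: (ex b) => /= -[? ?] /= /andP[? /eqP].
have [/forallP all2|nall] := boolP [forall p, #|fibre h p| == 2]; last first.
  move=> /leqifP; rewrite ltn_double => lt.
  exists [set h (true, p true)]; split.
    have := cardsD1 (h (true, p true)) (h @: setT); rewrite imset_f ?inE //; lia.
  move=> h'; rewrite inE => /and3P[_ _ /forallP h'N] pat quo eB r.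
  rewrite inE => /eqP hr.
  have E0 : h (true, p true) = h' (true, p true).
    apply: (@solve_fibre _ _ N0 h h' (S true)) => //; rewrite ?inE ?sumS //.
    by move=> s _ hs; apply: eB; rewrite inE.
  by rewrite hr E0; apply/eqP; rewrite -(pattern_eq _ _ pat) hr.
move=> [_ /eqP /double_inj cardV].
(* A repeated letter of the word [b] already fills its fibre of size 2, so it does not occur in the
   other word. *)
have fib b r : h r = h (b, p b) -> r.1 = b.
  move=> hr; have : r \in fibre h (b, p b) by rewrite inE hr.
  have -> : fibre h (b, p b) = [set (b, p b); (b, q b)].
    apply/esym/eqP; rewrite eqEcard (eqP (all2 _)) cards2 xpair_eqE eqxx pq.
    by rewrite subUset !sub1set !inE eqxx hpq eqxx.
  by rewrite !inE => /orP[] /eqP ->.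
pose v b := h (b, p b).
have vv : v true != v false by apply/negP => /eqP /fib.
exists [set v true; v false]; split.
  rewrite cardsDS; first by rewrite cards2 vv; lia.
  by apply/subsetP => x; rewrite !inE => /orP[] /eqP ->; exact: imset_f.
move=> h'; rewrite inE => /and3P[_ _ /forallP h'N] pat quo eB r.
have E0 b : h (b, p b) = h' (b, p b).
  apply: (@solve_fibre _ _ N0 h h' (S b)) => //; rewrite ?inE ?sumS //.
  move=> s; rewrite inE => /eqP sb hs; apply: eB; rewrite !inE.
  apply/norP; split; apply: contra hs => /eqP hs.
    by have := fib _ _ hs; rewrite sb => bt; rewrite bt hs.
  by have := fib _ _ hs; rewrite sb => bt; rewrite bt hs.
by rewrite !inE => /orP[] /eqP hr; rewrite hr /v E0; apply/eqP;
   rewrite -(pattern_eq _ _ pat) hr.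
Qed.

(** * Families of sets with congruent sums *)

Section set_systems.
Variables (N : nat) (I Z : finType) (comp : Z -> I -> {set 'I_N}).
Hypothesis N0 : 0 < N.
Hypothesis comp_inj : forall z z', comp z =1 comp z' -> z = z'.

Let mult z v := #|[set t | v \in comp z t]|.

Section fixed_sizes.
Variable k : I -> nat.
Let Pos := {t : I & 'I_(k t)}.

(** Listing each component by [enum] turns a family with prescribed sizes into a word whose fibre
    sizes are the multiplicities [mult]. *)
Let word z : {ffun Pos -> 'I_N} :=
  [ffun p : Pos => nth (Ordinal N0) (enum (comp z (tag p))) (nat_of_ord (tagged p))].

Let sized z := forall t, #|comp z t| = k t.

Let word_comp z p : sized z -> word z p \in comp z (tag p).
Proof.
move=> zk; rewrite ffunE -mem_enum mem_nth // -cardE zk; exact: (ltn_ord (tagged p)).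
Qed.

Let word_inj z p q : sized z -> tag p = tag q -> word z p = word z q -> p = q.
Proof.
move=> zk; case: p q => [t i] [t' j] /= tt'; case: _ / tt' j => j.
rewrite !ffunE /= => /eqP; rewrite nth_uniq ?enum_uniq -?cardE ?zk //.
by move=> /eqP/val_inj ->.
Qed.

Let word_surj z t v : sized z -> v \in comp z t -> exists2 p, tag p = t & word z p = v.
Proof.
move=> zk; rewrite -mem_enum => vt.
have lt : index v (enum (comp z t)) < k t by rewrite -zk cardE index_mem.
by exists (Tagged _ (Ordinal lt) : Pos) => //; rewrite ffunE /= nth_index.
Qed.

Let tag_fibre z p : sized z -> tag @: fibre (word z) p = [set t | word z p \in comp z t].
Proof.
move=> zk; apply/setP => t; rewrite inE; apply/imsetP/idP => [[q + ->]|].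
  by rewrite inE => /eqP <-; exact: word_comp.
by move=> /(word_surj zk)[q <- E]; exists q; rewrite // inE E.
Qed.

Let card_word_fibre z p : sized z -> #|fibre (word z) p| = mult z (word z p).
Proof.
move=> zk; rewrite /mult -tag_fibre // card_in_imset // => q r.
by rewrite !inE => /eqP Eq /eqP Er tqr; apply: word_inj; rewrite // Eq.
Qed.

Let sum_word z t : sized z ->
  \sum_(p | p \in [set p : Pos | tag p == t]) word z p = \sum_(v in comp z t) v.
Proof.
move=> zk; have -> : comp z t = word z @: [set p : Pos | tag p == t].
  apply/setP => v; apply/idP/imsetP => [/(word_surj zk)[p pt <-]|[p + ->]].
    by exists p; rewrite // inE pt.
  by rewrite inE => /eqP <-; exact: word_comp.
rewrite big_imset // => p q; rewrite !inE => /eqP tp /eqP tq.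
by apply: (word_inj zk); rewrite tp tq.
Qed.


(** The relation [e] marks components whose sums agree modulo [N]. When all multiplicities are 2, an
    element of one such component that is absent from the other occurs once in their congruence,
    which is what [card_even_words] asks for. *)
Lemma card_set_systems_sized (H : {set Z}) (e : rel I) :
  (forall z, z \in H -> sized z) ->
  (forall z v, z \in H -> mult z v != 1) ->
  (forall z t t', z \in H -> e t t' ->
     \sum_(v in comp z t) v = \sum_(v in comp z t') v %[mod N]) ->
  (forall z, z \in H -> (forall v, mult z v <= 2) ->
     exists v t t', [/\ e t t', v \in comp z t & v \notin comp z t']) ->
  #|H| <= word_const {t : I & 'I_(k t)} * N ^ (\sum_t k t).-1./2.
Proof.
move=> Hk H1 He H2.
have winj : {in H &, injective word}.
  move=> z z' /Hk zk /Hk zk' ww; apply: comp_inj => t; apply/setP => v.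
  apply/idP/idP => [/(word_surj zk)|/(word_surj zk')] [p <- <-].
    by rewrite ww; apply: word_comp.
  by rewrite -ww; apply: word_comp.
rewrite -(card_in_imset winj).
have -> : \sum_t k t = #|{: {t : I & 'I_(k t)}}|.
  by rewrite card_tagged sumnE big_map big_enum /=; apply: eq_bigr => t _; rewrite card_ord.
apply: card_even_words => // _ /imsetP[z zH ->].
  move=> p; rewrite card_word_fibre; last exact: Hk.
  rewrite ltn_neqAle eq_sym H1 //=; apply/card_gt0P; exists (tag p).
  rewrite inE; exact/word_comp/Hk.
move=> fib2.
have [|v [t [t' [ett vt vt']]]] := H2 z zH.
  move=> v; have [/eqP ->|] := boolP (mult z v == 0) => //.
  rewrite -lt0n => /card_gt0P[t]; rewrite inE => /(word_surj (Hk _ zH))[p _ <-].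
  by rewrite -card_word_fibre ?fib2 //; apply: Hk.
have [p0 p0t wp0] := word_surj (Hk _ zH) vt.
exists [set p | tag p == t], [set p | tag p == t'], p0; split.
- by rewrite inE p0t.
- rewrite inE p0t; apply: contraNneq vt' => <-; exact: vt.
- move=> p; rewrite !inE => /orP[] /eqP pt E.
    by apply: (word_inj (Hk _ zH)) => //; rewrite pt.
  by have := word_comp p (Hk _ zH); rewrite pt E wp0 (negPf vt').
- move=> _ /imsetP[z' z'H ->]; rewrite !sum_word; try exact: Hk.
  exact: He.
Qed.

End fixed_sizes.

(** For a given profile of sizes of total [m] there are O([N ^ (m.-1)./2]) families, each of weight
    [s ^- m], and [N = s ^ 2]: one factor [1 / s] is left. The number of profiles does not depend on
    [N]. *)
Lemma weighted_set_systems (R : realFieldType) (s : R) (d : nat) (H : {set Z}) (e : rel I) :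
  (0 < s)%R -> (s ^+ 2 = N%:R)%R ->
  (forall z t, z \in H -> #|comp z t| < d) ->
  (forall z v, z \in H -> mult z v != 1) ->
  (forall z t t', z \in H -> e t t' ->
     \sum_(v in comp z t) v = \sum_(v in comp z t') v %[mod N]) ->
  (forall z, z \in H -> (forall v, mult z v <= 2) ->
     exists v t t', [/\ e t t', v \in comp z t & v \notin comp z t']) ->
  (\sum_(z in H) s^-1 ^+ (\sum_t #|comp z t|)%N <=
    (\sum_(k : {ffun I -> 'I_d}) word_const {t : I & 'I_(k t)})%:R / s)%R.
Proof.
move=> s0 sN Hd H1 He H2.
have [d0|d0] := posnP d.
  rewrite big1 ?divr_ge0 ?ler0n ?ltW // => z zH.
  have z0 t : comp z t = set0 by have := Hd z t zH; rewrite d0.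
  have [|v [t [t' [_ vt _]]]] := H2 z zH; last by rewrite z0 inE in vt.
  by move=> v; apply: (@leq_trans 0) => //; rewrite leqn0 cards_eq0;
    apply/eqP/setP => t; rewrite !inE z0 inE.
case: d d0 Hd => // d _ Hd.
pose sz z : {ffun I -> 'I_d.+1} := [ffun t => inord #|comp z t|].
rewrite (partition_big sz predT) //= natr_sum mulr_suml.
apply: ler_sum => k _.
pose Hk := [set z in H | sz z == k].
have HkH z : z \in Hk -> z \in H by rewrite inE => /andP[].
have szk z : z \in Hk -> forall t, #|comp z t| = k t.
  by rewrite inE => /andP[zH /eqP <-] t; rewrite ffunE inordK // Hd.
have [E0|/set0Pn[z0 z0H]] := eqVneq Hk set0.
  rewrite big1 ?divr_ge0 ?ler0n ?ltW // => z zHk.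
  by have := in_set0 z; rewrite -E0 inE zHk.
set m := \sum_t k t.
(* A total size zero would make all components empty, whereas [H2] provides an element of one of
   them. *)
have m0 : 0 < m.
  rewrite lt0n; apply/negP => /eqP; rewrite /m => /eqP; rewrite sum_nat_eq0 => /forall_inP k0.
  have z00 t : comp z0 t = set0 by apply/eqP; rewrite -cards_eq0 (szk _ z0H) k0.
  have [|v [t [t' [_ vt _]]]] := H2 z0 (HkH _ z0H); last by rewrite z00 inE in vt.
  by move=> v; apply: (@leq_trans 0) => //; rewrite leqn0 cards_eq0;
    apply/eqP/setP => t; rewrite !inE z00 inE.
have s1 : (1 <= s)%R.
  by rewrite leNgt; apply/negP => s_lt1; have : (s ^+ 2 < 1)%R;
    [rewrite expr_lt1 // ltW|rewrite sN ltrn1; case: (N) N0].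
have cardHk : #|Hk| <= word_const {t : I & 'I_(k t)} * N ^ m.-1./2.
  apply: (@card_set_systems_sized _ Hk e) => //.
  - by move=> z v /HkH; apply: H1.
  - by move=> z t t' /HkH; apply: He.
  - by move=> z /HkH; apply: H2.
rewrite (eq_bigl (fun z => z \in Hk)); last by move=> z; rewrite inE.
rewrite (eq_bigr (fun=> s^-1 ^+ m)%R); last first.
  by move=> z zH; congr (_ ^+ _)%R; apply: eq_bigr => t _; rewrite (szk _ zH).
rewrite sumr_const -[X in (X <= _)%R]mulr_natl.
apply: (@le_trans _ _ ((word_const {t : I & 'I_(k t)} * N ^ m.-1./2)%:R * s^-1 ^+ m)%R).
  by apply: ler_wpM2r; [rewrite exprn_ge0 // invr_ge0 ltW|rewrite ler_nat].
rewrite natrM -mulrA; apply: ler_wpM2l; first exact: ler0n.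
rewrite natrX -sN -exprM.
(* Twice the integer half of [m - 1] is at most [m - 1], so a factor [1 / s] is gained whatever the
   parity of [m]. *)
set q := (2 * m.-1./2)%N.
have le : (s^-1 ^+ m <= s^-1 ^+ q.+1)%R.
  have qm : q.+1 <= m by rewrite /q; move: m0; clearbody m; lia.
  by apply: ler_wiXn2l; rewrite ?invr_ge0 ?(ltW s0) ?invf_le1.
apply: le_trans (ler_wpM2l _ le) _; first by rewrite exprn_ge0 // ltW.
by rewrite exprS mulrCA -exprMn divff ?gt_eqF // expr1n mulr1.
Qed.
End set_systems.

(** * The trace of a power of a circulant matrix *)

(** Words are grouped by image: a set of size [k] is the image of [k!] injective words, all with the
    same sum and the same product. *)
Lemma sum_injective_words (R : comNzRingType) (N k : nat) (Y : 'I_N -> R) (Q : pred nat) :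
  (\sum_(f : {ffun 'I_k -> 'I_N} | injectiveb f && Q (\sum_j f j)%N) \prod_j Y (f j) =
   k`!%:R * \sum_(A : {set 'I_N} | (#|A| == k) && Q (\sum_(i in A) i)%N)
              \prod_(i in A) Y i)%R.
Proof.
pose im (f : {ffun 'I_k -> 'I_N}) := f @: [set: 'I_k].
rewrite (partition_big im (fun A => (#|A| == k) && Q (\sum_(i in A) i)%N)) /=.
  rewrite mulr_sumr; apply: eq_bigr => A /andP[/eqP Ak QA].
  rewrite (eq_bigl (fun f => f \in [set f : {ffun 'I_k -> 'I_N} in ffun_on (mem A) | injectiveb f])).
    rewrite (eq_bigr (fun=> (\prod_(i in A) Y i)%R)).
      by rewrite sumr_const card_inj_ffuns_on Ak card_ord ffactnn mulr_natl.
    move=> f; rewrite !inE => /andP[/ffun_onP fA /injectiveP finj].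
    have -> : A = im f.
      apply/esym/eqP; rewrite eqEcard Ak card_imset // cardsT card_ord leqnn andbT.
      by apply/subsetP => _ /imsetP[j _ ->]; apply: fA.
    rewrite big_imset; last by move=> ? ? _ _; apply: finj.
    by apply: eq_bigl => j; rewrite inE.
  move=> f; rewrite !inE; apply/andP/andP => [[/andP[finj _] /eqP <-]|[/ffun_onP fA finj]].
    by split => //; apply/ffun_onP => j; apply: imset_f; rewrite inE.
  have -> : im f = A.
    apply/eqP; rewrite eqEcard Ak card_imset ?cardsT ?card_ord ?leqnn ?andbT; last exact/injectiveP.
    by apply/subsetP => _ /imsetP[j _ ->]; apply: fA.
  split => //; rewrite finj /=.
  have -> // : (\sum_j f j = \sum_(i in A) i)%N.
  have -> : A = im f.
    apply/esym/eqP; rewrite eqEcard Ak card_imset ?cardsT ?card_ord ?leqnn ?andbT; last exact/injectiveP.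
    by apply/subsetP => _ /imsetP[j _ ->]; apply: fA.
  rewrite big_imset; last by move=> ? ? _ _; apply: (injectiveP _ finj).
  by apply: eq_bigl => j; rewrite inE.
move=> f /andP[/injectiveP finj Qf]; rewrite /im card_imset // cardsT card_ord eqxx /=.
rewrite big_imset; last by move=> ? ? _ _; apply: finj.
by rewrite (eq_bigl predT) // => j; rewrite inE.
Qed.

(** The letter at [ord0] is determined by the others, which are free. *)
Lemma card_zero_sum_words (N k : nat) : 0 < N ->
  #|[set f : {ffun 'I_k.+1 -> 'I_N} | N %| \sum_j f j]| = N ^ k.
Proof.
move=> N0.
pose c (m : nat) : 'I_N := Ordinal (ltn_pmod (N - m %% N) N0).
have cP m : N %| c m + m.
  by rewrite /dvdn /= modnDml -modnDmr subnK ?modnn // ltnW // ltn_pmod.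
pose ext (g : {ffun 'I_k -> 'I_N}) : {ffun 'I_k.+1 -> 'I_N} :=
  [ffun i => if unlift ord0 i is Some j then g j else c (\sum_j g j)].
have extl g (j : 'I_k) : ext g (lift ord0 j) = g j by rewrite ffunE liftK.
have ext0 g : ext g ord0 = c (\sum_j g j) by rewrite ffunE unlift_none.
have ext_inj : injective ext.
  move=> g g1 E; apply/ffunP => j; have := extl g j; rewrite E => <-; exact: extl.
have -> : [set f : {ffun 'I_k.+1 -> 'I_N} | N %| \sum_j f j] = ext @: [set: {ffun 'I_k -> 'I_N}].
  apply/setP => f; rewrite inE; apply/idP/imsetP => [|[g _ ->]].
    rewrite big_ord_recl => fN.
    exists [ffun j => f (lift ord0 j)] => //; apply/ffunP => i.
    case: (unliftP ord0 i) => [j|] ->; first by rewrite !ffunE liftK ?ffunE.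
    rewrite ext0; under eq_bigr do rewrite ffunE.
    move: fN (cP (\sum_j f (lift ord0 j))); move: (\sum_j _) (c _) => m x.
    rewrite /dvdn => /eqP e1 /eqP e2; apply/val_inj.
    have : f ord0 + m = x + m %[mod N] by rewrite e1 e2.
    by move=> /eqP; rewrite eqn_modDr !modn_small // => /eqP.
  rewrite big_ord_recl ext0; under [X in (_ + X)%N]eq_bigr => j _ do rewrite (extl g j).
  exact: cP.
by rewrite card_imset // cardsT card_ffun !card_ord.
Qed.

Local Open Scope ring_scope.

(** Among the [N ^ k.+1] zero-sum words, the injective ones number [(k + 2)!] per set, and the
    others are counted by [card_noninjective_words]. *)
Lemma card_zero_sum_sets (N k : nat) : (0 < N)%N ->
  let c := (k.+2`! * #|[set A : {set 'I_N} | (#|A| == k.+2) & (N %| \sum_(i in A) i)%N]|)%N in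
  (c <= N ^ k.+1 <= c + word_const 'I_k.+2 * N ^ k)%N.
Proof.
move=> N0 /=.
(* With all factors equal to 1 in [int], the identity between sums becomes one between cardinals. *)
have := sum_injective_words k.+2 (fun _ : 'I_N => 1 : int) (fun m => N %| m)%N.
rewrite [X in X = _ -> _](eq_bigr (fun=> 1)); last by move=> f _; rewrite big1.
rewrite [X in _ = _ * X -> _](eq_bigr (fun=> 1)); last by move=> A _; rewrite big1.
rewrite !sumr_const -natrM => /eqP; rewrite eqr_nat => /eqP.
have -> : #|[set A : {set 'I_N} | (#|A| == k.+2) & (N %| \sum_(i in A) i)%N]| =
  #|[pred A : {set 'I_N} | (#|A| == k.+2) && (N %| \sum_(i in A) i)%N]|.
  by apply: eq_card => A; rewrite !inE.
move=> <-.
rewrite -(card_zero_sum_words k.+1 N0).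
have := card_noninjective_words 'I_k.+2 N0; rewrite card_ord subSS subn1 /= => le.
set inj := #|_|.
have -> : #|[set f : {ffun 'I_k.+2 -> 'I_N} | N %| \sum_j f j]%N| =
   (inj + #|[set h : {ffun 'I_k.+2 -> 'I_N} | ~~ injectiveb h & (N %| \sum_p h p)%N]|)%N.
  rewrite -(cardID [pred f : {ffun 'I_k.+2 -> 'I_N} | injectiveb f]); congr addn.
    by apply: eq_card => f; rewrite !inE andbC.
  by apply: eq_card => f; rewrite !inE.
by rewrite leq_addr leq_add2l.
Qed.

Lemma tr_circulant_expr (R : comNzRingType) (n : nat) (x : nat -> R) (k : nat) :
  \tr ((\matrix_(i < n.+1, j < n.+1) x ((j + (n.+1 - i)) %% n.+1)%N) ^+ k) =
  n.+1%:R * \sum_(f : {ffun 'I_k -> 'I_n.+1} | (n.+1 %| \sum_j f j)%N) \prod_j x (f j).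
Proof.
set C := \matrix_(i, j) _.
pose S : 'M[R]_n.+1 := \matrix_(i, j) (j == i + 1 %[mod n.+1])%N%:R.
have SX m : S ^+ m = \matrix_(i, j) (j == i + m %[mod n.+1])%N%:R.
  elim: m => [|m IH].
    rewrite expr0; apply/matrixP => i j; rewrite !mxE addn0 !modn_small //.
    by rewrite eq_sym.
  rewrite exprSr IH; apply/matrixP => i j; rewrite !mxE.
  rewrite (bigD1 (inord ((i + m) %% n.+1))) //= !mxE inordK ?ltn_pmod //.
  rewrite modn_mod eqxx mul1r modnDml -addnA addn1 big1 ?addr0 // => l ll.
  rewrite !mxE; case: eqP => [E|]; last by rewrite mul0r.
  case/eqP: ll; apply: val_inj; rewrite /= inordK ?ltn_pmod //.
  by rewrite -E modn_small.
have CE : C = horner_mx S (\sum_(i < n.+1) x i *: 'X^i).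
  rewrite linear_sum /=; under eq_bigr do rewrite linearZ /= rmorphXn /= horner_mx_X SX.
  apply/matrixP => i j; rewrite summxE mxE.
  rewrite (bigD1 (inord ((j + (n.+1 - i)) %% n.+1))) //= !mxE inordK ?ltn_pmod //.
  rewrite modnDmr addnCA subnKC ?modnDr ?eqxx ?mulr1; last exact: ltnW.
  rewrite big1 ?addr0 // => l ll; rewrite !mxE.
  case: eqP => [E|]; last by rewrite mulr0.
  case/eqP: ll; apply: val_inj; rewrite /= inordK ?ltn_pmod //.
  rewrite -modnDml E modnDml addnAC subnKC; last exact: ltnW.
  by rewrite modnDl modn_small.
(* Distributing the power over its [k] factors indexes the expansion by words, each carrying the
   shift by the sum of its letters. *)
have -> : C ^+ k = \sum_(f : {ffun 'I_k -> 'I_n.+1}) (\prod_j x (f j)) *: S ^+ (\sum_j f j)%N.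
  rewrite CE -rmorphXn /= -[k in LHS]card_ord -prodr_const bigA_distr_bigA /= linear_sum /=.
  apply: eq_bigr => f _.
  rewrite scaler_prod linearZ /= prodrXr rmorphXn /= horner_mx_X.
  by [].
have trS m : \tr (S ^+ m) = n.+1%:R * (n.+1 %| m)%N%:R.
  rewrite SX /mxtrace (eq_bigr (fun=> (n.+1 %| m)%N%:R)).
    by rewrite sumr_const card_ord mulr_natl.
  by move=> i _; rewrite mxE -[X in X == _ %[mod _]]addn0 eqn_modDl mod0n eq_sym.
rewrite linear_sum /= mulr_sumr [RHS]big_mkcond /=; apply: eq_bigr => f _.
rewrite linearZ /= trS; case: ifP => _; rewrite ?mulr0 // mulr1.
by rewrite -[RHS]mulrC.
Qed.

(* The left-hand side is the n-th finite difference of x ^ m at 0. *)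
Lemma sum_alternating_bin_expr (R : comNzRingType) (n m : nat) : (m <= n)%N ->
  \sum_(j < n.+1) (-1) ^+ (n - j) * 'C(n, j)%:R * j%:R ^+ m = (m == n)%:R * n`!%:R :> R.
Proof.
elim: n m => [|n IH] m mn.
  by move: mn; rewrite leqn0 => /eqP ->; rewrite big_ord1 fact0 !mulr1.
case: m mn => [_|m mn].
  have := exprDn (-1 : R) 1 n.+1; rewrite addNr expr0n mul0r => /= E.
  rewrite [RHS]E.
  by apply: eq_bigr => j _; rewrite expr0 expr1n !mulr1 mulr_natr.
rewrite big_ord_recl /= expr0n /= mulr0 add0r eqSS.
(* The identity [(j + 1) C(n + 1, j + 1) = (n + 1) C(n, j)] lowers the order, and the binomial
   formula expands [(1 + j) ^ m]. By induction only [r = m] can contribute, and only when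
   [m = n]. *)
transitivity (n.+1%:R * \sum_(r < m.+1) 'C(m, r)%:R *
    \sum_(j < n.+1) (-1) ^+ (n - j) * 'C(n, j)%:R * j%:R ^+ r : R).
  rewrite mulr_sumr; under [RHS]eq_bigr do rewrite mulr_sumr mulr_sumr.
  rewrite exchange_big; apply: eq_bigr => j _ /=.
  rewrite /bump /= add1n subSS exprSr mulrA.
  transitivity ((-1) ^+ (n - j) * (n.+1 * 'C(n, j))%:R * j.+1%:R ^+ m : R).
    by rewrite mul_bin_diag natrM; ring.
  rewrite -[j.+1]add1n natrD exprDn mulr_sumr; apply: eq_bigr => r _.
  by rewrite expr1n mul1r natrM -mulr_natr; ring.
rewrite big_ord_recr /= binn mul1r IH // big1 ?add0r.
  by case: eqP => _; rewrite ?mul0r ?mulr0 // !mul1r factS natrM.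
by move=> r _; rewrite IH ?(ltnW (leq_trans (ltn_ord r) _)) // ltn_eqF ?mul0r ?mulr0 // (leq_trans (ltn_ord r)).
Qed.

(** Pascal's rule makes the partial sums telescope; this evaluates the truncated sums over [s] in
    [sum_eulerian]. *)
Lemma sum_alternating_bin (R : comNzRingType) (n m : nat) :
  \sum_(k < m.+1) (-1) ^+ k * 'C(n.+1, k)%:R = (-1) ^+ m * 'C(n, m)%:R :> R.
Proof.
elim: m => [|m IH]; first by rewrite big_ord1 !bin0.
by rewrite big_ord_recr /= IH binS natrD exprS; ring.
Qed.

(* The summands are the values at the integers of the density of a sum of [n.+1]
   uniform variables, that is, Eulerian numbers divided by [n!]. *)
Lemma sum_eulerian (R : fieldType) (n : nat) : n`!%:R != 0 :> R ->
  \sum_(0 <= s < n.+1) (n`!%:R^-1 * \sum_(0 <= k < s.+1)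
     (-1) ^+ k * 'C(n.+1, k)%:R * (s%:R - k%:R) ^+ n) = 1 :> R.
Proof.
move=> nf; rewrite -mulr_sumr; apply: (mulfI nf); rewrite mulrA mulfV // mul1r mulr1.
have := sum_alternating_bin_expr R (leqnn n); rewrite eqxx mul1r => <-.
transitivity (\sum_(s < n.+1) \sum_(k < n.+1 | (k <= s)%N)
    (-1) ^+ k * 'C(n.+1, k)%:R * (s%:R - k%:R) ^+ n : R).
  rewrite big_mkord; apply: eq_bigr => s _.
  by rewrite big_mkord (big_ord_widen_cond n.+1 predT (fun k => (-1) ^+ k * 'C(n.+1, k)%:R * (s%:R - k%:R) ^+ n)) //.
transitivity (\sum_(s < n.+1) \sum_(j < n.+1 | (j <= s)%N)
    (-1) ^+ (s - j) * 'C(n.+1, s - j)%:R * j%:R ^+ n : R).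
  apply: eq_bigr => s _.
  have lt (k : 'I_n.+1) : (s - k < n.+1)%N by rewrite (leq_ltn_trans (leq_subr _ _)).
  rewrite (reindex_onto (fun k => Ordinal (lt k)) (fun k => Ordinal (lt k))) /=; last first.
    by move=> k ks; apply: val_inj; rewrite /= subKn.
  apply: eq_big => [k|k /andP[ks /eqP E]].
    rewrite leq_subr; apply/eqP/idP => [<- /=|ks]; first by rewrite leq_subr.
    by apply: val_inj; rewrite /= subKn.
  have ks' : (k <= s)%N by rewrite -E /= leq_subr.
  by rewrite natrB // opprB addrC subrK.
(* For a fixed [j], standing for [s - k], the sum over [s] is a partial alternating sum of
   binomials, equal to [(-1) ^ (n - j) C(n, j)]; what remains is the finite difference of
   [x ^ n]. *)
rewrite (exchange_big_dep predT) //=; apply: eq_bigr => j _.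
rewrite -mulr_suml; congr (_ * _).
transitivity (\sum_(k < (n - j).+1) (-1) ^+ k * 'C(n.+1, k)%:R : R).
  rewrite -(big_mkord predT (fun k => (-1) ^+ k * 'C(n.+1, k)%:R)).
  transitivity (\sum_(j <= s < n.+1) (-1) ^+ (s - j) * 'C(n.+1, s - j)%:R : R).
    by rewrite big_geq_mkord.
  rewrite -{1}[nat_of_ord j]add0n big_addn subSn; last by rewrite -ltnS.
  by apply: eq_bigr => s _; rewrite addnK.
by rewrite sum_alternating_bin bin_sub // -ltnS.
Qed.

From mathcomp Require Import all_classical all_reals all_analysis.
From mathcomp Require Import measurable_realfun.

Import numFieldNormedType.Exports.

(** * Moments and independence *)

Section all_moments.
Local Open Scope classical_set_scope.
Context (d : measure_display) (T : measurableType d) (R : realType) (P : probability T R).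
Implicit Types Y Z : T -> R.

(** An algebra containing the bounded measurable functions, chosen so that integrability conditions
    reduce to closure under the operations. *)
Definition all_moments Y : Prop := measurable_fun setT Y /\
  forall k, P.-integrable setT (fun w => (`|Y w| ^+ k)%:E).

Lemma all_moments_le (Y : T -> R) (Z : nat -> T -> R) : measurable_fun setT Y ->
  (forall k, P.-integrable setT (EFin \o Z k)) ->
  (forall k w, `|Y w| ^+ k <= Z k w) -> all_moments Y.
Proof.
move=> mY iZ YZ; split=> // k; apply: (le_integrable _ _ _ (iZ k)) => //.
  by apply/measurable_EFinP/measurable_funX/measurableT_comp.
move=> w _; rewrite /= lee_fin ger0_norm ?exprn_ge0 //.
exact: le_trans (YZ k w) (ler_norm _).
Qed.

Lemma all_moments_bounded Y M : measurable_fun setT Y -> (forall w, `|Y w| <= M) ->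
  all_moments Y.
Proof.
move=> mY YM; apply: (@all_moments_le _ (fun k => cst (M ^+ k))) => // k.
  exact: finite_measure_integrable_cst.
by move=> w /=; rewrite lerXn2r ?nnegrE // (le_trans _ (YM w)).
Qed.

Lemma all_moments_cst c : all_moments (fun=> c).
Proof. by apply: (@all_moments_bounded _ `|c|). Qed.

Lemma all_momentsD Y Z : all_moments Y -> all_moments Z -> all_moments (fun w => Y w + Z w).
Proof.
move=> [mY iY] [mZ iZ].
apply: (@all_moments_le _ (fun k w => 2 ^+ k * (`|Y w| ^+ k + `|Z w| ^+ k))).
- exact: measurable_funD.
- move=> k; have /= := integrableZl measurableT (2 ^+ k) (integrableD measurableT (iY k) (iZ k)).
  exact: eq_integrable.
move=> k w; have := ler_normD (Y w) (Z w).
move: `|Y w + Z w| (normr_ge0 (Y w + Z w)) `|Y w| (normr_ge0 (Y w)) `|Z w| (normr_ge0 (Z w)).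
move=> a a0 b b0 c c0 abc.
apply: (@le_trans _ _ ((2 * Num.max b c) ^+ k)).
  rewrite lerXn2r ?nnegrE ?mulr_ge0 ?le_max ?b0 //.
  by apply: le_trans abc _; case: (leP b c) => bc; lra.
rewrite exprMn ler_wpM2l ?exprn_ge0 //.
by case: (leP b c) => _; rewrite ?lerDr ?lerDl exprn_ge0.
Qed.

Lemma all_momentsM Y Z : all_moments Y -> all_moments Z -> all_moments (fun w => Y w * Z w).
Proof.
move=> [mY iY] [mZ iZ].
apply: (@all_moments_le _ (fun k w => `|Y w| ^+ k.*2 + `|Z w| ^+ k.*2)).
- exact: measurable_funM.
- by move=> k; apply: (integrableD measurableT (iY k.*2) (iZ k.*2)).
move=> k w; rewrite normrM exprMn -!muln2 !exprM.
move: (`|Y w| ^+ k) (`|Z w| ^+ k) => a b; have := sqr_ge0 (a - b); have := sqr_ge0 (a + b).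
have := sqr_ge0 a; have := sqr_ge0 b; nra.
Qed.

Lemma all_momentsN Y : all_moments Y -> all_moments (fun w => - Y w).
Proof.
move=> hY; rewrite (_ : (fun _ => _) = (fun w => -1 * Y w)).
  exact/all_momentsM/hY/all_moments_cst.
by apply/funext => w; rewrite mulN1r.
Qed.

Lemma all_momentsB Y Z : all_moments Y -> all_moments Z -> all_moments (fun w => Y w - Z w).
Proof. by move=> hY hZ; apply: all_momentsD => //; apply: all_momentsN. Qed.

Lemma all_moments_norm Y : all_moments Y -> all_moments (fun w => `|Y w|).
Proof.
move=> [mY iY]; split; first exact: measurableT_comp.
by move=> k; under eq_fun do rewrite normr_id.
Qed.

Lemma all_momentsX Y k : all_moments Y -> all_moments (fun w => Y w ^+ k).
Proof.
move=> hY; elim: k => [|k IH]; first by under eq_fun do rewrite expr0; apply: all_moments_cst.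
by under eq_fun do rewrite exprS; apply: all_momentsM.
Qed.

Lemma all_moments_sum (I : Type) (r : seq I) (Q : pred I) (F : I -> T -> R) :
  (forall i, Q i -> all_moments (F i)) -> all_moments (fun w => \sum_(i <- r | Q i) F i w).
Proof.
move=> hF; elim: r => [|i r IH].
  by under eq_fun do rewrite big_nil; apply: all_moments_cst.
under eq_fun do rewrite big_cons; have [Qi|_] := boolP (Q i); last exact: IH.
by apply: all_momentsD => //; apply: hF.
Qed.

Lemma all_moments_prod (I : Type) (r : seq I) (Q : pred I) (F : I -> T -> R) :
  (forall i, Q i -> all_moments (F i)) -> all_moments (fun w => \prod_(i <- r | Q i) F i w).
Proof.
move=> hF; elim: r => [|i r IH].
  by under eq_fun do rewrite big_nil; apply: all_moments_cst.
under eq_fun do rewrite big_cons; have [Qi|_] := boolP (Q i); last exact: IH.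
by apply: all_momentsM => //; apply: hF.
Qed.

Lemma all_moments_integrable Y : all_moments Y -> P.-integrable setT (EFin \o Y).
Proof.
move=> [mY iY]; apply: (le_integrable _ _ _ (iY 1%N)) => //; first exact/measurable_EFinP.
by move=> w _; rewrite /= expr1 lee_fin normr_id.
Qed.

Definition Ex Y : R := \int[P]_w Y w.

Lemma ExD Y Z : all_moments Y -> all_moments Z -> Ex (fun w => Y w + Z w) = Ex Y + Ex Z.
Proof. by move=> hY hZ; rewrite /Ex RintegralD //; apply: all_moments_integrable. Qed.

Lemma ExB Y Z : all_moments Y -> all_moments Z -> Ex (fun w => Y w - Z w) = Ex Y - Ex Z.
Proof. by move=> hY hZ; rewrite /Ex RintegralB //; apply: all_moments_integrable. Qed.

Lemma ExZ c Y : all_moments Y -> Ex (fun w => c * Y w) = c * Ex Y.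
Proof. by move=> hY; rewrite /Ex RintegralZl //; apply: all_moments_integrable. Qed.

Lemma Ex_cst c : Ex (fun=> c) = c.
Proof.
rewrite /Ex Rintegral_cst // -[RHS]mulr1; congr (_ * _).
exact: (congr1 fine (probability_setT P)).
Qed.

Lemma Ex_sum (I : Type) (r : seq I) (Q : pred I) (F : I -> T -> R) :
  (forall i, Q i -> all_moments (F i)) ->
  Ex (fun w => \sum_(i <- r | Q i) F i w) = \sum_(i <- r | Q i) Ex (F i).
Proof.
move=> hF; elim: r => [|i r IH].
  by rewrite big_nil -[RHS](Ex_cst 0); congr Ex; apply/funext => w; rewrite big_nil.
rewrite big_cons; under eq_fun do rewrite big_cons.
have [Qi|_] := boolP (Q i); last exact: IH.
by rewrite ExD ?IH //; [exact: hF|exact: all_moments_sum].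
Qed.

Lemma Ex_le Y Z : all_moments Y -> all_moments Z -> (forall w, Y w <= Z w) -> Ex Y <= Ex Z.
Proof. by move=> hY hZ YZ; apply: le_Rintegral => //; apply: all_moments_integrable. Qed.

Lemma Ex_ge0 Y : (forall w, 0 <= Y w) -> 0 <= Ex Y.
Proof. by move=> Y0; apply: Rintegral_ge0. Qed.

Lemma Ex_norm Y : all_moments Y -> `|Ex Y| <= Ex (fun w => `|Y w|).
Proof. by move=> hY; apply: le_normr_Rintegral => //; apply: all_moments_integrable. Qed.

Lemma Ex_norm_le Y Z : all_moments Y -> all_moments Z -> (forall w, `|Y w| <= Z w) ->
  `|Ex Y| <= Ex Z.
Proof.
move=> hY hZ YZ; apply: le_trans (Ex_norm hY) _; apply: Ex_le => //.
exact: all_moments_norm.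
Qed.

(** The factorization on rectangles identifies the joint law with the product of the marginals;
    Fubini then splits the integral of [x * y]. *)
Lemma Ex_indep (Y Z : T -> R) : all_moments Y -> all_moments Z ->
  (forall A B, measurable A -> measurable B ->
     P (Y @^-1` A `&` Z @^-1` B) = (P (Y @^-1` A) * P (Z @^-1` B))%E) ->
  Ex (fun w => Y w * Z w) = Ex Y * Ex Z.
Proof.
move=> hY hZ YZ.
have [mY _] := hY; have [mZ _] := hZ.
have mYZ : measurable_fun setT (fun w => (Y w, Z w)) by exact: measurable_fun_pair.
pose fY : {mfun T >-> R} := HB.pack Y (isMeasurableFun.Build _ _ _ _ Y mY).
pose fZ : {mfun T >-> R} := HB.pack Z (isMeasurableFun.Build _ _ _ _ Z mZ).
pose fYZ : {mfun T >-> (R * R)%type} :=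
  HB.pack (fun w => (Y w, Z w)) (isMeasurableFun.Build _ _ _ _ (fun w => (Y w, Z w)) mYZ).
pose mu1 := distribution P fY; pose mu2 := distribution P fZ; pose mu := distribution P fYZ.
have E : forall A, measurable A -> (mu1 \x mu2)%E A = mu A.
  apply: product_measure_unique => A B mA mB.
  by rewrite -YZ.
have mf : measurable_fun setT (fun xy : R * R => (xy.1 * xy.2)%:E).
  by apply/measurable_EFinP/measurable_funM.
have iYZ := all_moments_integrable (all_momentsM hY hZ).
have imu : mu.-integrable setT (fun xy : R * R => (xy.1 * xy.2)%:E).
  by apply: integrable_pushforward.
have i12 : (mu1 \x mu2)%E.-integrable setT (fun xy : R * R => (xy.1 * xy.2)%:E).
  apply/integrableP; split => //.
  rewrite (eq_measure_integral mu) => [|A mA _]; last exact: E.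
  by case/integrableP: imu.
rewrite /Ex /Rintegral.
have -> : (\int[P]_w (Y w * Z w)%:E = \int[mu]_xy (xy.1 * xy.2)%:E)%E.
  by rewrite integral_distribution.
rewrite (eq_measure_integral (mu1 \x mu2)%E) => [|A mA _]; last exact/esym/E.
rewrite -integral12_prod_meas1 //.
have i2 : mu2.-integrable setT EFin.
  by apply: integrable_pushforward => //; exact: all_moments_integrable.
have i1 : mu1.-integrable setT EFin.
  by apply: integrable_pushforward => //; exact: all_moments_integrable.
have e2 : (\int[mu2]_y y%:E = \int[P]_w (Z w)%:E)%E.
  by rewrite integral_distribution //; exact: all_moments_integrable.
have e1 : (\int[mu1]_y y%:E = \int[P]_w (Y w)%:E)%E.
  by rewrite integral_distribution //; exact: all_moments_integrable.
have -> : (\int[mu1]_x fubini_F mu2 (fun xy : R * R => (xy.1 * xy.2)%:E) x =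
    \int[mu1]_x (x%:E * \int[mu2]_y y%:E))%E.
  apply: eq_integral => x _; rewrite /fubini_F -integralZl //.
have f2 : (\int[mu2]_y y%:E)%E \is a fin_num by exact: integrable_fin_num.
rewrite -(fineK f2) integralZr // fineM ?integrable_fin_num //.
by rewrite e1 e2.
Qed.

End all_moments.

(** * Independence of one variable from all the others *)

Section independence.
Local Open Scope classical_set_scope.
Context (d : measure_display) (T : measurableType d) (R : realType) (P : probability T R).
Variable X : nat -> {RV P >-> R}.
Hypothesis indepX : independent_RVs X.

(* A generating pi-system of the sigma-algebra of the [X j] with [j != i]. *)
Definition cylinders_off (i : nat) : set (set T) :=
  [set A | exists (J : {fset nat}) (B : nat -> set R), [/\ i \notin J,
     forall j, measurable (B j) & A = \bigcap_(j in [set` J]) X j @^-1` B j]].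

Lemma cylinders_off_measurable i A : cylinders_off i A -> measurable A.
Proof.
move=> [J [B [_ mB ->]]]; apply: fin_bigcap_measurable => // j _.
by rewrite -[X in measurable X]setTI; apply: measurable_funP.
Qed.

Lemma cylinders_off_setI i : setI_closed (cylinders_off i).
Proof.
move=> _ _ [J [B [iJ mB ->]]] [J' [B' [iJ' mB' ->]]].
exists (J `|` J')%fset, (fun j => (if j \in J then B j else setT) `&`
   (if j \in J' then B' j else setT)); split.
- by rewrite inE negb_or iJ.
- by move=> j; apply: measurableI; case: ifP.
apply/seteqP; split => w /=.
  move=> [wB wB'] j /=; split; case: ifP => // jJ; [exact: wB|exact: wB'].
move=> wU; split => j /= jJ.
  by have /= := wU j; rewrite inE jJ /= => /(_ isT)[].
by have /= := wU j; rewrite inE jJ orbT /= => /(_ isT)[].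
Qed.

(** For fixed [C] both sides are finite measures in [A]. They agree on the pi-system of cylinders,
    hence on the sigma-algebra it generates. *)
Lemma cylinders_off_indep i C A : measurable C -> <<s cylinders_off i >> A ->
  P (A `&` X i @^-1` C) = (P A * P (X i @^-1` C))%E.
Proof.
move=> mC sA.
have mXC : measurable (X i @^-1` C) by rewrite -[X in measurable X]setTI; apply: measurable_funP.
have fC : P (X i @^-1` C) \is a fin_num by exact: fin_num_measure.
pose p : {nonneg R} := NngNum (fine_ge0 (measure_ge0 P (X i @^-1` C))).
have /= := @g_sigma_algebra_measure_unique _ R T (cylinders_off i) _ (fun=> setT) _ _
  (mrestr P mXC) (mscale p P) _ _ _ A sA.
rewrite /mrestr /mscale /= fineK // muleC; apply.
- exact: cylinders_off_measurable.
- move=> _; exists fset0, (fun=> setT); split => //.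
  by rewrite (_ : [set` fset0] = set0) ?bigcap_set0 //; apply/seteqP; split.
- by apply/seteqP; split => // w _; exists 0%N.
- exact: cylinders_off_setI.
- move=> _ [J [B [iJ mB ->]]].
  (* A cylinder off [i] intersected with a condition on [X i] is a cylinder over [i] and [J], to
     which the independence hypothesis applies. *)
  pose B' j := if j == i then C else B j.
  have := @indepX (i |` J)%fset B'; rewrite big_fsetU1 //= => e.
  have -> : \bigcap_(j in [set` J]) X j @^-1` B j `&` X i @^-1` C =
      \bigcap_(j in [set` (i |` J)%fset]) X j @^-1` B' j.
    apply/seteqP; split => w /=.
      move=> [wJ wC] j /=; rewrite !inE /B' => /orP[/eqP ->|jJ]; first by rewrite eqxx.
      case: eqP => [ji|_]; first by rewrite -ji jJ in iJ.
      exact: wJ.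
    move=> wU; split.
      move=> j /= jJ; have := wU j; rewrite /= !inE jJ orbT /B' => /(_ isT).
      by case: eqP => // ji; rewrite -ji jJ in iJ.
    by have := wU i; rewrite /= !inE eqxx /B' eqxx => /(_ isT).
  rewrite e => [|j _]; last by rewrite /B'; case: ifP.
  rewrite /B' eqxx; congr (_ * _)%E.
  rewrite (@indepX J B) //; apply: eq_fbigr => j jJ _.
  by case: eqP => // ji; rewrite -ji jJ in iJ.
- move=> _; rewrite setTI; exact: (le_lt_trans (probability_le1 _ _) (ltry _)).
Qed.

(** Stated as measurability for the sigma-algebra of the other variables, the property passes to
    sums, products and measurable images, such as the test functions of Stein's method. *)
Definition depends_off (i : nat) (Y : T -> R) : Prop :=
  measurable_fun setT (Y : g_sigma_algebraType (cylinders_off i) -> R).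

Lemma depends_off_RV i j : i != j -> depends_off i (X j).
Proof.
move=> ij _ B mB; rewrite setTI; apply: sub_sigma_algebra.
exists [fset j]%fset, (fun=> B); split => //; first by rewrite inE.
by rewrite set_fset1 bigcap_set1.
Qed.

Lemma Ex_depends_off i k Y : all_moments P (X i) -> all_moments P Y -> depends_off i Y ->
  Ex P (fun w => X i w ^+ k * Y w) = Ex P (fun w => X i w ^+ k) * Ex P Y.
Proof.
move=> hX hY dY; apply: Ex_indep => //; first exact: all_momentsX.
move=> A B mA mB; rewrite setIC muleC.
pose A' := (fun x : R => x ^+ k) @^-1` A.
have mA' : measurable A'.
  by rewrite -[X in measurable X]setTI; apply: (@measurable_funX _ _ _ setT id k).
apply: (@cylinders_off_indep i A') => //.
by have := dY measurableT B mB; rewrite setTI.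
Qed.

Lemma depends_off_cst i c : depends_off i (fun=> c).
Proof. exact: measurable_cst. Qed.

Lemma depends_offD i Y Z : depends_off i Y -> depends_off i Z -> depends_off i (fun w => Y w + Z w).
Proof. exact: measurable_funD. Qed.

Lemma depends_offM i Y Z : depends_off i Y -> depends_off i Z -> depends_off i (fun w => Y w * Z w).
Proof. exact: measurable_funM. Qed.

Lemma depends_offX i k Y : depends_off i Y -> depends_off i (fun w => Y w ^+ k).
Proof. exact: measurable_funX. Qed.

Lemma depends_off_comp i (f : R -> R) Y : measurable_fun setT f -> depends_off i Y ->
  depends_off i (fun w => f (Y w)).
Proof. by move=> mf dY; apply: measurableT_comp. Qed.

Lemma depends_off_sum i (I : Type) (r : seq I) (Q : pred I) (F : I -> T -> R) :
  (forall j, Q j -> depends_off i (F j)) -> depends_off i (fun w => \sum_(j <- r | Q j) F j w).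
Proof.
move=> hF; elim: r => [|j r IH].
  by under eq_fun do rewrite big_nil; apply: depends_off_cst.
under eq_fun do rewrite big_cons; have [Qj|_] := boolP (Q j); last exact: IH.
by apply: depends_offD => //; apply: hF.
Qed.

Lemma depends_off_prod i (I : Type) (r : seq I) (Q : pred I) (F : I -> T -> R) :
  (forall j, Q j -> depends_off i (F j)) -> depends_off i (fun w => \prod_(j <- r | Q j) F j w).
Proof.
move=> hF; elim: r => [|j r IH].
  by under eq_fun do rewrite big_nil; apply: depends_off_cst.
under eq_fun do rewrite big_cons; have [Qj|_] := boolP (Q j); last exact: IH.
by apply: depends_offM => //; apply: hF.
Qed.

Hypothesis momX : forall i, all_moments P (X i).

Lemma Ex_monomial_seq (r : seq nat) (m : nat -> nat) : uniq r ->
  Ex P (fun w => \prod_(i <- r) X i w ^+ m i) = \prod_(i <- r) Ex P (fun w => X i w ^+ m i).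
Proof.
elim: r => [|i r IH] /=.
  by move=> _; rewrite big_nil -[RHS](Ex_cst P); congr Ex; apply/funext => w; rewrite big_nil.
move=> /andP[ir ur]; rewrite big_cons -IH //.
under eq_fun do rewrite big_cons.
apply: Ex_depends_off => //.
  by apply: all_moments_prod => j _; apply: all_momentsX.
under eq_fun do rewrite big_seq.
apply: depends_off_prod => j jr; apply: depends_offX; apply: depends_off_RV.
by apply/eqP => ij; rewrite ij jr in ir.
Qed.

Lemma Ex_monomial (n : nat) (m : 'I_n -> nat) :
  Ex P (fun w => \prod_(i < n) X i w ^+ m i) = \prod_(i < n) Ex P (fun w => X i w ^+ m i).
Proof.
case: n m => [|n] m.
  by rewrite big_ord0 -[RHS](Ex_cst P); congr Ex; apply/funext => w; rewrite big_ord0.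
have := @Ex_monomial_seq (iota 0 n.+1) (fun j => m (inord j)) (iota_uniq _ _).
rewrite -[iota 0 n.+1]/(index_iota 0 n.+1) big_mkord.
under [in RHS]eq_bigr do rewrite inord_val.
rewrite (_ : (fun w => \prod_(0 <= i < n.+1) X i w ^+ m (inord i)) =
  (fun w => \prod_(i < n.+1) X i w ^+ m i)) //; apply/funext => w.
by rewrite big_mkord; under eq_bigr do rewrite inord_val.
Qed.

End independence.

(** * Stein's method for multilinear polynomials *)

Section multilinear.
Context (d : measure_display) (T : measurableType d) (R : realType) (P : probability T R).
Variable X : nat -> {RV P >-> R}.
Hypothesis indepX : independent_RVs X.
Hypothesis momX : forall i, all_moments P (X i).
Hypothesis meanX : forall i, Ex P (X i) = 0.
Hypothesis varX : forall i, Ex P (fun w => X i w ^+ 2) = 1.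
Variables (N : nat) (c : {set 'I_N} -> R).
Hypothesis c0 : c finset.set0 = 0.
Implicit Types (i : 'I_N) (A B : {set 'I_N}) (w : T).

Definition mono A w : R := \prod_(j in A) X j w.
Definition chaos w : R := \sum_A c A * mono A w.
Definition chaos_off i w : R := \sum_(A : {set 'I_N} | i \notin A) c A * mono A w.
Definition deriv_chaos i w : R := \sum_(A : {set 'I_N} | i \notin A) c (i |: A) * mono A w.
(* The derivative in direction [i] of [sum_A (c A / #|A|) X_A], the image of the
   chaos by the inverse of the number operator. *)
Definition deriv_chaos_inv i w : R :=
  \sum_(A : {set 'I_N} | i \notin A) c (i |: A) / #|A|.+1%:R * mono A w.
Definition carre_du_champ w : R := \sum_(i < N) deriv_chaos_inv i w * deriv_chaos i w.

Lemma sum_containing i (F : {set 'I_N} -> R) :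
  \sum_(A : {set 'I_N} | i \in A) F A = \sum_(A : {set 'I_N} | i \notin A) F (i |: A).
Proof.
rewrite (reindex_onto (fun A => i |: A) (fun A => A :\ i)) /=; last first.
  by move=> A iA; rewrite finset.setD1K.
apply: eq_bigl => A; rewrite finset.setU11 /=.
apply/eqP/idP => [<-|iA]; first by rewrite finset.setD11.
by rewrite finset.setU1K.
Qed.

Lemma monoU1 i A w : i \notin A -> mono (i |: A) w = X i w * mono A w.
Proof. by move=> iA; rewrite /mono big_setU1. Qed.

Lemma chaosE i w : chaos w = chaos_off i w + X i w * deriv_chaos i w.
Proof.
rewrite /chaos (bigID (fun A => i \notin A)) /=; congr (_ + _).
under eq_bigl do rewrite negbK.
rewrite sum_containing mulr_sumr; apply: eq_bigr => A iA.
by rewrite monoU1 // mulrCA.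
Qed.

(** Each nonempty [A] is reached once from each of its [#|A|] elements, which cancels the division.
    The empty set is never reached, hence the assumption [c0]. *)
Lemma chaos_sum_deriv w : chaos w = \sum_(i < N) X i w * deriv_chaos_inv i w.
Proof.
transitivity (\sum_(i < N) \sum_(A : {set 'I_N} | i \in A) c A / #|A|%:R * mono A w).
  rewrite (exchange_big_dep predT) //=; apply: eq_bigr => A _.
  have [->|A0] := eqVneq A finset.set0.
    by rewrite c0 mul0r big1 // => i _; rewrite ?mul0r.
  rewrite sumr_const -[RHS]mulr_natl mulrA; congr (_ * _).
  by rewrite mulrCA divff ?mulr1 // pnatr_eq0 cards_eq0.
apply: eq_bigr => i _; rewrite sum_containing mulr_sumr; apply: eq_bigr => A iA.
by rewrite monoU1 // cardsU1 iA mulrCA.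
Qed.

Lemma all_moments_mono A : all_moments P (mono A).
Proof. by apply: all_moments_prod => j _. Qed.

Lemma all_moments_lin (Q : pred {set 'I_N}) (b : {set 'I_N} -> R) :
  all_moments P (fun w => \sum_(A : {set 'I_N} | Q A) b A * mono A w).
Proof.
by apply: all_moments_sum => A _; apply: all_momentsM (all_moments_mono A); apply: all_moments_cst.
Qed.

Lemma depends_off_lin i (b : {set 'I_N} -> R) :
  depends_off X i (fun w => \sum_(A : {set 'I_N} | i \notin A) b A * mono A w).
Proof.
apply: depends_off_sum => A iA; apply: depends_offM; first exact: depends_off_cst.
apply: depends_off_prod => j jA; apply: depends_off_RV.
by apply/eqP => ij; rewrite (val_inj ij : i = j) jA in iA.
Qed.

Lemma monoE A w : mono A w = \prod_(j < N) X j w ^+ (j \in A).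
Proof.
rewrite /mono big_mkcond; apply: eq_bigr => j _.
by case: (j \in A); rewrite ?expr1 ?expr0.
Qed.

(** An index in exactly one of the two sets contributes a vanishing mean, an index in both a
    variance equal to 1. *)
Lemma Ex_mono_mono A B : Ex P (fun w => mono A w * mono B w) = (A == B)%:R.
Proof.
under eq_fun do rewrite !monoE -big_split /=.
under eq_fun do under eq_bigr do rewrite -exprD.
rewrite (Ex_monomial indepX momX (fun j => (j \in A) + (j \in B))%N).
have [->|/eqP AB] := eqVneq A B.
  rewrite big1 // => j _; case: (j \in B); first exact: varX.
  by rewrite -[RHS](Ex_cst P); congr Ex; apply/funext => w; rewrite expr0.
have [j jAB] : exists j, (j \in A) != (j \in B).
  apply/existsP; rewrite -negb_forall; apply/negP => /forallP AB'; apply: AB.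
  by apply/finset.setP => j; apply/eqP.
rewrite (bigD1 j) //=.
have -> : ((j \in A) + (j \in B) = 1)%N by move: jAB; case: (j \in A); case: (j \in B).
by under eq_fun do rewrite expr1; rewrite meanX mul0r.
Qed.

Lemma Ex_lin_lin (Q : pred {set 'I_N}) (b b' : {set 'I_N} -> R) :
  Ex P (fun w => (\sum_(A : {set 'I_N} | Q A) b A * mono A w) * (\sum_(A : {set 'I_N} | Q A) b' A * mono A w)) =
  \sum_(A : {set 'I_N} | Q A) b A * b' A.
Proof.
under eq_fun do rewrite mulr_suml.
have hM A : all_moments P (fun w => b A * mono A w).
  by apply: all_momentsM (all_moments_mono A); apply: all_moments_cst.
rewrite Ex_sum; last first.
  by move=> A _; apply: all_momentsM; [exact: hM|exact: all_moments_lin].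
apply: eq_bigr => A QA.
under eq_fun do rewrite mulr_sumr.
rewrite Ex_sum; last first.
  move=> B _; apply: all_momentsM; first exact: hM.
  by apply: all_momentsM (all_moments_mono B); apply: all_moments_cst.
rewrite (bigD1 A) //= big1 ?addr0 => [|B /andP[_ BA]].
  under eq_fun do rewrite mulrACA.
  rewrite ExZ ?Ex_mono_mono ?eqxx ?mulr1 //.
  by apply: all_momentsM; apply: all_moments_mono.
under eq_fun do rewrite mulrACA.
rewrite ExZ ?Ex_mono_mono ?(eq_sym A) ?(negPf BA) ?mulr0 //.
by apply: all_momentsM; apply: all_moments_mono.
Qed.

Lemma Ex_chaos : Ex P chaos = 0.
Proof.
rewrite /chaos Ex_sum; last first.
  by move=> A _; apply: all_momentsM (all_moments_mono A); apply: all_moments_cst.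
rewrite big1 // => A _; rewrite ExZ; last exact: all_moments_mono.
have := Ex_mono_mono A finset.set0.
under eq_fun do rewrite [X in _ * X]big_set0 mulr1.
by move=> ->; case: eqP => [->|_]; rewrite ?c0 ?mul0r ?mulr0.
Qed.

(** By orthonormality each [i] in [A] contributes [c A ^ 2 / #|A|], and there are [#|A|] of them. *)
Lemma Ex_carre_du_champ : Ex P carre_du_champ = \sum_A c A ^+ 2.
Proof.
rewrite /carre_du_champ Ex_sum; last first.
  by move=> i _; apply: all_momentsM; apply: all_moments_lin.
transitivity (\sum_(i < N) \sum_(A : {set 'I_N} | i \in A) c A ^+ 2 / #|A|%:R).
  apply: eq_bigr => i _; rewrite Ex_lin_lin sum_containing.
  by apply: eq_bigr => A iA; rewrite cardsU1 iA mulrAC -expr2.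
rewrite (exchange_big_dep predT) //=; apply: eq_bigr => A _.
have [->|A0] := eqVneq A finset.set0.
  by rewrite c0 expr0n big1 // => i _; rewrite ?mul0r.
by rewrite sumr_const -[LHS]mulr_natl mulrCA divff ?mulr1 // pnatr_eq0 cards_eq0.
Qed.

Lemma Ex_deriv_chaos_inv_sqr : \sum_(i < N) Ex P (fun w => deriv_chaos_inv i w ^+ 2) <= \sum_A c A ^+ 2.
Proof.
rewrite -Ex_carre_du_champ Ex_sum; last first.
  by move=> i _; apply: all_momentsM; apply: all_moments_lin.
apply: ler_sum => i _; under eq_fun do rewrite expr2.
rewrite !Ex_lin_lin; apply: ler_sum => A iA.
set x := c _; set n : R := _%:R; rewrite mulrACA -expr2 [leRHS]mulrAC -expr2.
rewrite ler_wpM2l ?sqr_ge0 // -[leRHS]mulr1 ler_wpM2l ?invr_ge0 ?ler0n //.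
by rewrite invf_le1 ?ltr0n // ler1n.
Qed.

(** Pointwise, [2 |y| <= e + y ^ 2 / e]. The free weight [e] plays the part of the Cauchy-Schwarz
    inequality and is adapted to the size of the second moment. *)
Lemma Ex_le_weighted_square (Y : T -> R) (e : R) : all_moments P Y -> 0 < e ->
  Ex P (fun w => `|Y w|) <= (e + e^-1 * Ex P (fun w => Y w ^+ 2)) / 2.
Proof.
move=> hY e0.
have hY2 : all_moments P (fun w => Y w ^+ 2) by exact: all_momentsX.
have hr : all_moments P (fun w => e^-1 * Y w ^+ 2).
  by apply: all_momentsM => //; apply: all_moments_cst.
rewrite -(ExZ _ hY2) -{1}(Ex_cst P e) -ExD //; last exact: all_moments_cst.
rewrite mulrC -ExZ; last by apply: all_momentsD => //; apply: all_moments_cst.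
apply: Ex_le; first exact: all_moments_norm.
  apply: all_momentsM; first exact: all_moments_cst.
  by apply: all_momentsD => //; apply: all_moments_cst.
move=> w; rewrite -real_normK ?num_real //; move: `|Y w| => y.
rewrite mulrC ler_pdivlMr // -(ler_pM2l e0).
have -> : e * (e + e^-1 * y ^+ 2) = e ^+ 2 + y ^+ 2 by field; rewrite gt_eqF.
by have := sqr_ge0 (e - y); nra.
Qed.

Variables (f f' : R -> R) (M M' K alpha : R).
Hypothesis mf : measurable_fun setT f.
Hypothesis mf' : measurable_fun setT f'.
Hypothesis f_bounded : forall x, `|f x| <= M.
Hypothesis f'_bounded : forall x, `|f' x| <= M'.
Hypothesis f_taylor : forall x h, `|f (x + h) - f x - h * f' x| <= K * h ^+ 2.
Hypothesis f'_lipschitz : forall x h, `|f' (x + h) - f' x| <= K * `|h|.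
Hypothesis mom6 : forall i, Ex P (fun w => X i w ^+ 6) <= alpha.

Let K0 : 0 <= K.
Proof. by have := f'_lipschitz 0 1; rewrite normr1 mulr1; apply: le_trans. Qed.

Let all_moments_comp (g : R -> R) (m : R) (Y : T -> R) : measurable_fun setT g ->
  (forall x, `|g x| <= m) -> all_moments P Y -> all_moments P (fun w => g (Y w)).
Proof.
move=> mg gm [mY _]; apply: (@all_moments_bounded _ _ _ _ _ m) => //.
exact: measurableT_comp.
Qed.

Let hXU i : all_moments P (fun w => X i w * deriv_chaos_inv i w).
Proof. by apply: all_momentsM => //; apply: all_moments_lin. Qed.

(* Both [f (chaos_off i)] and [f' (chaos_off i)] are independent of [X i], so that
   only the Taylor remainders survive. *)
Lemma stein_coordinate i (e : R) : 0 < e ->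
  `|Ex P (fun w => X i w * deriv_chaos_inv i w * f (chaos w)) -
    Ex P (fun w => deriv_chaos_inv i w * deriv_chaos i w * f' (chaos w))| <=
  K / 2 * (e * Ex P (fun w => deriv_chaos_inv i w ^+ 2) +
           e^-1 * (2 * alpha + 2) * Ex P (fun w => deriv_chaos i w ^+ 4)).
Proof.
move=> e0.
pose U := deriv_chaos_inv i; pose V := deriv_chaos i; pose W0 := chaos_off i.
have hU : all_moments P U by exact: all_moments_lin.
have hV : all_moments P V by exact: all_moments_lin.
have hW0 : all_moments P W0 by exact: all_moments_lin.
have hW : all_moments P chaos by exact: all_moments_lin.
have hf Y : all_moments P Y -> all_moments P (fun w => f (Y w)) by exact: all_moments_comp.
have hf' Y : all_moments P Y -> all_moments P (fun w => f' (Y w)) by exact: all_moments_comp.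
have hX := momX i.
have dU : depends_off X i U by exact: depends_off_lin.
have dV : depends_off X i V by exact: depends_off_lin.
have dW0 : depends_off X i W0 by exact: depends_off_lin.
pose F1 w := X i w ^+ 1 * (U w * f (W0 w)).
pose G w := U w * V w * f' (W0 w).
pose F2 w := X i w ^+ 2 * G w.
have hG : all_moments P G by apply: all_momentsM; [exact: all_momentsM|exact: hf'].
have hF1 : all_moments P F1.
  by apply: all_momentsM; [exact: all_momentsX|apply: all_momentsM => //; exact: hf].
have hF2 : all_moments P F2 by apply: all_momentsM => //; exact: all_momentsX.
have EF1 : Ex P F1 = 0.
  rewrite (Ex_depends_off indepX) //.
  - by under eq_fun do rewrite expr1; rewrite meanX mul0r.
  - by apply: all_momentsM => //; exact: hf.
  - by apply: depends_offM => //; apply: depends_off_comp.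
have EF2 : Ex P F2 = Ex P G.
  rewrite (Ex_depends_off indepX) ?varX ?mul1r //.
  by apply: depends_offM; [exact: depends_offM|apply: depends_off_comp].
have hA : all_moments P (fun w => X i w * U w * f (chaos w)).
  by apply: all_momentsM; [exact: all_momentsM|exact: hf].
have hB : all_moments P (fun w => U w * V w * f' (chaos w)).
  by apply: all_momentsM; [exact: all_momentsM|exact: hf'].
(* [F1] and [F2 - G] have expectation zero. Subtracting them leaves [x u (f W - f W0 - x v f' W0) -
   u v (f' W - f' W0)], which only contains Taylor remainders. *)
have -> : Ex P (fun w => X i w * U w * f (chaos w)) - Ex P (fun w => U w * V w * f' (chaos w)) =
    Ex P (fun w => (X i w * U w * f (chaos w) - U w * V w * f' (chaos w)) - (F1 w + (F2 w - G w))).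
  rewrite ExB; [|exact: all_momentsB|by apply: all_momentsD => //; apply: all_momentsB].
  rewrite ExB // ExD //; last exact: all_momentsB.
  by rewrite ExB // EF1 EF2 subrr addr0 subr0.
have hU2 : all_moments P (fun w => U w ^+ 2) by exact: all_momentsX.
have hXV k : all_moments P (fun w => X i w ^+ k * V w ^+ 4).
  by apply: all_momentsM; apply: all_momentsX.
(* The remainders are at most [K |u| (|x| ^ 3 + |x|) v ^ 2]. The weighted inequality of parameter
   [e], followed by [(p + q) ^ 2 <= 2 p ^ 2 + 2 q ^ 2], gives this bound; hence the sixth moment. *)
pose Z w := K / 2 * (e * U w ^+ 2 + e^-1 * (2 * (X i w ^+ 6 * V w ^+ 4) + 2 * (X i w ^+ 2 * V w ^+ 4))).
have h1 : all_moments P (fun w => e * U w ^+ 2).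
  by apply: all_momentsM => //; exact: all_moments_cst.
have h2 k : all_moments P (fun w => 2 * (X i w ^+ k * V w ^+ 4)).
  by apply: all_momentsM => //; exact: all_moments_cst.
have h3 : all_moments P (fun w => e^-1 * (2 * (X i w ^+ 6 * V w ^+ 4) + 2 * (X i w ^+ 2 * V w ^+ 4))).
  by apply: all_momentsM; [exact: all_moments_cst|exact: all_momentsD].
have hZ : all_moments P Z by apply: all_momentsM; [exact: all_moments_cst|exact: all_momentsD].
apply: (@le_trans _ _ (Ex P Z)).
  apply: Ex_norm_le => //.
    by apply: all_momentsB; [exact: all_momentsB|apply: all_momentsD => //; exact: all_momentsB].
  move=> w; rewrite /Z /F1 /F2 /G (chaosE i) -/W0 -/V expr1.
  have := f_taylor (W0 w) (X i w * V w).
  have := f'_lipschitz (W0 w) (X i w * V w).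
  move: (f _) (f _) (f' _) (f' _) => b a b' a' l1 l2.
  move: (X i w) (U w) (V w) l1 l2 => x u v l1 l2.
  have -> : x * u * a - u * v * a' - (x * (u * b) + (x ^+ 2 * (u * v * b') - u * v * b')) =
     x * u * (a - b - x * v * b') - u * v * (a' - b') by ring.
  apply: le_trans (ler_normB _ _) _; rewrite !normrM.
  apply: (@le_trans _ _ (K * (`|u| * ((`|x| ^+ 3 + `|x|) * `|v| ^+ 2)))).
    apply: (@le_trans _ _ (`|x| * `|u| * (K * (x * v) ^+ 2) + `|u| * `|v| * (K * `|x * v|))).
      by apply: lerD; apply: ler_wpM2l => //; rewrite mulr_ge0.
    rewrite -[(x * v) ^+ 2]real_normK ?num_real // normrM.
    by rewrite le_eqVlt; apply/orP; left; apply/eqP; ring.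
  rewrite -mulrA ler_wpM2l // -(ler_pM2l e0) mulrCA.
  have -> : x ^+ 6 = (`|x| ^+ 3) ^+ 2 by rewrite -exprM -normrX ger0_norm // (exprM _ 3 2) sqr_ge0.
  have -> : v ^+ 4 = (`|v| ^+ 2) ^+ 2 by rewrite -exprM -normrX ger0_norm // (exprM _ 2 2) sqr_ge0.
  rewrite -(@real_normK _ u) ?num_real // -(@real_normK _ x) ?num_real //.
  clear l1 l2; move: `|u| `|x| (`|v| ^+ 2) => {}u {}x y.
  have -> : e * (2^-1 * (e * u ^+ 2 + e^-1 * (2 * ((x ^+ 3) ^+ 2 * y ^+ 2) + 2 * (x ^+ 2 * y ^+ 2)))) =
    2^-1 * ((e * u) ^+ 2 + (2 * ((x ^+ 3 * y) ^+ 2) + 2 * ((x * y) ^+ 2))).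
    by field; rewrite gt_eqF.
  rewrite mulrDl; move: (x ^+ 3 * y) (x * y) => p q.
  rewrite mulrA [u * e]mulrC; move: (e * u) => s.
  have := sqr_ge0 (s - (p + q)); have := sqr_ge0 (p - q); nra.
rewrite /Z ExZ; last exact: all_momentsD.
rewrite ExD // !ExZ //; last exact: all_momentsD.
rewrite ExD // !ExZ // !(Ex_depends_off indepX) ?varX //; try exact: depends_offX; try exact: all_momentsX.
apply: ler_wpM2l; first by rewrite divr_ge0.
rewrite lerD2l -mulrA; apply: ler_wpM2l; first by rewrite invr_ge0 ltW.
have : 0 <= Ex P (fun w => V w ^+ 4) by apply: Ex_ge0 => w; rewrite (exprM _ 2 2) sqr_ge0.
move: (mom6 i); rewrite -/V; move: (Ex P _) (Ex P (fun w => V w ^+ 4)) => p q; nra.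
Qed.

(** Here [v] is arbitrary: it will be the limiting variance, from which the mean of [carre_du_champ]
    still differs. The discrepancy is only multiplied by the bound [M'] on [f']. *)
Lemma stein_bound (v e : R) : 0 < e ->
  `|Ex P (fun w => chaos w * f (chaos w)) - v * Ex P (fun w => f' (chaos w))| <=
  M' * Ex P (fun w => `|carre_du_champ w - v|) +
  K / 2 * (e * \sum_A c A ^+ 2 +
           e^-1 * (2 * alpha + 2) * \sum_(i < N) Ex P (fun w => deriv_chaos i w ^+ 4)).
Proof.
move=> e0.
have hW : all_moments P chaos by exact: all_moments_lin.
have hfW : all_moments P (fun w => f (chaos w)) by exact: all_moments_comp hW.
have hf'W : all_moments P (fun w => f' (chaos w)) by exact: all_moments_comp hW.
have hUV i : all_moments P (fun w => deriv_chaos_inv i w * deriv_chaos i w).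
  by apply: all_momentsM; apply: all_moments_lin.
have hG : all_moments P carre_du_champ by apply: all_moments_sum => i _; apply: hUV.
have hGv : all_moments P (fun w => carre_du_champ w - v).
  by apply: all_momentsB => //; apply: all_moments_cst.
have E1 : Ex P (fun w => chaos w * f (chaos w)) =
    \sum_(i < N) Ex P (fun w => X i w * deriv_chaos_inv i w * f (chaos w)).
  rewrite -Ex_sum => [|i _]; last exact: all_momentsM.
  by congr Ex; apply/funext => w; rewrite {1}chaos_sum_deriv mulr_suml.
have E2 : v * Ex P (fun w => f' (chaos w)) =
   \sum_(i < N) Ex P (fun w => deriv_chaos_inv i w * deriv_chaos i w * f' (chaos w)) -
   Ex P (fun w => (carre_du_champ w - v) * f' (chaos w)).
  rewrite -Ex_sum => [|i _]; last exact: all_momentsM.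
  rewrite -ExB; [|by apply: all_moments_sum => i _; apply: all_momentsM|exact: all_momentsM].
  rewrite -ExZ //; congr Ex; apply/funext => w.
  by rewrite -mulr_suml -/(carre_du_champ w); ring.
rewrite E1 E2 opprB addrCA -sumrB; apply: le_trans (ler_normD _ _) _; apply: lerD.
  rewrite -ExZ; last exact: all_moments_norm.
  apply: Ex_norm_le; first exact: all_momentsM.
    by apply: all_momentsM; [exact: all_moments_cst|exact: all_moments_norm].
  by move=> w; rewrite normrM mulrC ler_wpM2r.
apply: le_trans (ler_norm_sum _ _ _) _.
apply: le_trans (ler_sum _ (fun i _ => stein_coordinate i e0)) _.
rewrite -mulr_sumr big_split /= -!mulr_sumr; apply: ler_wpM2l; first exact: divr_ge0.
by rewrite lerD2r; apply: ler_wpM2l; [exact: ltW|exact: Ex_deriv_chaos_inv_sqr].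
Qed.

End multilinear.

(** * Quadruples of sets *)

Section quadruples.
Variable N : nat.
Local Notation S := {set 'I_N}.
Implicit Types (p : S * S) (z : (S * S) * (S * S)) (t : bool * bool) (j : 'I_N).

(** A quadruple is a pair of pairs, as in the square of a double sum: the first boolean selects the
    pair, the second one of its two sets. *)
Definition quad_comp z t : S :=
  let p := if t.1 then z.2 else z.1 in if t.2 then p.2 else p.1.

Definition pair_mult p j : nat := (j \in p.1) + (j \in p.2).

Lemma quad_comp_inj z z' : quad_comp z =1 quad_comp z' -> z = z'.
Proof.
case: z z' => [[A B] [A' B']] [[C D] [C' D']] E.
have := E (true, true); have := E (true, false).
have := E (false, true); have := E (false, false).
by rewrite /quad_comp /= => -> -> -> ->.
Qed.

Lemma sum_bool_pair (F : bool * bool -> nat) :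
  (\sum_t F t = F (false, false) + F (false, true) + (F (true, false) + F (true, true)))%N.
Proof.
transitivity (\sum_a \sum_b F (a, b))%N; first by rewrite pair_bigA; apply: eq_bigr => -[].
by rewrite !big_bool addnC; congr addn; rewrite addnC.
Qed.

Lemma quad_mult z j :
  #|[set t | j \in quad_comp z t]%SET| = (pair_mult z.1 j + pair_mult z.2 j)%N.
Proof.
rewrite -sum1_card big_mkcond /= (eq_bigr (fun t => (j \in quad_comp z t) : nat)).
  by rewrite sum_bool_pair.
by move=> t _; rewrite finset.inE; case: ifP.
Qed.

End quadruples.

(** * Variance of the carre du champ and fourth moments of the derivatives *)

Section bounds.
Context (d : measure_display) (T : measurableType d) (R : realType) (P : probability T R).
Variable X : nat -> {RV P >-> R}.
Hypothesis indepX : independent_RVs X.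
Hypothesis momX : forall i, all_moments P (X i).
Hypothesis meanX : forall i, Ex P (X i) = 0.
Hypothesis varX : forall i, Ex P (fun w => X i w ^+ 2) = 1.

(** An exponent zero contributes a factor 1, so the bound depends on the number of variables present
    and not on [N]. *)
Lemma prod_moments_bound (N M : nat) (m : 'I_N -> nat) (beta : R) : 1 <= beta ->
  (forall j : 'I_N, `|Ex P (fun w => X j w ^+ m j)| <= beta) ->
  (#|[set j | m j != 0%N]%SET| <= M)%N ->
  `|\prod_(j < N) Ex P (fun w => X j w ^+ m j)| <= beta ^+ M.
Proof.
move=> b1 hb hM; rewrite normr_prod.
apply: (@le_trans _ _ (\prod_(j in [set j | m j != 0%N]%SET) beta)).
  rewrite [leRHS]big_mkcond /=; apply: ler_prod => j _; rewrite normr_ge0 finset.inE /=.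
  case: eqP => [->|_] //=.
  by under eq_fun do rewrite expr0; rewrite Ex_cst normr1.
by rewrite prodr_const ler_weXn2l.
Qed.

Lemma ler_sum_unique (N : nat) (F : 'I_N -> R) (b : R) : 0 <= b ->
  (forall i j, F i != 0 -> F j != 0 -> i = j) -> (forall i, `|F i| <= b) ->
  `|\sum_(i < N) F i| <= b.
Proof.
move=> b0 uF Fb; case: (pickP (fun i => F i != 0)) => [i Fi|F0].
  rewrite (bigD1 i) //= big1 ?addr0 // => j /eqP ji; apply/eqP.
  by apply: contraT => Fj; case: ji; apply: uF.
by rewrite big1 ?normr0 // => i _; apply/eqP; have := F0 i; case: eqP.
Qed.

Variables (N D : nat) (s C beta : R).
Hypothesis N0 : (0 < N)%N.
Hypothesis s0 : 0 < s.
Hypothesis sN : s ^+ 2 = N%:R.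
Hypothesis C0 : 0 <= C.
Hypothesis beta1 : 1 <= beta.
Hypothesis betaX : forall i k, (k <= 4)%N -> `|Ex P (fun w => X i w ^+ k)| <= beta.
Local Notation S := {set 'I_N}.
Implicit Types (p : S * S) (z : (S * S) * (S * S)) (t : bool * bool) (A B : S).

(** The features shared by the coefficients of [deriv_chaos] and [deriv_chaos_inv]. Here [A] is a
    set of the chaos deprived of [i]: it has between 1 and [D - 1] elements, and its sum is
    congruent to [- i]. *)
Definition admissible (U : 'I_N -> S -> R) : Prop := forall i A,
  `|U i A| <= C * s^-1 ^+ #|A| /\
  (U i A != 0 -> (0 < #|A| < D)%N /\ (N %| i + \sum_(j in A) j)%N).

Variables (U V : 'I_N -> S -> R).
Hypothesis hU : admissible U.
Hypothesis hV : admissible V.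

Let si : 0 <= s^-1. Proof. by rewrite invr_ge0 ltW. Qed.

Let admissible_unique (i i' : 'I_N) m : (N %| i + m)%N -> (N %| i' + m)%N -> i = i'.
Proof.
rewrite /dvdn => /eqP e /eqP e'; have /eqP : i + m = i' + m %[mod N] by rewrite e e'.
by rewrite eqn_modDr !modn_small // => /eqP /val_inj.
Qed.

Let admissible_modn (i : 'I_N) A B : (N %| i + \sum_(j in A) j)%N -> (N %| i + \sum_(j in B) j)%N ->
  (\sum_(j in A) j = \sum_(j in B) j %[mod N])%N.
Proof.
rewrite /dvdn => /eqP e /eqP e'; apply/eqP; rewrite -(eqn_modDl i).
by rewrite e e'.
Qed.

Definition mono_pair p w : R := mono X p.1 w * mono X p.2 w.

Lemma all_moments_mono_pair p : all_moments P (mono_pair p).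
Proof. by apply: all_momentsM; apply: all_moments_mono. Qed.

Lemma mono_pairE p w : mono_pair p w = \prod_(j < N) X j w ^+ pair_mult p j.
Proof.
by rewrite /mono_pair !monoE -big_split /=; apply: eq_bigr => j _; rewrite -exprD.
Qed.

Lemma Ex_mono_pair p :
  Ex P (mono_pair p) = \prod_(j < N) Ex P (fun w => X j w ^+ pair_mult p j).
Proof.
by rewrite -(Ex_monomial indepX momX); congr Ex; apply/funext => w; rewrite mono_pairE.
Qed.

Lemma Ex_mono_pair2 z : Ex P (fun w => mono_pair z.1 w * mono_pair z.2 w) =
  \prod_(j < N) Ex P (fun w => X j w ^+ (pair_mult z.1 j + pair_mult z.2 j)).
Proof.
rewrite -(Ex_monomial indepX momX (fun j => pair_mult z.1 j + pair_mult z.2 j)%N).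
congr Ex; apply/funext => w.
by rewrite !mono_pairE -big_split /=; apply: eq_bigr => j _; rewrite exprD.
Qed.

Let mult1_0 (m : 'I_N -> nat) j : m j = 1%N ->
  \prod_(j < N) Ex P (fun w => X j w ^+ m j) = 0.
Proof.
move=> mj; rewrite (bigD1 j) //= mj.
by under eq_fun do rewrite expr1; rewrite meanX mul0r.
Qed.

Lemma Ex_mono_pair2_eq0 z j : (pair_mult z.1 j + pair_mult z.2 j = 1)%N ->
  Ex P (fun w => mono_pair z.1 w * mono_pair z.2 w) = 0.
Proof. by move=> mj; rewrite Ex_mono_pair2 (@mult1_0 (fun j => pair_mult z.1 j + pair_mult z.2 j)%N j). Qed.

Lemma Ex_mono_pair_eq0 p j : pair_mult p j = 1%N -> Ex P (mono_pair p) = 0.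
Proof. by move=> mj; rewrite Ex_mono_pair (mult1_0 mj). Qed.

Lemma Ex_mono_pair_disjoint z :
  (forall j, pair_mult z.1 j = 0%N \/ pair_mult z.2 j = 0%N) ->
  Ex P (fun w => mono_pair z.1 w * mono_pair z.2 w) =
  Ex P (mono_pair z.1) * Ex P (mono_pair z.2).
Proof.
move=> dis; rewrite Ex_mono_pair2 !Ex_mono_pair -big_split /=; apply: eq_bigr => j _.
have E0 : Ex P (fun w => X j w ^+ 0) = 1 by under eq_fun do rewrite expr0; apply: Ex_cst.
by case: (dis j) => ->; rewrite ?addn0 ?add0n E0 ?mul1r ?mulr1.
Qed.

Let small z : Prop := forall t, (#|quad_comp z t| < D)%N.

(** Four sets with fewer than [D] elements involve at most [4 * D] variables, each with an exponent
    at most 4. *)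
Lemma Ex_mono_pair2_bound z : small z ->
  `|Ex P (fun w => mono_pair z.1 w * mono_pair z.2 w)| <= beta ^+ (4 * D).
Proof.
move=> sz; rewrite Ex_mono_pair2.
apply: (prod_moments_bound (m := fun j => pair_mult z.1 j + pair_mult z.2 j)%N) => // [j|].
  by apply: betaX; rewrite /pair_mult; do 4 case: (_ \in _).
apply: (@leq_trans (\sum_(t : bool * bool) #|quad_comp z t|)); last first.
  have := sz (false, false); have := sz (false, true).
  by have := sz (true, false); have := sz (true, true); rewrite sum_bool_pair; lia.
apply: (@leq_trans #|\bigcup_t quad_comp z t|%SET).
  apply: subset_leq_card; apply/fintype.subsetP => j; rewrite finset.inE => mj.
  move: mj; rewrite -quad_mult -lt0n => /card_gt0P[t]; rewrite finset.inE => jt.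
  by apply/finset.bigcupP; exists t.
elim/big_rec2: _ => [|t n A _ IH]; first by rewrite cards0.
by apply: leq_trans (leq_card_setU _ _) _; rewrite leq_add2l.
Qed.

Lemma Ex_mono_pair_bound p : (#|p.1| < D)%N -> (#|p.2| < D)%N ->
  `|Ex P (mono_pair p)| <= beta ^+ (4 * D).
Proof.
move=> p1 p2; have D0 : (0 < D)%N by apply: leq_trans p1.
have := @Ex_mono_pair2_bound (p, (finset.set0, finset.set0)).
rewrite Ex_mono_pair_disjoint /=; last by move=> j; right; rewrite /pair_mult !finset.inE.
have -> : Ex P (mono_pair (finset.set0, finset.set0)) = 1.
  by rewrite -[RHS](Ex_cst P); congr Ex; apply/funext => w; rewrite /mono_pair /mono !big_set0 mulr1.
rewrite mulr1; apply=> -[[] []]; rewrite /quad_comp //= cards0 //.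
Qed.

Definition quad_const : R := (\sum_(k : {ffun bool * bool -> 'I_D}) word_const {t : bool * bool & 'I_(k t)})%:R.

Lemma quad_const_ge0 : 0 <= quad_const. Proof. exact: ler0n. Qed.

Definition pair_weight p : R := \sum_(i < N) U i p.1 * V i p.2.

Let F z : R := s^-1 ^+ (\sum_t #|quad_comp z t|).

Let F_ge0 z : 0 <= F z. Proof. by rewrite exprn_ge0. Qed.

Let FE z : F z = s^-1 ^+ #|z.1.1| * s^-1 ^+ #|z.1.2| * (s^-1 ^+ #|z.2.1| * s^-1 ^+ #|z.2.2|).
Proof. by rewrite /F sum_bool_pair !exprD. Qed.

(* At most one [i] contributes, since [i] is determined modulo [N] by [p.1]. *)
Lemma pair_weight_bound p : `|pair_weight p| <= C ^+ 2 * (s^-1 ^+ #|p.1| * s^-1 ^+ #|p.2|).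
Proof.
apply: ler_sum_unique.
- by rewrite mulr_ge0 ?exprn_ge0 // mulr_ge0 // exprn_ge0.
- move=> i j; rewrite !mulf_eq0 !negb_or => /andP[/(hU _ _).2[_ d1] _] /andP[/(hU _ _).2[_ d2] _].
  exact: admissible_unique d1 d2.
- move=> i; rewrite normrM expr2 mulrACA.
  by apply: ler_pM => //; [apply: (hU _ _).1|apply: (hV _ _).1].
Qed.

Lemma pair_weight_neq0 p : pair_weight p != 0 ->
  [/\ (#|p.1| < D)%N, (#|p.2| < D)%N & (\sum_(j in p.1) j = \sum_(j in p.2) j %[mod N])%N].
Proof.
move=> w0; have [i] : exists i, U i p.1 * V i p.2 != 0.
  apply/existsP; apply: contraNT w0; rewrite negb_exists => /forallP h.
  by rewrite /pair_weight big1 // => i _; apply/eqP; have := h i; rewrite negbK.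
rewrite mulf_eq0 negb_or => /andP[/(hU _ _).2[/andP[_ s1] d1] /(hV _ _).2[/andP[_ s2] d2]].
by split => //; apply: admissible_modn d1 d2.
Qed.

Definition pair_sum w : R := \sum_p pair_weight p * mono_pair p w.

(** The variance is a sum of covariances over quadruples. A nonzero covariance excludes elements
    covered once and requires an element [j] common to the two pairs. If no element is covered more
    than twice, [j] lies in only one set of each pair, and the congruence between the two sets of a
    pair is solved for it. *)
Lemma variance_pair_sum :
  Ex P (fun w => (pair_sum w - Ex P pair_sum) ^+ 2) <= C ^+ 4 * (beta ^+ (4 * D) + (beta ^+ (4 * D)) ^+ 2) * quad_const / s.
Proof.
set G := pair_sum.
have hp p : all_moments P (fun w => pair_weight p * mono_pair p w).
  by apply: all_momentsM (all_moments_mono_pair p); apply: all_moments_cst.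
have hG : all_moments P G by apply: all_moments_sum => p _; apply: hp.
pose cov z := Ex P (fun w => mono_pair z.1 w * mono_pair z.2 w) - Ex P (mono_pair z.1) * Ex P (mono_pair z.2).
have EG : Ex P G = \sum_p pair_weight p * Ex P (mono_pair p).
  by rewrite /G /pair_sum Ex_sum //; apply: eq_bigr => p _; rewrite ExZ //; apply: all_moments_mono_pair.
have hG2 : all_moments P (fun w => G w ^+ 2) by exact: all_momentsX.
have hGc : all_moments P (fun w => 2 * Ex P G * G w) by apply: all_momentsM => //; apply: all_moments_cst.
have -> : Ex P (fun w => (G w - Ex P G) ^+ 2) = \sum_z pair_weight z.1 * pair_weight z.2 * cov z.
  transitivity (Ex P (fun w => G w ^+ 2) - Ex P G ^+ 2).
    transitivity (Ex P (fun w => G w ^+ 2 - 2 * Ex P G * G w + Ex P G ^+ 2)).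
      by congr Ex; apply/funext => w; ring.
    rewrite ExD; [|exact: all_momentsB|exact: all_moments_cst].
    by rewrite ExB // ExZ // Ex_cst; ring.
  have -> : Ex P (fun w => G w ^+ 2) =
      \sum_z pair_weight z.1 * pair_weight z.2 * Ex P (fun w => mono_pair z.1 w * mono_pair z.2 w).
    have h2 z : all_moments P (fun w => pair_weight z.1 * pair_weight z.2 * (mono_pair z.1 w * mono_pair z.2 w)).
      apply: all_momentsM; first exact: all_moments_cst.
      by apply: all_momentsM; apply: all_moments_mono_pair.
    transitivity (\sum_z Ex P (fun w => pair_weight z.1 * pair_weight z.2 * (mono_pair z.1 w * mono_pair z.2 w))).
      rewrite -Ex_sum //; congr Ex; apply/funext => w.
      rewrite expr2 /G /pair_sum big_distrlr /= pair_bigA /=; apply: eq_bigr => z _.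
      by rewrite mulrACA.
    by apply: eq_bigr => z _; rewrite ExZ //; apply: all_momentsM; apply: all_moments_mono_pair.
  rewrite expr2 EG big_distrlr /= pair_bigA /= -sumrB; apply: eq_bigr => z _.
  by rewrite mulrBr mulrACA.
pose H := [set z | pair_weight z.1 * pair_weight z.2 * cov z != 0]%SET.
have HP z : z \in H -> [/\ pair_weight z.1 != 0, pair_weight z.2 != 0 & cov z != 0].
  by rewrite finset.inE !mulf_eq0 !negb_or => /andP[/andP[]].
have Hsmall z : z \in H -> small z.
  move=> /HP[/pair_weight_neq0[s1 s2 _] /pair_weight_neq0[s3 s4 _] _].
  by move=> [[] []]; rewrite /quad_comp.
have -> : \sum_z pair_weight z.1 * pair_weight z.2 * cov z =
    \sum_(z in H) pair_weight z.1 * pair_weight z.2 * cov z.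
  rewrite [RHS]big_mkcond; apply: eq_bigr => z _; rewrite finset.inE.
  by case: eqP => [->|].
set b := beta ^+ _.
have b0 : 0 <= b by rewrite exprn_ge0 // (le_trans ler01).
apply: (@le_trans _ _ (\sum_(z in H) C ^+ 4 * (b + b ^+ 2) * F z)).
  apply: ler_sum => z zH; apply: le_trans (ler_norm _) _.
  rewrite !normrM FE mulrAC; apply: (@le_trans _ _ (C ^+ 2 * (s^-1 ^+ #|z.1.1| * s^-1 ^+ #|z.1.2|) *
      (C ^+ 2 * (s^-1 ^+ #|z.2.1| * s^-1 ^+ #|z.2.2|)) * (b + b ^+ 2))).
    rewrite mulrAC; apply: ler_pM; [exact: mulr_ge0|exact: normr_ge0| |].
      by apply: ler_pM => //; apply: pair_weight_bound.
    apply: le_trans (ler_normB _ _) _; apply: lerD.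
      exact/Ex_mono_pair2_bound/Hsmall.
    rewrite normrM expr2; have [/pair_weight_neq0[s1 s2 _] /pair_weight_neq0[s3 s4 _] _] := HP z zH.
    by apply: ler_pM => //; apply: Ex_mono_pair_bound.
  by rewrite le_eqVlt; apply/orP; left; apply/eqP; ring.
rewrite -mulr_sumr -[leRHS]mulrA; apply: ler_wpM2l.
  by apply: mulr_ge0; [exact: exprn_ge0|apply: addr_ge0 => //; exact: exprn_ge0].
apply: (@weighted_set_systems N _ _ (@quad_comp N) N0 (@quad_comp_inj N) R s D H
   (fun t t' => t.1 == t'.1)) => //.
- by move=> z t zH; apply: Hsmall.
- move=> z j zH; rewrite quad_mult; apply/eqP => mj; have [_ _] := HP z zH.
  rewrite /cov (Ex_mono_pair2_eq0 mj) sub0r oppr_eq0.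
  (* A total multiplicity 1 comes from one of the pairs, so the product of the two expectations
     vanishes as well. *)
  have : pair_mult z.1 j = 1%N \/ pair_mult z.2 j = 1%N.
    by move: mj; case: (pair_mult z.1 j) => [|[|n]] //; [right|left].
  by case=> [/Ex_mono_pair_eq0 ->|/Ex_mono_pair_eq0 ->]; rewrite ?mul0r ?mulr0 eqxx.
- move=> z t t' zH; have [/pair_weight_neq0[_ _ e1] /pair_weight_neq0[_ _ e2] _] := HP z zH.
  by case: t t' => [[] []] [[] []] //= _; rewrite /quad_comp /=.
- move=> z zH le2.
  have [j /andP[m1 m2]] : exists j, (pair_mult z.1 j != 0%N) && (pair_mult z.2 j != 0%N).
    apply/existsP; apply: contraT; rewrite negb_exists => /forallP h.
    have [_ _] := HP z zH; rewrite /cov Ex_mono_pair_disjoint ?subrr ?eqxx // => j.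
    by have := h j; rewrite negb_and !negbK => /orP[] /eqP; [left|right].
  have := le2 j; rewrite quad_mult => le2j; exists j.
  (* Since the second pair also covers [j], the first one covers it just once; [c] tells which of
     its sets contains [j]. *)
  have [c cP] : exists c, (j \in quad_comp z (false, c)) && (j \notin quad_comp z (false, ~~ c)).
    move: m1 m2 le2j; rewrite /pair_mult /quad_comp /=.
    case j1 : (j \in z.1.1); case j2 : (j \in z.1.2) => //=.
    - by case: (_ \in _); case: (_ \in _).
    - by exists false; rewrite /= j1 j2.
    - by exists true; rewrite /= j1 j2.
  by case/andP: cP => j1 j2; exists (false, c), (false, ~~ c).
Qed.

(** All four sets complete the same [i] to a zero sum, so any two of their sums are congruent. When
    no element is covered more than twice, an element of the first set, nonempty by admissibility,
    is missed by another set, and the congruence between these two is solved for it. *)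
Lemma fourth_moment_sum :
  \sum_(i < N) Ex P (fun w => (\sum_A V i A * mono X A w) ^+ 4) <=
  C ^+ 4 * beta ^+ (4 * D) * quad_const / s.
Proof.
pose w4 z := \sum_(i < N) V i z.1.1 * V i z.1.2 * (V i z.2.1 * V i z.2.2).
pose Y z w := mono_pair z.1 w * mono_pair z.2 w.
have hY z : all_moments P (Y z) by apply: all_momentsM; apply: all_moments_mono_pair.
have -> : \sum_(i < N) Ex P (fun w => (\sum_A V i A * mono X A w) ^+ 4) = \sum_z w4 z * Ex P (Y z).
  transitivity (\sum_(i < N) \sum_z V i z.1.1 * V i z.1.2 * (V i z.2.1 * V i z.2.2) * Ex P (Y z)).
    apply: eq_bigr => i _.
    transitivity (Ex P (fun w => \sum_z V i z.1.1 * V i z.1.2 * (V i z.2.1 * V i z.2.2) * Y z w)).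
      congr Ex; apply/funext => w; rewrite (exprM _ 2 2) !expr2 big_distrlr /= pair_bigA /=.
      rewrite big_distrlr /= pair_bigA /=; apply: eq_bigr => z _.
      by rewrite /Y /mono_pair; ring.
    rewrite Ex_sum => [|z _]; last by apply: all_momentsM => //; apply: all_moments_cst.
    by apply: eq_bigr => z _; rewrite ExZ.
  by rewrite exchange_big; apply: eq_bigr => z _; rewrite mulr_suml.
pose H := [set z | w4 z * Ex P (Y z) != 0]%SET.
have HP z : z \in H -> exists i, [/\ V i z.1.1 != 0, V i z.1.2 != 0, V i z.2.1 != 0 & V i z.2.2 != 0].
  rewrite finset.inE mulf_eq0 negb_or => /andP[w0 _].
  have [i] : exists i, V i z.1.1 * V i z.1.2 * (V i z.2.1 * V i z.2.2) != 0.
    apply/existsP; apply: contraNT w0; rewrite negb_exists => /forallP h.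
    by rewrite /w4 big1 // => i _; apply/eqP; have := h i; rewrite negbK.
  by rewrite !mulf_eq0 !negb_or => /andP[/andP[v1 v2] /andP[v3 v4]]; exists i.
have HQ z : z \in H -> exists i, forall t, V i (quad_comp z t) != 0.
  by move=> /HP[i [v1 v2 v3 v4]]; exists i => -[[] []]; rewrite /quad_comp.
have -> : \sum_z w4 z * Ex P (Y z) = \sum_(z in H) w4 z * Ex P (Y z).
  rewrite [RHS]big_mkcond; apply: eq_bigr => z _; rewrite finset.inE.
  by case: eqP => [->|].
have Hsmall z : z \in H -> small z.
  by move=> /HQ[i hi] t; have [/andP[]] := (hV _ _).2 (hi t).
set b := beta ^+ _.
have b0 : 0 <= b by rewrite exprn_ge0 // (le_trans ler01).
apply: (@le_trans _ _ (\sum_(z in H) C ^+ 4 * b * F z)).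
  apply: ler_sum => z zH; apply: le_trans (ler_norm _) _.
  rewrite normrM mulrAC; apply: ler_pM => //; last exact/Ex_mono_pair2_bound/Hsmall.
  apply: ler_sum_unique; first by rewrite mulr_ge0 // exprn_ge0.
    move=> i j; rewrite !mulf_eq0 !negb_or.
    move=> /andP[/andP[/(hV _ _).2[_ d1] _] _] /andP[/andP[/(hV _ _).2[_ d2] _] _].
    exact: admissible_unique d1 d2.
  move=> i; rewrite FE !normrM.
  have -> : C ^+ 4 * (s^-1 ^+ #|z.1.1| * s^-1 ^+ #|z.1.2| * (s^-1 ^+ #|z.2.1| * s^-1 ^+ #|z.2.2|)) =
    C * s^-1 ^+ #|z.1.1| * (C * s^-1 ^+ #|z.1.2|) * (C * s^-1 ^+ #|z.2.1| * (C * s^-1 ^+ #|z.2.2|)) by ring.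
  by do 3 ?[apply: ler_pM; rewrite ?mulr_ge0 //]; apply: (hV _ _).1.
rewrite -mulr_sumr -[leRHS]mulrA; apply: ler_wpM2l.
  by apply: mulr_ge0 => //; exact: exprn_ge0.
apply: (@weighted_set_systems N _ _ (@quad_comp N) N0 (@quad_comp_inj N) R s D H
   (fun t t' => true)) => //.
- by move=> z t zH; apply: Hsmall.
- move=> z j zH; rewrite quad_mult; apply/eqP => mj.
  by move: zH; rewrite finset.inE /Y (Ex_mono_pair2_eq0 mj) mulr0 eqxx.
- move=> z t t' /HQ[i hi] _.
  exact: (admissible_modn ((hV _ _).2 (hi t)).2 ((hV _ _).2 (hi t')).2).
- move=> z /HQ[i hi] le2.
  have [/andP[/card_gt0P[j jA] _] _] := (hV _ _).2 (hi (false, false)).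
  exists j, (false, false).
  have [t jt] : exists t, j \notin quad_comp z t.
    apply/existsP; apply: contraT; rewrite negb_exists => /forallP h.
    have := le2 j; rewrite (_ : [set t | _]%SET = finset.setT) ?cardsT ?card_prod ?card_bool //.
    by apply/finset.setP => t; rewrite !finset.inE; have := h t; rewrite negbK.
  by exists t.
Qed.

End bounds.

(** * The circulant statistic *)

Section circulant.
Context (d : measure_display) (T : measurableType d) (R : realType) (P : probability T R).
Variable X : nat -> {RV P >-> R}.
Hypothesis indepX : independent_RVs X.
Hypothesis momX : forall i, all_moments P (X i).
Hypothesis meanX : forall i, Ex P (X i) = 0.
Hypothesis varX : forall i, Ex P (fun w => X i w ^+ 2) = 1.

Definition word_mono (N : nat) (Pos : finType) (h : {ffun Pos -> 'I_N}) (w : T) : R :=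
  \prod_p X (h p) w.

Lemma all_moments_word_mono (N : nat) (Pos : finType) (h : {ffun Pos -> 'I_N}) :
  all_moments P (word_mono h).
Proof. by apply: all_moments_prod => p _. Qed.

Lemma Ex_word_mono (N : nat) (Pos : finType) (h : {ffun Pos -> 'I_N}) :
  Ex P (word_mono h) = \prod_(j < N) Ex P (fun w => X j w ^+ #|[set p | h p == j]%SET|).
Proof.
rewrite -(Ex_monomial indepX momX (fun j : 'I_N => #|[set p | h p == j]%SET|)).
congr Ex; apply/funext => w; rewrite /word_mono (partition_big h predT) //=.
apply: eq_bigr => j _; rewrite -prodr_const.
apply: eq_big => p; first by rewrite finset.inE.
by move=> /eqP ->.
Qed.

Definition noninjective_sum (N k : nat) (w : T) : R :=
  \sum_(f : {ffun 'I_k -> 'I_N} | ~~ injectiveb f && (N %| \sum_j f j)%N) word_mono f w.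

(** The square is a sum over pairs of words, viewed as words on [bool * 'I_k]. A letter occurring
    once annihilates the expectation, and the remaining pairs are those of
    [card_noninjective_pairs]. *)
Lemma Ex_noninjective_sum_sqr (N k : nat) (beta : R) : (0 < N)%N -> 1 <= beta ->
  (forall i m, (m <= k.*2)%N -> `|Ex P (fun w => X i w ^+ m)| <= beta) ->
  Ex P (fun w => noninjective_sum N k w ^+ 2) <=
    beta ^+ k.*2 * (word_const (bool * 'I_k)%type * N ^ (k - 2))%:R.
Proof.
move=> N0 beta1 hbeta.
pose Q (f : {ffun 'I_k -> 'I_N}) := ~~ injectiveb f && (N %| \sum_j f j)%N.
pose half (h : {ffun bool * 'I_k -> 'I_N}) b : {ffun 'I_k -> 'I_N} := [ffun j => h (b, j)].
pose QQ h := Q (half h true) && Q (half h false).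
have E1 w : noninjective_sum N k w ^+ 2 = \sum_(h | QQ h) word_mono h w.
  pose join (fg : {ffun 'I_k -> 'I_N} * {ffun 'I_k -> 'I_N}) : {ffun bool * 'I_k -> 'I_N} :=
    [ffun p : bool * 'I_k => if p.1 then fg.1 p.2 else fg.2 p.2].
  rewrite expr2 /noninjective_sum big_distrlr /= pair_big /=.
  rewrite [RHS](reindex_onto join (fun h => (half h true, half h false))) /=; last first.
    by move=> h _; apply/ffunP => -[[] j]; rewrite !ffunE.
  have hj fg : (half (join fg) true, half (join fg) false) = fg.
    by case: fg => f g; congr pair; apply/ffunP => j; rewrite !ffunE.
  apply: eq_big => [fg|fg _].
    have [e1 e2] : half (join fg) true = fg.1 /\ half (join fg) false = fg.2.
      by case: (fg) (hj fg) => f g [-> ->].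
    by rewrite hj eqxx andbT /QQ e1 e2.
  rewrite /word_mono.
  transitivity (\prod_b \prod_j X (join fg (b, j)) w).
    rewrite big_bool /=; congr (_ * _); apply: eq_bigr => j _; by rewrite ffunE.
  by rewrite pair_bigA; apply: eq_bigr => -[].
under eq_fun do rewrite E1.
rewrite Ex_sum; last by move=> h _; exact: all_moments_word_mono.
pose H := [set h : {ffun bool * 'I_k -> 'I_N} |
     [&& [forall p, 1 < #|fibre h p|]%N,
         [forall b, ~~ injectiveb [ffun j => h (b, j)]] &
         [forall b, N %| \sum_j h (b, j)]]%N]%SET.
apply: (@le_trans _ _ (\sum_(h in H) beta ^+ k.*2)); last first.
  rewrite sumr_const -[leLHS]mulr_natr; apply: ler_wpM2l.
    by rewrite exprn_ge0 // (le_trans ler01).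
  by rewrite ler_nat card_noninjective_pairs.
rewrite [leRHS]big_mkcond [leLHS]big_mkcond; apply: ler_sum => h _.
case: ifPn => [QQh|_]; last by case: ifP => // _; rewrite exprn_ge0 // (le_trans ler01).
case: ifPn => [_|hH].
  apply: le_trans (ler_norm _) _; rewrite Ex_word_mono.
  have cardP : #|{: bool * 'I_k}| = k.*2 by rewrite card_prod card_bool card_ord mul2n.
  apply: (prod_moments_bound (m := fun j : 'I_N => #|[set p | h p == j]%SET|)) => // [j|].
    by apply: hbeta; rewrite -cardP max_card.
  rewrite -cardP -cardsT; apply: (@leq_trans #|h @: [set: bool * 'I_k]|%SET); last exact: leq_imset_card.
  apply: subset_leq_card; apply/fintype.subsetP => j; rewrite finset.inE -lt0n.
  move=> /card_gt0P[p]; rewrite finset.inE => /eqP <-; exact: imset_f.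
suff [p hp] : exists p, #|fibre h p| = 1%N.
  rewrite Ex_word_mono (bigD1 (h p)) //=.
  rewrite (_ : #|_| = 1%N) //; under eq_fun do rewrite expr1.
  by rewrite meanX mul0r.
move: hH QQh; rewrite finset.inE !negb_and => /or3P[|/existsP[b]|/existsP[b]].
- move=> /existsP[p]; rewrite -leqNgt => hp _; exists p; apply/eqP.
  by rewrite eqn_leq hp /=; apply/card_gt0P; exists p; rewrite finset.inE.
- by rewrite negbK /QQ /Q; case: b => ->; rewrite ?andbF.
- rewrite /QQ /Q; have -> : (\sum_j h (b, j) = \sum_j half h b j)%N.
    by apply: eq_bigr => j _; rewrite ffunE.
  by case: b => /negPf ->; rewrite ?andbF.
Qed.

Variables (D n : nat) (a : nat -> R).
Let N := n.+1.
Definition sqrt_size : R := Num.sqrt n.+1%:R.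
Local Notation s := sqrt_size.

Lemma sqrt_size_gt0 : 0 < s. Proof. by rewrite sqrtr_gt0 ltr0n. Qed.
Lemma sqrt_size_sqr : s ^+ 2 = N%:R. Proof. by rewrite sqr_sqrtr. Qed.
Lemma sqrt_size_ge1 : 1 <= s. Proof. by rewrite -sqrtr1 ler_wsqrtr // ler1n. Qed.

(* This is [a k * N ^ ((1 - k) / 2)]. *)
Definition scaling (k : nat) : R := a k * (s * s^-1 ^+ k).

(** The factorial counts the injective words with image [A]. *)
Definition circ_coef (A : {set 'I_n.+1}) : R :=
  if [&& 2 <= #|A|, #|A| <= D & N %| \sum_(j in A) j]%N
  then (#|A|)`!%:R * scaling #|A| else 0.

Definition remainder (w : T) : R :=
  \sum_(2 <= k < D.+1) scaling k * noninjective_sum N k w.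

Lemma circ_coef0 : circ_coef finset.set0 = 0.
Proof. by rewrite /circ_coef cards0. Qed.

Lemma sum_nat_eq (m : nat) (b : bool) (G : nat -> R) :
  \sum_(2 <= k < D.+1 | (m == k) && b) G k = if [&& 2 <= m, m <= D & b]%N then G m else 0.
Proof.
case: b; last by rewrite !andbF big1 // => k; rewrite andbF.
under eq_bigl do rewrite andbT eq_sym.
have -> : [&& 2 <= m, m <= D & true]%N = (m \in index_iota 2 D.+1).
  by rewrite mem_index_iota ltnS andbT.
case: ifPn => mD.
  rewrite big_mkcond (bigD1_seq m) ?iota_uniq //= eqxx big1 ?addr0 // => k km.
  by rewrite (negPf km).
rewrite big_seq_cond big1 // => k /andP[kD /eqP km].
by move: mD; rewrite -km kD.
Qed.

(** Sets are grouped by cardinality. The function [g] is the identity for the chaos itself and the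
    square for its variance. *)
Lemma sum_circ_coef (F : {set 'I_n.+1} -> R) (g : R -> nat -> R) : (forall k, g 0 k = 0) ->
  \sum_A g (circ_coef A) #|A| * F A =
  \sum_(2 <= k < D.+1) g (k`!%:R * scaling k) k *
     \sum_(A : {set 'I_n.+1} | (#|A| == k) && (N %| \sum_(j in A) j)%N) F A.
Proof.
move=> g0.
under [RHS]eq_bigr do rewrite mulr_sumr.
rewrite (exchange_big_dep xpredT) //=; apply: eq_bigr => A _.
rewrite (sum_nat_eq _ _ (fun k => g (k`!%:R * scaling k) k * F A)) /circ_coef.
by case: ifP => // _; rewrite g0 mul0r.
Qed.

Lemma trace_decomposition (w : T) :
  trace_stat X (poly_ge2 D a) n w / s = chaos X circ_coef w + remainder w.
Proof.
have -> : chaos X circ_coef w = \sum_(2 <= k < D.+1) scaling k *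
    \sum_(f : {ffun 'I_k -> 'I_N} | injectiveb f && (N %| \sum_j f j)%N) word_mono f w.
  rewrite /chaos (sum_circ_coef (g := fun x _ => x) (fun A => mono X A w)) //.
  apply: eq_bigr => k _; rewrite (sum_injective_words k (fun j : 'I_N => X j w) (fun m => N %| m)%N).
  by rewrite [RHS]mulrCA -[LHS]mulrA.
rewrite /remainder -big_split /= /trace_stat /poly_ge2.
rewrite linear_sum /= linear_sum /= mulr_suml; apply: eq_bigr => k _.
rewrite linearZ /= linearZ /= rmorphXn /= horner_mx_X.
rewrite /random_circulant /circulant_mx (tr_circulant_expr n (fun i => X i w / s)).
rewrite -mulrDr /scaling -!mulrA; congr (_ * _).
rewrite mulrCA mulrC; have -> : n.+1%:R / s = s.
  by rewrite -[n.+1%:R]sqrt_size_sqr expr2 mulfK // gt_eqF // sqrt_size_gt0.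
congr (_ * _).
transitivity (s^-1 ^+ k * \sum_(f : {ffun 'I_k -> 'I_N} | (N %| \sum_j f j)%N) word_mono f w).
  rewrite mulr_sumr; apply: eq_bigr => f _.
  by rewrite /word_mono big_split /= prodr_const card_ord mulrC.
congr (_ * _); rewrite (bigID (fun f : {ffun 'I_k -> 'I_N} => injectiveb f)) /=.
by congr (_ + _); apply: eq_bigl => f; rewrite andbC.
Qed.

(** Coefficients of the two derivatives, extended by zero to the sets containing [i], so that the
    sums run over all sets as in [pair_sum]. *)
Let V (i : 'I_n.+1) (A : {set 'I_n.+1}) : R := if i \notin A then circ_coef (i |: A) else 0.
Let U (i : 'I_n.+1) (A : {set 'I_n.+1}) : R :=
  if i \notin A then circ_coef (i |: A) / #|A|.+1%:R else 0.

Definition coef_const : R := \sum_(2 <= k < D.+1) k`!%:R * `|a k|.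

Lemma coef_const_ge0 : 0 <= coef_const.
Proof. by apply: sumr_ge0 => k _; rewrite mulr_ge0. Qed.

Let s0 : 0 < s := sqrt_size_gt0.

(** Removing one element from a set of size [k + 1] absorbs the factor [s]: the weight becomes one
    [1 / s] per remaining element, as [admissible] requires. *)
Lemma scalingS k : scaling k.+1 = a k.+1 * s^-1 ^+ k.
Proof. by rewrite /scaling exprS mulVKf // gt_eqF. Qed.

Let admissible_V : admissible D s coef_const V.
Proof.
move=> i A; rewrite /V /circ_coef; case: ifPn => [iA|_]; last first.
  by rewrite normr0 eqxx mulr_ge0 ?coef_const_ge0 // exprn_ge0 // invr_ge0 ltW.
rewrite cardsU1 iA /= add1n; case: ifPn => [/and3P[A1 AD AN]|_]; last first.
  by rewrite normr0 eqxx mulr_ge0 ?coef_const_ge0 // exprn_ge0 // invr_ge0 ltW.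
split; last by move=> _; rewrite -ltnS A1 AD; split => //; move: AN; rewrite big_setU1.
have si : 0 <= s^-1 ^+ #|A| by rewrite exprn_ge0 // invr_ge0 ltW.
rewrite scalingS mulrA normrM (ger0_norm si); apply: ler_wpM2r => //.
rewrite normrM (ger0_norm (ler0n _ _)) /coef_const.
rewrite (bigD1_seq #|A|.+1) ?iota_uniq ?mem_index_iota ?A1 ?ltnS //=.
by rewrite lerDl; apply: sumr_ge0 => k _; rewrite mulr_ge0.
Qed.

Let admissible_U : admissible D s coef_const U.
Proof.
move=> i A; have [h1 h2] := admissible_V i A.
have E : U i A = V i A / #|A|.+1%:R by rewrite /U /V; case: ifP => // _; rewrite mul0r.
rewrite E; split; last by rewrite mulf_eq0 negb_or => /andP[/h2].
apply: le_trans h1; rewrite normrM normfV (ger0_norm (ler0n _ _)).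
by rewrite ler_pdivrMr ?ltr0n // ler_peMr // ler1n.
Qed.

Lemma deriv_chaosE i w : deriv_chaos X circ_coef i w = \sum_A V i A * mono X A w.
Proof.
rewrite /deriv_chaos big_mkcond; apply: eq_bigr => A _; rewrite /V.
by case: ifP => // _; rewrite mul0r.
Qed.

Lemma carre_du_champE w : carre_du_champ X circ_coef w = pair_sum X U V w.
Proof.
rewrite /carre_du_champ /pair_sum.
transitivity (\sum_(i < n.+1) \sum_p U i p.1 * V i p.2 * mono_pair X p w).
  apply: eq_bigr => i _; rewrite deriv_chaosE.
  have -> : deriv_chaos_inv X circ_coef i w = \sum_A U i A * mono X A w.
    rewrite /deriv_chaos_inv big_mkcond; apply: eq_bigr => A _; rewrite /U.
    by case: ifP => // _; rewrite mul0r.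
  by rewrite big_distrlr /= pair_bigA /=; apply: eq_bigr => p _; rewrite mulrACA.
by rewrite exchange_big; apply: eq_bigr => p _; rewrite /pair_weight mulr_suml.
Qed.

Lemma variance_carre_du_champ (beta : R) : 1 <= beta ->
  (forall i m, (m <= 4)%N -> `|Ex P (fun w => X i w ^+ m)| <= beta) ->
  Ex P (fun w => (carre_du_champ X circ_coef w - Ex P (carre_du_champ X circ_coef)) ^+ 2) <=
  coef_const ^+ 4 * (beta ^+ (4 * D) + (beta ^+ (4 * D)) ^+ 2) * quad_const R D / s.
Proof.
move=> b1 hb.
have -> : carre_du_champ X circ_coef = pair_sum X U V.
  by apply/funext => w; exact: carre_du_champE.
apply: (@variance_pair_sum _ _ _ P X indepX momX meanX n.+1 D s) => //.
- exact: sqrt_size_sqr.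
- exact: coef_const_ge0.
Qed.

Lemma fourth_moment_deriv (beta : R) : 1 <= beta ->
  (forall i m, (m <= 4)%N -> `|Ex P (fun w => X i w ^+ m)| <= beta) ->
  \sum_(i < n.+1) Ex P (fun w => deriv_chaos X circ_coef i w ^+ 4) <=
  coef_const ^+ 4 * beta ^+ (4 * D) * quad_const R D / s.
Proof.
move=> b1 hb.
under eq_bigr do under eq_fun do rewrite deriv_chaosE.
apply: (@fourth_moment_sum _ _ _ P X indepX momX meanX n.+1 D s) => //.
- exact: sqrt_size_sqr.
- exact: coef_const_ge0.
Qed.

(** By [sum_eulerian], used with [n = l - 1], the inner sum over [s] is 1. *)
Lemma limit_varianceE : limit_variance D a = \sum_(2 <= k < D.+1) a k ^+ 2 * k`!%:R.
Proof.
rewrite /limit_variance big_nat_cond [RHS]big_nat_cond; apply: eq_bigr => k /andP[/andP[k2 _] _].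
case: k k2 => // k _.
by rewrite (@sum_eulerian R k) ?mulr1 // pnatr_eq0 -lt0n fact_gt0.
Qed.

Definition variance_const : R :=
  \sum_(2 <= k < D.+1) a k ^+ 2 * k`!%:R * (word_const 'I_k)%:R.

(** The number of zero-sum sets of size [k], times [k!], falls short of [N ^ (k - 1)] by
    O([N ^ (k - 2)]). The relative error O(1/N) is weakened to [1 / s], the order of the other
    errors. *)
Lemma sum_circ_coef_sqr :
  `|\sum_A circ_coef A ^+ 2 - limit_variance D a| <= variance_const / s.
Proof.
have -> : \sum_A circ_coef A ^+ 2 = \sum_(2 <= k < D.+1) (k`!%:R * scaling k) ^+ 2 *
    #|[set A : {set 'I_n.+1} | (#|A| == k) & (N %| \sum_(j in A) j)%N]%SET|%:R.
  have := sum_circ_coef (fun=> 1) (g := fun x _ => x ^+ 2) (fun k => expr0n _ 2).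
  under eq_bigr do rewrite mulr1; move=> ->; apply: eq_bigr => k _.
  rewrite sumr_const; congr (_ * _%:R); apply: eq_card => A.
  by rewrite !finset.inE.
rewrite limit_varianceE -sumrB; apply: le_trans (ler_norm_sum _ _ _) _.
rewrite /variance_const mulr_suml big_nat_cond [leRHS]big_nat_cond.
apply: ler_sum => k /andP[/andP[k2 _] _].
case: k k2 => [|[|k]] // _.
set m := #|_|; have := card_zero_sum_sets k (ltn0Sn n); rewrite /= -/m => /andP[m1 m2].
rewrite scalingS.
have -> : ((k.+2)`!%:R * (a k.+2 * s^-1 ^+ k.+1)) ^+ 2 * m%:R - a k.+2 ^+ 2 * (k.+2)`!%:R =
   - (a k.+2 ^+ 2 * (k.+2)`!%:R * ((N ^ k.+1 - k.+2`! * m)%N%:R / (s ^+ 2) ^+ k.+1)).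
  rewrite natrB // natrM natrX -sqrt_size_sqr.
  have -> : (s^-1 ^+ k.+1) = (s ^+ k.+1)^-1 by rewrite exprVn.
  have -> : (s ^+ 2) ^+ k.+1 = (s ^+ k.+1) ^+ 2 by rewrite -!exprM mulnC.
  have : s ^+ k.+1 != 0 by rewrite expf_neq0 // gt_eqF.
  by move: (s ^+ k.+1) => y y0; field.
have ak : 0 <= a k.+2 ^+ 2 * (k.+2)`!%:R by rewrite mulr_ge0 // sqr_ge0.
have q0 : 0 <= (N ^ k.+1 - k.+2`! * m)%N%:R / (s ^+ 2) ^+ k.+1.
  by rewrite divr_ge0 // exprn_ge0 // sqr_ge0.
rewrite normrN ger0_norm; last exact: mulr_ge0.
rewrite -[leRHS]mulrA; apply: ler_wpM2l => //.
rewrite sqrt_size_sqr ler_pdivrMr ?exprn_gt0 ?ltr0n //.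
apply: (@le_trans _ _ (word_const 'I_k.+2 * N ^ k)%:R).
  by rewrite ler_nat leq_subLR.
rewrite natrM -mulrA; apply: ler_wpM2l => //.
rewrite natrX exprS mulrA; rewrite -[leLHS]mul1r; apply: ler_wpM2r; first exact: exprn_ge0.
rewrite -sqrt_size_sqr expr2 mulKf ?gt_eqF //; exact: sqrt_size_ge1.
Qed.

(** The term of degree [k] has second moment O([s ^- (2 (k - 1)) N ^ (k - 2)]), that is O([s ^- 2]);
    the weight [1 / s] in [Ex_le_weighted_square] balances the two sides. *)
Lemma Ex_remainder (beta : R) : 1 <= beta ->
  (forall i m, (m <= D.*2)%N -> `|Ex P (fun w => X i w ^+ m)| <= beta) ->
  Ex P (fun w => `|remainder w|) <=
  (\sum_(2 <= k < D.+1) `|a k| * (1 + beta ^+ k.*2 * (word_const (bool * 'I_k)%type)%:R)) / s.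
Proof.
move=> b1 hb.
have hR k : all_moments P (noninjective_sum N k).
  by apply: all_moments_sum => f _; exact: all_moments_word_mono.
have hsR k : all_moments P (fun w => scaling k * noninjective_sum N k w).
  by apply: all_momentsM => //; exact: all_moments_cst.
apply: (@le_trans _ _ (\sum_(2 <= k < D.+1) Ex P (fun w => `|scaling k * noninjective_sum N k w|))).
  rewrite -Ex_sum => [|k _]; last exact: all_moments_norm.
  apply: Ex_le => [||w]; last exact: ler_norm_sum.
    by apply: all_moments_norm; apply: all_moments_sum => k _; exact: hsR.
  by apply: all_moments_sum => k _; apply: all_moments_norm.
rewrite mulr_suml big_nat_cond [leRHS]big_nat_cond.
apply: ler_sum => k /andP[/andP[k2 kD] _].
case: k k2 kD => [|[|k]] // _ kD; rewrite scalingS.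
have si : 0 < s^-1 by rewrite invr_gt0.
have hS : all_moments P (fun w => s^-1 ^+ k.+1 * noninjective_sum N k.+2 w).
  by apply: all_momentsM => //; exact: all_moments_cst.
under eq_fun do rewrite -mulrA normrM.
rewrite ExZ; last exact: all_moments_norm.
rewrite -mulrA; apply: ler_wpM2l => //.
apply: le_trans (Ex_le_weighted_square hS si) _.
under eq_fun do rewrite exprMn.
rewrite ExZ; last exact: all_momentsX.
have hb2 i m : (m <= k.+2.*2)%N -> `|Ex P (fun w => X i w ^+ m)| <= beta.
  by move=> mk; apply: hb; apply: leq_trans mk _; rewrite leq_double -ltnS.
have /= := Ex_noninjective_sum_sqr (ltn0Sn n) b1 hb2.
set b := beta ^+ _; set e := Ex P _; rewrite natrM subn2 /= natrX -sqrt_size_sqr => eb.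
have b0 : 0 <= b by rewrite exprn_ge0 // (le_trans ler01).
have le : (s^-1 ^+ k.+1) ^+ 2 * e <= b * (word_const (bool * 'I_k.+2)%type)%:R * s^-1 ^+ 2.
  apply: le_trans (ler_wpM2l (sqr_ge0 _) eb) _.
  rewrite le_eqVlt; apply/orP; left; apply/eqP.
  rewrite -[in RHS](mul1r (s^-1 ^+ 2)) -(expr1n _ k.*2) -(mulVf (_ : s != 0)) ?gt_eqF //.
  rewrite exprMn exprAC -!exprM -mul2n [(2 * k)%N]mulnC.
  have -> : s^-1 ^+ (k.+1 * 2) = s^-1 ^+ (k * 2) * s^-1 ^+ 2 by rewrite -exprD mulSn addnC.
  by ring.
have bw : 0 <= b * (word_const (bool * 'I_k.+2)%type)%:R by rewrite mulr_ge0.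
have : s^-1^-1 * ((s^-1 ^+ k.+1) ^+ 2 * e) <= s * (b * (word_const (bool * 'I_k.+2)%type)%:R * s^-1 ^+ 2).
  by rewrite invrK; apply: ler_wpM2l => //; exact: ltW.
have -> : s * (b * (word_const (bool * 'I_k.+2)%type)%:R * s^-1 ^+ 2) = b * (word_const (bool * 'I_k.+2)%type)%:R / s.
  by rewrite exprS expr1; field; rewrite gt_eqF.
move: (b * _) bw (_ * (_ * e)) => {}bw bw0 y yb.
have bws : 0 <= bw / s by rewrite divr_ge0 // ltW.
rewrite [leRHS]mulrDl mul1r; lra.
Qed.

End circulant.

Local Open Scope classical_set_scope.

(** * The Stein equation *)

Section calculus.
Context (R : realType).
Implicit Types (f df : R -> R) (x y z K : R).

Lemma MVT_is_derive f df x y : x <= y ->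
  (forall z, x <= z <= y -> is_derive z 1 f (df z)) ->
  exists2 z, x <= z <= y & f y - f x = df z * (y - x).
Proof.
move=> xy fdf; have [||z] := @MVT_segment R f df x y xy.
- by move=> z; rewrite in_itv /= => /andP[xz zy]; apply: fdf; rewrite !ltW.
- apply: derivable_within_continuous => z; rewrite in_itv /= => zxy.
  by have [] := fdf z zxy.
by rewrite in_itv /= => zxy E; exists z.
Qed.

Lemma ler_is_derive f df x y : x <= y ->
  (forall z, x <= z <= y -> is_derive z 1 f (df z)) ->
  (forall z, x <= z <= y -> 0 <= df z) -> f x <= f y.
Proof.
move=> xy fdf df0; have [z zxy E] := MVT_is_derive xy fdf.
by rewrite -subr_ge0 E mulr_ge0 ?subr_ge0 // df0.
Qed.

Lemma lipschitz_is_derive f df K : (forall z, is_derive z 1 f (df z)) ->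
  (forall z, `|df z| <= K) -> forall x h, `|f (x + h) - f x| <= K * `|h|.
Proof.
move=> fdf dfK x h; have [h0|h0] := leP 0 h.
  have xh : x <= x + h by rewrite lerDl.
  have [z _ ->] := MVT_is_derive xh (fun z _ => fdf z).
  by rewrite addrAC subrr add0r normrM ler_wpM2r.
have xh : x + h <= x by rewrite gerDl ltW.
have [z _] := MVT_is_derive xh (fun z _ => fdf z).
rewrite opprD addrA subrr add0r -normrN opprB => ->.
by rewrite mulrN normrN normrM ler_wpM2r.
Qed.

(** The mean value theorem gives the increment as [df z * h] with [z] within [|h|] of [x]. A
    Lipschitz derivative is assumed rather than a second derivative, because the Stein solution
    inherits the corners of [ramp]. *)
Lemma taylor_is_derive f df K : (forall z, is_derive z 1 f (df z)) ->
  (forall x h, `|df (x + h) - df x| <= K * `|h|) ->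
  forall x h, `|f (x + h) - f x - h * df x| <= K * h ^+ 2.
Proof.
move=> fdf dfL x h.
have [z zP E] : exists2 z, `|z - x| <= `|h| & f (x + h) - f x = df z * h.
  have [h0|h0] := leP 0 h.
    have xh : x <= x + h by rewrite lerDl.
    have [z /andP[xz zx] E] := MVT_is_derive xh (fun z _ => fdf z).
    exists z; last by rewrite E addrAC subrr add0r.
    by rewrite (ger0_norm h0) ger0_norm ?subr_ge0 // lerBlDl.
  have xh : x + h <= x by rewrite gerDl ltW.
  have [z /andP[xz zx] E] := MVT_is_derive xh (fun z _ => fdf z).
  exists z; first by rewrite (ltr0_norm h0) ler0_norm ?subr_le0 // opprB; lra.
  by apply: oppr_inj; rewrite opprB E; ring.
rewrite E [h * _]mulrC -mulrBl normrM -(real_normK (num_real h)) expr2 mulrA.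
apply: ler_wpM2r => //; have := dfL x (z - x); rewrite [x + _]addrC subrK.
move=> /le_trans; apply; apply: ler_wpM2l => //.
by have := dfL 0 1; rewrite normr1 mulr1; apply: le_trans.
Qed.

End calculus.

(** * The centred normal law of variance v *)

Section gaussian.
Context (R : realType).
Implicit Types x y z : R.
Variables (v : R).
Hypothesis v0 : 0 < v.
Let sigma := Num.sqrt v.
Notation mu := (@lebesgue_measure R).
Definition gpdf : R -> R := normal_pdf 0 sigma.
Local Notation phi := gpdf.

Let sigma0 : sigma != 0. Proof. by rewrite gt_eqF // sqrtr_gt0. Qed.

Lemma gpdfE x : phi x = normal_peak sigma * expR (- (x ^+ 2 / (v *+ 2))).
Proof. by rewrite /phi normal_pdfE // /normal_fun subr0 sqr_sqrtr ?ltW // mulNr. Qed.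

Lemma gpdf_gt0 x : 0 < phi x.
Proof. by rewrite gpdfE mulr_gt0 ?expR_gt0 // normal_peak_gt0. Qed.

Lemma gpdfN x : phi (- x) = phi x. Proof. by rewrite !gpdfE sqrrN. Qed.

Lemma gpdf_le x y : `|x| <= `|y| -> phi y <= phi x.
Proof.
move=> xy; rewrite !gpdfE; apply: ler_wpM2l; first exact: normal_peak_ge0.
rewrite ler_expR lerN2; apply: ler_wpM2r; first by rewrite invr_ge0 mulrn_wge0 // ltW.
by rewrite -(real_normK (num_real x)) -(real_normK (num_real y)) lerXn2r ?nnegrE.
Qed.

Lemma is_derive_gpdf (x : R) : is_derive x 1 phi (- (x / v) * phi x).
Proof.
have -> : phi = (fun x => normal_peak sigma * expR (- (x ^+ 2 / (v *+ 2)))).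
  by apply/funext => y; rewrite gpdfE.
rewrite /=.
apply: is_derive_eq; rewrite /GRing.scale /= -mulr_natr; field.
by rewrite gt_eqF.
Qed.

Lemma continuous_gpdf : continuous phi. Proof. exact: continuous_normal_pdf. Qed.

Lemma measurable_gpdf : measurable_fun setT phi. Proof. exact: measurable_normal_pdf. Qed.

Lemma integrable_gpdfM (g : R -> R) : measurable_fun setT g -> (forall x, `|g x| <= 1) ->
  mu.-integrable setT (EFin \o (fun x => g x * phi x)).
Proof.
move=> mg g1; apply: (le_integrable measurableT _ _ (integrable_normal_pdf 0 sigma)).
  by apply/measurable_EFinP/measurable_funM => //; exact: measurable_gpdf.
move=> x _; rewrite /= lee_fin normrM.
by rewrite -[leRHS]mul1r ler_wpM2r.
Qed.

(* Integral of [g] on ]-oo, x] against the centred normal law of variance [v]. *)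
Definition gint (g : R -> R) x : R := \int[mu]_(t in `]-oo, x]) (g t * phi t).

Lemma is_derive_gint (g : R -> R) (x : R) : continuous g -> (forall x, `|g x| <= 1) ->
  is_derive x 1 (gint g) (g x * phi x).
Proof.
move=> cg g1; have mg : measurable_fun setT g by exact: continuous_measurable_fun.
have xx1 : x < x + 1 by rewrite ltrDl.
have ig : mu.-integrable `]-oo, (x + 1)] (EFin \o (fun x => g x * phi x)).
  by apply: integrableS (integrable_gpdfM mg g1).
have cgp : {for x, continuous (fun x => g x * phi x)}.
  by apply: cvgM; [exact: cg|exact: continuous_gpdf].
have [dg E] := continuous_FTC1 xx1 ig (ltNyr _) cgp.
rewrite -[X in is_derive _ _ _ X]E derive1E; exact: derivableP.
Qed.

Definition gcdf x : R := gint (fun=> 1) x.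

Lemma gcdfE x : normal_prob 0 sigma `]-oo, x] = (gcdf x)%:E.
Proof.
rewrite /gcdf /gint /Rintegral fineK; last first.
  apply: integrable_fin_num => //.
  apply: (integrableS measurableT) => //; apply: integrable_gpdfM => // y.
  by rewrite normr1.
by apply: eq_integral => y _; rewrite mul1r.
Qed.

Lemma is_derive_gcdf (x : R) : is_derive x 1 gcdf (phi x).
Proof.
rewrite -[X in is_derive _ _ _ X]mul1r; apply: is_derive_gint => [y|y]; first exact: cvg_cst.
by rewrite normr1.
Qed.

(** The identity, as a random variable under the normal law, has distribution function [gcdf]; the
    limits of [gcdf] at both ends then come from those of a general distribution function. *)
Let idR : measurableTypeR R -> R := idfun.
#[local] HB.instance Definition _ := @isMeasurableFun.Build _ _ _ _ idR (@measurable_id _ _ setT).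
Let idRV : {RV (normal_prob 0 sigma : probability (measurableTypeR R) R) >-> R} := idR.

Let cdf_gcdf x : cdf idRV x = (gcdf x)%:E.
Proof. exact: gcdfE. Qed.

Lemma gcdf_Ny e : 0 < e -> exists M, forall y, y < M -> `|gcdf y| < e.
Proof.
move=> e0; have /fine_cvg := cvg_cdfNy0 idRV.
rewrite (_ : fine \o cdf idRV = gcdf); last by apply/funext => y; exact: (congr1 fine (cdf_gcdf y)).
move=> /cvgrPdist_lt /(_ e e0)[M [_ HM]]; exists M => y /HM /=.
by rewrite sub0r normrN.
Qed.

Lemma gcdf_y e : 0 < e -> exists M, forall y, M < y -> `|1 - gcdf y| < e.
Proof.
move=> e0; have /fine_cvg := cvg_cdfy1 idRV.
rewrite (_ : fine \o cdf idRV = gcdf); last by apply/funext => y; exact: (congr1 fine (cdf_gcdf y)).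
by move=> /cvgrPdist_lt /(_ e e0)[M [_ HM]]; exists M => y /HM.
Qed.

Definition vanishes_Ny (Q : R -> R) : Prop :=
  forall e, 0 < e -> exists M, forall y, y < M -> `|Q y| < e.

Lemma ge0_of_derive_Ny (K dK : R -> R) x : vanishes_Ny K ->
  (forall z, z <= x -> is_derive z 1 K (dK z)) -> (forall z, z <= x -> 0 <= dK z) -> 0 <= K x.
Proof.
move=> K0 dKK dK0; rewrite leNgt; apply/negP => Kx.
have [M HM] := K0 (- K x) (eqbRL (oppr_gt0 _) Kx).
pose y := Num.min (M - 1) x.
have yx : y <= x by rewrite /y ge_min lexx orbT.
have yM : y < M by rewrite /y gt_min ltrBlDr ltrDl ltr01.
have := HM y yM.
have : K y <= K x by apply: (ler_is_derive yx (df := dK)) => z /andP[_ zx]; [exact: dKK|exact: dK0].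
move=> h; rewrite ltr0_norm; last exact: le_lt_trans h Kx.
by rewrite ltrN2 ltNge h.
Qed.

Lemma vanishesD_Ny (Q Q' : R -> R) : vanishes_Ny Q -> vanishes_Ny Q' ->
  vanishes_Ny (fun x => Q x + Q' x).
Proof.
move=> hQ hQ' e e0; have e2 : 0 < e / 2 by rewrite divr_gt0.
have [M HM] := hQ _ e2; have [M' HM'] := hQ' _ e2.
exists (Num.min M M') => y; rewrite lt_min => /andP[yM yM'].
apply: le_lt_trans (ler_normD _ _) _.
by rewrite [e]splitr; apply: ltrD; [exact: HM|exact: HM'].
Qed.

Lemma vanishesN_Ny (Q : R -> R) : vanishes_Ny Q -> vanishes_Ny (fun x => - Q x).
Proof.
by move=> hQ e e0; have [M HM] := hQ e e0; exists M => y /HM; rewrite normrN.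
Qed.

Lemma vanishes_Ny_le (Q : R -> R) C : (forall x, x < 0 -> `|Q x| <= C / - x) -> vanishes_Ny Q.
Proof.
move=> hQ e e0; exists (- (`|C| + 1) / e) => y.
rewrite ltr_pdivlMr // => ye.
have y0 : y < 0.
  by rewrite -(pmulr_llt0 _ e0); apply: lt_trans ye _; rewrite oppr_lt0 ltr_pwDr.
apply: le_lt_trans (hQ y y0) _; rewrite ltr_pdivrMr ?oppr_gt0 //.
by have := ler_norm C; nra.
Qed.

(** * Bounds on the Mills ratio *)

Section mills.
Variable Q : R -> R.
Hypothesis dQ : forall x : R, is_derive x 1 Q (phi x).
Hypothesis Q0 : vanishes_Ny Q.

Let peak_bound x : phi x <= normal_peak sigma. Proof. exact: normal_pdf_ub. Qed.

(* In both Mills bounds the difference of the two sides vanishes at -oo and is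
   nondecreasing on the negative half-line. *)
Lemma mills_upper x : x < 0 -> Q x <= - (v * phi x / x).
Proof.
move=> x0; rewrite -subr_ge0.
have /= := @ge0_of_derive_Ny (fun x => - (v * phi x / x) - Q x) (fun x => v * phi x / x ^+ 2) x.
apply.
- apply: vanishesD_Ny; last exact: vanishesN_Ny.
  apply: (@vanishes_Ny_le _ (v * normal_peak sigma)) => y y0.
  have ny : 0 <= (- y)^-1 by rewrite invr_ge0 oppr_ge0 ltW.
  rewrite -mulrN -invrN normrM (ger0_norm ny); apply: ler_wpM2r => //.
  rewrite ger0_norm; last by rewrite mulr_ge0 // ltW // gpdf_gt0.
  by apply: ler_wpM2l; [exact: ltW|exact: peak_bound].
- move=> z zx; have z0 : z != 0 by rewrite lt_eqF // (le_lt_trans zx).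
  have h1 := is_derive_gpdf z; have h2 := is_deriveV z0 (is_derive_id z 1).
  have h3 := dQ z.
  apply: is_derive_eq; rewrite /GRing.scale /=; field.
  by rewrite z0 gt_eqF.
- by move=> z _; rewrite divr_ge0 ?sqr_ge0 // mulr_ge0 // ltW // gpdf_gt0.
Qed.

Let vx0 x : 0 < v + x ^+ 2. Proof. by rewrite ltr_pwDl ?sqr_ge0. Qed.

Lemma mills_lower x : x < 0 -> - (v * x * phi x / (v + x ^+ 2)) <= Q x.
Proof.
move=> x0; rewrite -subr_ge0 opprK.
have /= := @ge0_of_derive_Ny (fun x => Q x + v * x * phi x / (v + x ^+ 2))
  (fun x => 2 * v ^+ 2 * phi x / (v + x ^+ 2) ^+ 2) x.
apply.
- apply: vanishesD_Ny => //.
  apply: (@vanishes_Ny_le _ (v * normal_peak sigma)) => y y0.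
  have p0 := ltW (gpdf_gt0 y).
  rewrite normrM (gtr0_norm (x := (v + y ^+ 2)^-1)) ?invr_gt0 // ler_pdivrMr //.
  rewrite !normrM (gtr0_norm v0) (ltr0_norm y0) (ger0_norm p0).
  rewrite [leRHS]mulrAC ler_pdivlMr ?oppr_gt0 //.
  have -> : v * - y * phi y * - y = v * phi y * y ^+ 2 by ring.
  apply: ler_pM; [by rewrite mulr_ge0 // ltW|exact: sqr_ge0| |by rewrite lerDr ltW].
  by apply: ler_wpM2l; [exact: ltW|exact: peak_bound].
- move=> z zx; have z0 : v + z ^+ 2 != 0 by rewrite gt_eqF.
  have h1 := is_derive_gpdf z; have h2 : is_derive z 1 (fun z => v + z ^+ 2) (2 * z).
    by apply: is_derive_eq; rewrite /GRing.scale /=; ring.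
  have h3 := @is_deriveV R (fun z => v + z ^+ 2) _ _ _ z0 h2.
  have h4 := dQ z.
  apply: is_derive_eq; rewrite /GRing.scale /=; field.
  by rewrite z0 gt_eqF.
- move=> z _; apply: divr_ge0; last exact: sqr_ge0.
  by apply: mulr_ge0; [rewrite mulr_ge0 // sqr_ge0|exact/ltW/gpdf_gt0].
Qed.

(** Up to a factor in [[0, 1]], [r] is the Stein solution on the tail and the last quantity is [x]
    times its derivative. There [x ^ 2 * r] and [x] nearly cancel, so both Mills bounds are used. *)
Lemma mills_ratio x : x <= -1 -> let r := Q x / (v * phi x) in
  [/\ 0 <= r <= 1, `|x * r| <= 1 & `|(x ^+ 2 * r + x) / v| <= 1].
Proof.
move=> x1 r; have x0 : x < 0 by apply: le_lt_trans x1 _; rewrite ltrN10.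
have p0 : 0 < v * phi x by rewrite mulr_gt0 // gpdf_gt0.
have up : r <= - x^-1.
  rewrite /r ler_pdivrMr //; apply: le_trans (mills_upper x0) _.
  by rewrite le_eqVlt; apply/orP; left; apply/eqP; ring.
have lo : - x / (v + x ^+ 2) <= r.
  rewrite /r ler_pdivlMr //; apply: le_trans (mills_lower x0).
  by rewrite le_eqVlt; apply/orP; left; apply/eqP; ring.
have r0 : 0 <= r.
  by apply: le_trans lo; apply: divr_ge0; [rewrite oppr_ge0 ltW|exact: ltW].
have xr : - x * r <= 1.
  have := ler_wpM2l (_ : 0 <= - x) up; rewrite mulrNN mulfV ?lt_eqF //; apply.
  by rewrite oppr_ge0 ltW.
have xr' : - x <= (v + x ^+ 2) * r by rewrite mulrC -ler_pdivrMr.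
clearbody r.
have r1 : r <= 1.
  by apply: le_trans xr; rewrite -{1}[r]mul1r; apply: ler_wpM2r => //; rewrite lerNr.
split; first by rewrite r0.
  by rewrite -normrN -mulNr ger0_norm // mulr_ge0 // oppr_ge0 ltW.
rewrite normrM (gtr0_norm (x := v^-1)) ?invr_gt0 // ler_pdivrMr // mul1r.
have x2r : x ^+ 2 * r <= - x.
  have -> : x ^+ 2 * r = - x * (- x * r) by ring.
  by rewrite -[leRHS]mulr1; apply: ler_wpM2l => //; rewrite oppr_ge0 ltW.
have vr : v * r <= v by rewrite -[leRHS]mulr1; apply: ler_wpM2l => //; exact: ltW.
by rewrite ler_norml; move: xr'; rewrite mulrDl; lra.
Qed.

End mills.

(** Since [phi] is even, the reflected upper tail is again a primitive of [phi], so the Mills bounds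
    at [- x] serve for large positive [x]. *)
Lemma is_derive_gcdfN (x : R) : is_derive x 1 (fun x => 1 - gcdf (- x)) (phi x).
Proof.
have h1 : is_derive (- x) 1 gcdf (phi (- x)) := is_derive_gcdf (- x).
have h2 := @is_derive1_comp R gcdf -%R x _ _ h1 (is_deriveNid x 1).
have h3 : is_derive x 1 (fun y => gcdf (- y)) (- phi x).
  by apply: is_derive_eq h2 _; rewrite gpdfN mulrN1.
by apply: is_derive_eq; rewrite /GRing.scale /=; ring.
Qed.

Lemma gcdfN_Ny : vanishes_Ny (fun x => 1 - gcdf (- x)).
Proof.
move=> e /gcdf_y[M HM]; exists (- M) => y yM; apply: HM.
by rewrite ltrNr.
Qed.

Lemma gcdf_itv x : 0 <= gcdf x <= 1.
Proof.
rewrite -!lee_fin -gcdfE measure_ge0 /=.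
exact: (@probability_le1 _ _ _ (normal_prob 0 sigma)).
Qed.

(** * The solution of the Stein equation for a ramp *)

Section stein_solution.
Variables a b : R.
Hypothesis ab : a < b.

Definition ramp x : R := Num.min 1 (Num.max 0 ((b - x) / (b - a))).

Let ba0 : 0 < b - a. Proof. by rewrite subr_gt0. Qed.

Lemma ramp_itv x : 0 <= ramp x <= 1.
Proof. by rewrite /ramp le_min ler01 le_max lexx /= ge_min lexx. Qed.

Lemma ramp1 x : x <= a -> ramp x = 1.
Proof.
move=> xa; rewrite /ramp min_l // le_max ler_pdivlMr // mul1r.
by rewrite lerB // orbT.
Qed.

Lemma ramp0 x : b <= x -> ramp x = 0.
Proof.
move=> bx; rewrite /ramp max_l ?min_r //.
by rewrite ler_pdivrMr // mul0r subr_le0.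
Qed.

Lemma ramp_lipschitz x y : `|ramp x - ramp y| <= (b - a)^-1 * `|x - y|.
Proof.
have -> : (b - a)^-1 * `|x - y| = `|(b - x) / (b - a) - (b - y) / (b - a)|.
  rewrite -mulrBl normrM (gtr0_norm (x := (b - a)^-1)) ?invr_gt0 // mulrC distrC.
  by congr (`|_| * _); ring.
rewrite /ramp; move: (_ / _) (_ / _) => s t.
have mono (p q : R) : p <= q -> 0 <= Num.min 1 (Num.max 0 q) - Num.min 1 (Num.max 0 p) <= q - p.
  move=> pq; case: (leP 0 p) => p0; case: (leP 0 q) => q0; rewrite ?(min_r ler01);
    [case: (leP 1 p) => p1; case: (leP 1 q) => q1| |case: (leP 1 q) => q1|]; lra.
have [st|/ltW ts] := leP s t.
  have /andP[h0 h1] := mono _ _ st.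
  by rewrite (ger0_norm h0) ger0_norm // subr_ge0.
have /andP[h0 h1] := mono _ _ ts.
by rewrite distrC (ger0_norm h0) distrC ger0_norm // subr_ge0.
Qed.

Lemma continuous_ramp : continuous ramp.
Proof.
move=> x; apply/cvgrPdist_lt => e e0; near=> y.
apply: le_lt_trans (ramp_lipschitz x y) _.
rewrite mulrC ltr_pdivrMr //; near: y.
by apply: cvgr_dist_lt; [exact: cvg_id|rewrite mulr_gt0].
Unshelve. all: by end_near. Qed.

Let measurable_ramp : measurable_fun setT ramp.
Proof. exact: continuous_measurable_fun continuous_ramp. Qed.

Let ramp_norm x : `|ramp x| <= 1.
Proof. by have /andP[h0 h1] := ramp_itv x; rewrite ger0_norm. Qed.

Definition ramp_mean : R := \int[mu]_t (ramp t * phi t).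
Local Notation c := ramp_mean.

Lemma gint_ramp x : b <= x -> gint ramp x = c.
Proof.
move=> bx; rewrite /gint Rintegral_mkcond; congr Rintegral; apply/funext => t.
rewrite patchE; case: ifPn => //; rewrite notin_setE /= in_itv /= => /negP.
by rewrite -ltNge => xt; rewrite ramp0 ?mul0r // (le_trans bx) // ltW.
Qed.

Let one_norm (x : R) : `|1 : R| <= 1. Proof. by rewrite normr1. Qed.

Let int_itv (g : R -> R) x : measurable_fun setT g -> (forall x, `|g x| <= 1) ->
  mu.-integrable `]-oo, x] (EFin \o (fun t => g t * phi t)).
Proof. by move=> mg g1; apply: integrableS (integrable_gpdfM mg g1). Qed.

Let int_one x : mu.-integrable `]-oo, x] (EFin \o (fun t => 1 * phi t)).
Proof. by apply: (@int_itv (fun=> 1)). Qed.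

Lemma ramp_mean_itv : gcdf a <= c <= gcdf b.
Proof.
apply/andP; split.
  rewrite /gcdf /gint Rintegral_mkcond; apply: le_Rintegral => //.
  - by rewrite -restrict_EFin; apply/(integrable_mkcond _ _).1.
  - exact: integrable_gpdfM.
  move=> t _; rewrite patchE; case: ifPn => [|_].
    by rewrite inE /= in_itv /= => ta; rewrite ramp1.
  by rewrite mulr_ge0 ?(ltW (gpdf_gt0 _)) //; case/andP: (ramp_itv t).
rewrite -(gint_ramp (lexx b)); apply: le_Rintegral => //; try exact: int_itv.
by move=> t _; apply: ler_wpM2r; [exact/ltW/gpdf_gt0|case/andP: (ramp_itv t)].
Qed.

Let c01 : 0 <= c <= 1.
Proof.
have /andP[c0 c1] := ramp_mean_itv; have /andP[a0 _] := gcdf_itv a.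
by have /andP[_ b1] := gcdf_itv b; rewrite (le_trans a0 c0) (le_trans c1 b1).
Qed.

Let hc x := ramp x - c.

Let hc_norm x : `|hc x| <= 1.
Proof.
by rewrite /hc ler_norml; have := ramp_itv x; have := c01; lra.
Qed.

Let continuous_hc : continuous hc.
Proof. by move=> x; apply: cvgB; [exact: continuous_ramp|exact: cvg_cst]. Qed.

Let J := gint hc.

Let JE x : J x = gint ramp x - c * gcdf x.
Proof.
have i1 := int_one x; have i2 := int_itv x measurable_ramp ramp_norm.
have i3 : mu.-integrable `]-oo, x] (EFin \o (fun t => c * (1 * phi t))).
  by apply: (integrableZl _ c i1).
rewrite /J /gcdf /gint -RintegralZl // -RintegralB //.
by apply: eq_Rintegral => t _; rewrite /hc; ring.
Qed.

Let J_left x : x <= a -> J x = (1 - c) * gcdf x.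
Proof.
move=> xa; rewrite JE mulrBl mul1r; congr (_ - _).
apply: eq_Rintegral => t; rewrite inE /= in_itv /= => tx.
by rewrite ramp1 // (le_trans tx).
Qed.

Let J_right x : b <= x -> J x = c * (1 - gcdf x).
Proof. by move=> bx; rewrite JE gint_ramp //; ring. Qed.

Let J_norm x : `|J x| <= 1.
Proof.
apply: le_trans (le_normr_Rintegral _ _) _ => //.
  apply: int_itv => //; exact: continuous_measurable_fun continuous_hc.
have /andP[_ g1] := gcdf_itv x; apply: le_trans g1.
apply: le_Rintegral => //.
- apply: (@integrable_norm _ _ _ mu) => //; apply: int_itv => //.
  exact: continuous_measurable_fun continuous_hc.
move=> t _; rewrite normrM (gtr0_norm (gpdf_gt0 t)).
by apply: ler_wpM2r => //; exact/ltW/gpdf_gt0.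
Qed.

(* The integral [J] vanishes at both ends, so that on the tails it is a multiple
   of [gcdf] or of [1 - gcdf], to which the Mills bounds apply. *)
Definition stein_sol x : R := J x / (v * phi x).
(** Defined by the Stein equation itself, which is then pure algebra; that it is the derivative of
    [stein_sol] is proved separately. *)
Definition stein_sol' x : R := (x * stein_sol x + hc x) / v.
Local Notation f := stein_sol.
Local Notation f' := stein_sol'.

Lemma stein_equation x : v * f' x - x * f x = ramp x - c.
Proof. by rewrite /stein_sol' /hc; field; rewrite gt_eqF. Qed.

Lemma is_derive_stein_sol (x : R) : is_derive x 1 f (f' x).
Proof.
have p0 : v * phi x != 0 by rewrite mulf_neq0 ?gt_eqF // gpdf_gt0.
have h1 := is_derive_gpdf x; have h2 := is_derive_gint x continuous_hc hc_norm.
have h3 : is_derive x 1 (fun x => v * phi x) (- x * phi x).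
  by apply: is_derive_eq; rewrite /GRing.scale /=; field; rewrite gt_eqF.
have h4 := @is_deriveV R (fun x => v * phi x) _ _ _ p0 h3.
apply: is_derive_eq; rewrite /stein_sol' /stein_sol /GRing.scale /= -/J; field.
by rewrite !gt_eqF ?gpdf_gt0.
Qed.

(** Here [r] is a Mills ratio and [g] is the factor of the solution on a tail, [1 - c] on the left
    and [c] on the right. *)
Let tail_bound (g : R) (y r : R) : 0 <= g <= 1 ->
  [/\ 0 <= r <= 1, `|y * r| <= 1 & `|(y ^+ 2 * r + y) / v| <= 1] ->
  [/\ `|g * r| <= 2, `|y * (g * r)| <= 2 & `|g * r + y * ((y * (g * r) + g) / v)| <= 2].
Proof.
move=> /andP[g0 g1] [/andP[r0 r1] yr yr2].
have gr : 0 <= g * r <= 1 by apply/andP; split; nra.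
split.
- by rewrite ger0_norm; case/andP: gr => // h1 h2; lra.
- rewrite mulrCA normrM (ger0_norm g0).
  by move: `|y * r| (normr_ge0 (y * r)) yr => z z0 z1; nra.
have -> : y * ((y * (g * r) + g) / v) = g * ((y ^+ 2 * r + y) / v) by field; rewrite gt_eqF.
move: ((y ^+ 2 * r + y) / v) yr2 => z z1.
apply: le_trans (ler_normD _ _) _; rewrite [X in X + _]ger0_norm; last by case/andP: gr.
rewrite normrM (ger0_norm g0); case/andP: gr => _ gr.
by move: `|z| (normr_ge0 z) z1 => {}z z0 z1; nra.
Qed.

(* Here [f x + x * f' x] is the derivative of [x * f x], whence [f'] is Lipschitz. *)
Lemma stein_sol_bounded : exists M, forall x,
  [/\ `|f x| <= M, `|x * f x| <= M & `|f x + x * f' x| <= M].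
Proof.
(* Beyond [L] in absolute value, [x] is outside the open interval from [a] to [b] and [1 <= |x|], as
   the Mills bounds demand. *)
pose L := 1 + `|a| + `|b|.
have L1 : 1 <= L by rewrite /L -addrA lerDl addr_ge0.
(* Bounds the solution on [[-L, L]], where [phi] is at least [phi L] and [J] is at most 1 in
   absolute value. *)
pose F0 := (v * phi L)^-1.
have F00 : 0 <= F0 by rewrite invr_ge0 mulr_ge0 ?ltW // gpdf_gt0.
exists (2 + F0 + L * F0 + (F0 + L * ((L * F0 + 1) / v))) => x.
have big : 0 <= L * F0 /\ 0 <= L * ((L * F0 + 1) / v).
  have h : 0 <= L * F0 by rewrite mulr_ge0 // (le_trans ler01).
  split => //; apply: mulr_ge0; first exact: le_trans ler01 _.
  by apply: divr_ge0; [exact: addr_ge0|exact: ltW].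
have [xL|xL] := lerP x (- L).
  have xa : x <= a.
    apply: le_trans xL _; rewrite /L; have := ler_norm (- a); rewrite normrN.
    by have := normr_ge0 b; lra.
  have x1 : x <= -1 by apply: le_trans xL _; rewrite lerN2.
  have := tail_bound (_ : 0 <= 1 - c <= 1) (mills_ratio is_derive_gcdf gcdf_Ny x1).
  have -> : (1 - c) * (gcdf x / (v * phi x)) = f x by rewrite /stein_sol J_left //; ring.
  rewrite /stein_sol' /hc ramp1 //; move=> /(_ _)[|h1 h2 h3]; first by have := c01; lra.
  by split; [move: h1|move: h2|move: h3] => /le_trans; apply; lra.
have [Lx|xL'] := lerP L x.
  have bx : b <= x.
    by apply: le_trans Lx; rewrite /L; have := ler_norm b; have := normr_ge0 a; lra.
  have x1 : - x <= -1 by rewrite lerN2; apply: le_trans Lx.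
  have := tail_bound c01 (mills_ratio is_derive_gcdfN gcdfN_Ny x1).
  rewrite opprK gpdfN.
  have -> : c * ((1 - gcdf x) / (v * phi x)) = f x by rewrite /stein_sol J_right //; ring.
  rewrite /stein_sol' /hc ramp0 //.
  (* Evaluating at [- x] changes the sign of both factors, so the bound carries over to [x]. *)
  have -> : f x + - x * ((- x * f x + c) / v) = f x + x * ((x * f x + (0 - c)) / v) by field; rewrite gt_eqF.
  rewrite mulNr normrN => -[h1 h2 h3].
  by split; [move: h1|move: h2|move: h3] => /le_trans; apply; lra.
have xn : `|x| <= L by rewrite ler_norml; apply/andP; split; exact: ltW.
have fF : `|f x| <= F0.
  rewrite /stein_sol normrM normfV (gtr0_norm (x := v * phi x)) ?mulr_gt0 ?gpdf_gt0 //.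
  have vp y : 0 < v * phi y by rewrite mulr_gt0 // gpdf_gt0.
  rewrite -[F0]mul1r; apply: ler_pM => //; first by rewrite invr_ge0 ltW.
  rewrite /F0 lef_pV2 ?posrE ?mulr_gt0 ?gpdf_gt0 //.
  apply: ler_wpM2l; first exact: ltW.
  by apply: gpdf_le; rewrite [leRHS]ger0_norm // (le_trans ler01).
have xf : `|x * f x| <= L * F0 by rewrite normrM; apply: ler_pM.
have xf' : `|x * f' x| <= L * ((L * F0 + 1) / v).
  rewrite normrM; apply: ler_pM => //.
  rewrite normrM normfV (gtr0_norm v0); apply: ler_wpM2r; first by rewrite invr_ge0 ltW.
  by apply: le_trans (ler_normD _ _) _; apply: lerD.
split; [apply: le_trans fF _; lra|apply: le_trans xf _; lra|].
by apply: le_trans (ler_normD _ _) _; move: fF xf'; lra.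
Qed.

Lemma stein_solution : exists (g g' : R -> R) (K : R),
  [/\ measurable_fun setT g, measurable_fun setT g',
      (forall x, `|g x| <= K) & (forall x, `|g' x| <= K)] /\
  [/\ (forall x h, `|g (x + h) - g x - h * g' x| <= K * h ^+ 2),
      (forall x h, `|g' (x + h) - g' x| <= K * `|h|) &
      (forall x, v * g' x - x * g x = ramp x - c)].
Proof.
have [M HM] := stein_sol_bounded.
have M0 : 0 <= M by have [h _ _] := HM 0; apply: le_trans h.
pose K := M + (M + 1) / v + (M + (b - a)^-1) / v.
have iv : 0 <= v^-1 by rewrite invr_ge0 ltW.
have iba : 0 <= (b - a)^-1 by rewrite invr_ge0 ltW.
have k1 : 0 <= (M + 1) / v by rewrite mulr_ge0 // addr_ge0.
have k2 : 0 <= (M + (b - a)^-1) / v by rewrite mulr_ge0 // addr_ge0.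
(* [v * f'] is [x * f + ramp - c]: the first term is Lipschitz by the bound on its derivative, the
   ramp by its slope. *)
have f'L x h : `|f' (x + h) - f' x| <= K * `|h|.
  pose F (x : R) := x * f x.
  have dF (z : R) : is_derive z 1 F (f z + z * f' z).
    have h1 := is_derive_stein_sol z.
    by apply: is_derive_eq; rewrite /GRing.scale /=; ring.
  have FL := lipschitz_is_derive dF (fun z => let: And3 _ _ h := HM z in h).
  rewrite /stein_sol' -mulrBl normrM (ger0_norm iv).
  apply: (@le_trans _ _ ((M + (b - a)^-1) * `|h| / v)).
    apply: ler_wpM2r => //.
    have -> : (x + h) * f (x + h) + hc (x + h) - (x * f x + hc x) =
       (F (x + h) - F x) + (ramp (x + h) - ramp x) by rewrite /F /hc; ring.
    apply: le_trans (ler_normD _ _) _; rewrite mulrDl; apply: lerD; first exact: FL.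
    by apply: le_trans (ramp_lipschitz _ _) _; rewrite addrAC subrr add0r.
  rewrite mulrAC; apply: ler_wpM2r => //; rewrite /K; lra.
have cf : continuous f.
  move=> z; apply: differentiable_continuous; apply/derivable1_diffP.
  by have [] := is_derive_stein_sol z.
have mf : measurable_fun setT f by exact: continuous_measurable_fun.
exists f, f', K; split; split.
- exact: mf.
- apply: measurable_funM; last exact: measurable_cst.
  apply: measurable_funD; first exact: measurable_funM.
  exact: continuous_measurable_fun continuous_hc.
- by move=> x; have [h _ _] := HM x; apply: le_trans h _; rewrite /K; lra.
- move=> x; have [_ h _] := HM x.
  rewrite normrM (ger0_norm iv); apply: (@le_trans _ _ ((M + 1) / v)); last by rewrite /K; lra.
  apply: ler_wpM2r => //; apply: le_trans (ler_normD _ _) _; exact: lerD.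
- exact: taylor_is_derive is_derive_stein_sol f'L.
- exact: f'L.
- exact: stein_equation.
Qed.

End stein_solution.
End gaussian.

(** * Convergence of the distribution functions *)

Section moments.
Context (d : measure_display) (T : measurableType d) (R : realType) (P : probability T R).
Variable X : nat -> {RV P >-> R}.
Hypothesis momX : forall k : nat, (3 <= k)%N ->
  (ereal_sup (range (fun i : nat => 'E_P[(fun w => `|X i w| ^+ k)%R])) < +oo)%E.

Let sup k := ereal_sup (range (fun i : nat => 'E_P[(fun w => `|X i w| ^+ k)%R]%E)).

Let E_le_sup i k : (\int[P]_w (`|X i w| ^+ k)%:E <= sup k)%E.
Proof.
have -> : (\int[P]_w (`|X i w| ^+ k)%:E = 'E_P[(fun w => `|X i w| ^+ k)%R])%E by rewrite unlock.
by apply: ereal_sup_ubound; exists i.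
Qed.

Let integrable_moment i k : (3 <= k)%N -> P.-integrable setT (fun w => (`|X i w| ^+ k)%:E).
Proof.
move=> k3; apply/integrableP; split.
  by apply/measurable_EFinP/measurable_funX/measurableT_comp.
under eq_integral do rewrite gee0_abs ?lee_fin ?exprn_ge0 //.
exact: le_lt_trans (E_le_sup i k) (momX k3).
Qed.

Let pow_le (x : R) (k m : nat) : (k <= m)%N -> `|x| ^+ k <= 1 + `|x| ^+ m.
Proof.
move=> km; have [x1|x1] := leP `|x| 1.
  by apply: (@le_trans _ _ 1); rewrite ?exprn_ile1 // lerDl exprn_ge0.
by apply: (@le_trans _ _ (`|x| ^+ m)); rewrite ?lerDr // ler_weXn2l // ltW.
Qed.

(** The moment hypothesis starts at order 3, so the order [k] is dominated by
    [1 + |x| ^ (k + 3)]. *)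
Lemma all_moments_RV i : all_moments P (X i).
Proof.
apply: (@all_moments_le _ _ _ _ _ (fun k w => 1 + `|X i w| ^+ (k + 3))) => // [k|k w].
  have i1 : P.-integrable setT (EFin \o (fun _ : T => 1 : R)).
    exact: finite_measure_integrable_cst.
  exact: (integrableD measurableT i1 (integrable_moment i (leq_addl k 3))).
by apply: pow_le; rewrite leq_addr.
Qed.

(** The suprema are uniform in [i], and the one of order [K + 3] dominates all orders up to [K]. *)
Lemma moments_bounded K : exists2 beta : R, 1 <= beta &
  forall i k, (k <= K)%N -> `|Ex P (fun w => X i w ^+ k)| <= beta.
Proof.
have K3 : (3 <= K + 3)%N by rewrite leq_addl.
have sup0 : (0 <= sup (K + 3))%E.
  by apply: le_trans (E_le_sup 0 _); apply: integral_ge0 => w _; rewrite lee_fin exprn_ge0.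
have fsup : sup (K + 3) \is a fin_num by rewrite ge0_fin_numE // momX.
exists (1 + fine (sup (K + 3))); first by rewrite lerDl fine_ge0.
move=> i k kK; have hX := all_moments_RV i.
have hXn : all_moments P (fun w => `|X i w| ^+ (K + 3)) by apply: all_momentsX; apply: all_moments_norm.
apply: (@le_trans _ _ (Ex P (fun w => 1 + `|X i w| ^+ (K + 3)))).
  apply: Ex_norm_le; first exact: all_momentsX.
    by apply: all_momentsD => //; apply: all_moments_cst.
  by move=> w; rewrite normrX; apply: pow_le; rewrite (leq_trans kK) // leq_addr.
rewrite ExD ?Ex_cst //; last exact: all_moments_cst.
rewrite lerD2l /Ex /Rintegral fine_le //.
by apply: integrable_fin_num => //; apply: integrable_moment.
Qed.

End moments.

(** * Rate of convergence against ramps *)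

Section rate.
Context (dT : measure_display) (T : measurableType dT) (R : realType) (P : probability T R).
Variable X : nat -> {RV P >-> R}.
Hypothesis indepX : independent_RVs X.
Hypothesis meanX : forall i, Ex P (X i) = 0.
Hypothesis varX : forall i, Ex P (fun w => X i w ^+ 2) = 1.
Hypothesis momX : forall i, all_moments P (X i).
Hypothesis bndX : forall K, exists2 beta : R, 1 <= beta &
  forall i k, (k <= K)%N -> `|Ex P (fun w => X i w ^+ k)| <= beta.
Variables (D : nat) (a : nat -> R).
Hypothesis D2 : (2 <= D)%N.
Hypothesis aD : a D != 0.
Let v := limit_variance D a.

Lemma limit_variance_gt0 : 0 < v.
Proof.
rewrite /v limit_varianceE big_nat_recr //= ltr_wpDl //.
  by apply: sumr_ge0 => k _; rewrite mulr_ge0 // sqr_ge0.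
by rewrite mulr_gt0 ?ltr0n ?fact_gt0 // exprn_even_gt0.
Qed.

Let W n := chaos X (circ_coef D (n := n) a).
Let Rm n := remainder X D n a.
Let s n := sqrt_size R n.

Let hW n : all_moments P (W n). Proof. exact: all_moments_lin. Qed.
Let hRm n : all_moments P (Rm n).
Proof.
apply: all_moments_sum => k _; apply: all_momentsM; first exact: all_moments_cst.
by apply: all_moments_sum => f _; apply: all_moments_word_mono.
Qed.

(** The chaos is centred, so after division by [s n] the expectation of the trace is that of the
    remainder. *)
Lemma normalized_trace_statE n w :
  normalized_trace_stat X (poly_ge2 D a) n w = W n w + (Rm n w - Ex P (Rm n)).
Proof.
have s0 : s n != 0 by rewrite gt_eqF // sqrt_size_gt0.
have trE : trace_stat X (poly_ge2 D a) n = (fun w => s n * (W n w + Rm n w)).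
  by apply/funext => w'; rewrite -trace_decomposition mulrC divfK.
have -> : normalized_trace_stat X (poly_ge2 D a) n w =
    (trace_stat X (poly_ge2 D a) n w - Ex P (trace_stat X (poly_ge2 D a) n)) / s n.
  by rewrite /normalized_trace_stat unlock.
rewrite trE ExZ; last exact: all_momentsD.
rewrite ExD // (Ex_chaos indepX momX meanX varX (circ_coef0 _ _ _)).
by field.
Qed.

(** This is [N ^ (- 1/4)], the weight [e] that balances [e] against [e^-1 / s]. *)
Let q n := Num.sqrt (s n)^-1.

(** The remainder costs the slope of the ramp times twice its L1 norm, once for itself and once for
    its mean; the chaos is handled by [stein_bound] with weight [q n]. *)
Lemma ramp_rate x y : x < y -> exists C, forall n,
  `|Ex P (fun w => ramp x y (normalized_trace_stat X (poly_ge2 D a) n w)) - ramp_mean v x y| <= C * q n.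
Proof.
move=> xy; have v0 := limit_variance_gt0.
have [g [g' [K [[mg mg' gK g'K] [gT g'L gE]]]]] := stein_solution v0 xy.
have K0 : 0 <= K by apply: le_trans (gK 0).
(* Order 4 serves for quadruples of sets, 6 for the Taylor remainders, and [2 D] for the squares of
   the non-injective sums. *)
have [beta b1 hb] := bndX (4 + 6 + D.*2).
have hb4 i m : (m <= 4)%N -> `|Ex P (fun w => X i w ^+ m)| <= beta.
  by move=> m4; apply: hb; lia.
have hb6 i : Ex P (fun w => X i w ^+ 6) <= beta.
  by apply: le_trans (ler_norm _) (hb _ _ _); lia.
have hbD i m : (m <= D.*2)%N -> `|Ex P (fun w => X i w ^+ m)| <= beta.
  by move=> mD; apply: hb; lia.
pose C1 := coef_const D a ^+ 4 * (beta ^+ (4 * D) + (beta ^+ (4 * D)) ^+ 2) * quad_const R D.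
pose C2 := coef_const D a ^+ 4 * beta ^+ (4 * D) * quad_const R D.
pose C3 := variance_const D a.
pose C4 := \sum_(2 <= k < D.+1) `|a k| * (1 + beta ^+ k.*2 * (word_const (bool * 'I_k)%type)%:R).
have beta0 : 0 <= beta by apply: le_trans b1.
have bD0 : 0 <= beta ^+ (4 * D) by rewrite exprn_ge0.
have cc0 : 0 <= coef_const D a ^+ 4 by rewrite exprn_ge0 // coef_const_ge0.
have C10 : 0 <= C1.
  apply: mulr_ge0; last exact: quad_const_ge0.
  by apply: mulr_ge0 => //; apply: addr_ge0 => //; exact: sqr_ge0.
have C20 : 0 <= C2 by apply: mulr_ge0; [exact: mulr_ge0|exact: quad_const_ge0].
have C30 : 0 <= C3.
  by apply: sumr_ge0 => k _; apply: mulr_ge0 => //; apply: mulr_ge0 => //; exact: sqr_ge0.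
have C40 : 0 <= C4.
  apply: sumr_ge0 => k _; apply: mulr_ge0 => //; apply: addr_ge0 => //.
  by apply: mulr_ge0 => //; exact: exprn_ge0.
pose iyx := (y - x)^-1.
have iyx0 : 0 <= iyx by rewrite invr_ge0 subr_ge0 ltW.
exists (iyx * (2 * C4) + (K * (C3 + (1 + C1) / 2) + K / 2 * (v + C3 + (2 * beta + 2) * C2))) => n.
have s0 : 0 < s n := sqrt_size_gt0 R n.
have s1 : 1 <= s n := sqrt_size_ge1 R n.
have q0 : 0 < q n by rewrite sqrtr_gt0 invr_gt0.
have qq : q n ^+ 2 = (s n)^-1 by rewrite sqr_sqrtr // invr_ge0 ltW.
have q1 : q n <= 1 by rewrite -sqrtr1 ler_wsqrtr // invf_le1.
have qle : (s n)^-1 <= q n by rewrite -qq expr2 ler_piMl // ltW.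
have qi : (q n)^-1 * (s n)^-1 = q n by rewrite -qq expr2 mulKf // gt_eqF.
have ramp_moments Y : all_moments P Y -> all_moments P (fun w => ramp x y (Y w)).
  move=> [mY _]; apply: (@all_moments_bounded _ _ _ _ _ 1).
    by apply: measurableT_comp => //; apply: continuous_measurable_fun; exact: continuous_ramp.
  by move=> w; have /andP[r0 r1] := ramp_itv x y (Y w); rewrite ger0_norm.
pose Y w := W n w + (Rm n w - Ex P (Rm n)).
have hRc : all_moments P (fun w => Rm n w - Ex P (Rm n)).
  by apply: all_momentsB => //; apply: all_moments_cst.
have hY : all_moments P Y by exact: all_momentsD.
rewrite (_ : (fun w => ramp x y _) = (fun w => ramp x y (Y w))); last first.
  by apply/funext => w; rewrite normalized_trace_statE.
have -> : Ex P (fun w => ramp x y (Y w)) - ramp_mean v x y =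
  Ex P (fun w => ramp x y (Y w) - ramp x y (W n w)) + (Ex P (fun w => ramp x y (W n w)) - ramp_mean v x y).
  by rewrite ExB; [ring|exact: ramp_moments|exact: ramp_moments].
apply: le_trans (ler_normD _ _) _; rewrite mulrDl; apply: lerD.
  apply: (@le_trans _ _ (Ex P (fun w => iyx * (`|Rm n w| + `|Ex P (Rm n)|)))).
    apply: Ex_norm_le; first by apply: all_momentsB; apply: ramp_moments.
      apply: all_momentsM; first exact: all_moments_cst.
      by apply: all_momentsD; [exact: all_moments_norm|exact: all_moments_cst].
    move=> w; apply: le_trans (ramp_lipschitz xy _ _) _; apply: ler_wpM2l => //.
    by rewrite /Y addrAC subrr add0r ler_normB.
  have hRn := all_moments_norm (hRm n).
  rewrite ExZ; last by apply: all_momentsD => //; exact: all_moments_cst.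
  rewrite ExD //; last exact: all_moments_cst.
  rewrite Ex_cst -mulrA; apply: ler_wpM2l => //.
  have := Ex_remainder indepX momX meanX n a b1 hbD; rewrite -/(Rm n) -/C4 -/(s n) => h.
  have := Ex_norm (hRm n).
  have : C4 / s n <= C4 * q n by apply: ler_wpM2l.
  move: h; set u := Ex P _; set u' := `|_|; rewrite -[2 * C4 * _]mulrA.
  by move: (C4 / _) (C4 * q n) u u' => p1 p2 p3 p4; lra.
have hgW : all_moments P (fun w => W n w * g (W n w)).
  apply: all_momentsM => //; apply: (@all_moments_bounded _ _ _ _ _ K) => //.
  by case: (hW n) => mW _; apply: measurableT_comp.
have hg'W : all_moments P (fun w => g' (W n w)).
  apply: (@all_moments_bounded _ _ _ _ _ K) => //.
  by case: (hW n) => mW _; apply: measurableT_comp.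
have -> : Ex P (fun w => ramp x y (W n w)) - ramp_mean v x y =
   - (Ex P (fun w => W n w * g (W n w)) - v * Ex P (fun w => g' (W n w))).
  rewrite -ExZ // opprB -ExB //; last by apply: all_momentsM => //; exact: all_moments_cst.
  rewrite -{1}(Ex_cst P (ramp_mean v x y)) -ExB; [|exact: ramp_moments|exact: all_moments_cst].
  by congr Ex; apply/funext => w; rewrite gE.
rewrite normrN.
apply: le_trans (stein_bound indepX momX meanX varX (circ_coef0 _ _ _) mg mg' gK g'K gT g'L hb6 v q0) _.
rewrite [leRHS]mulrDl; apply: lerD; rewrite -[leRHS]mulrA; apply: ler_wpM2l => //;
  last 2 first.
- by rewrite divr_ge0.
- rewrite [leRHS]mulrDl; apply: lerD.
    rewrite mulrC; apply: ler_wpM2r; first exact: ltW.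
    have := sum_circ_coef_sqr D n a; rewrite -/v -/(s n) -/C3 => h.
    have h2 : C3 / s n <= C3 by rewrite ler_pdivrMr // ler_peMr.
    by have := ler_norm (\sum_A circ_coef D a (n:=n) A ^+ 2 - v); lra.
  have := fourth_moment_deriv indepX momX meanX D n a b1 hb4; rewrite -/C2 -/(s n) => h.
  rewrite -[leLHS]mulrA mulrCA -[leRHS]mulrA; apply: ler_wpM2l; first by lra.
  apply: le_trans (ler_wpM2l (_ : 0 <= (q n)^-1) h) _; first by rewrite invr_ge0 ltW.
  by rewrite mulrCA qi.
  pose G := carre_du_champ X (circ_coef D (n := n) a).
  have hG : all_moments P G.
    by apply: all_moments_sum => i _; apply: all_momentsM; apply: all_moments_lin.
  have hGc : all_moments P (fun w => G w - Ex P G).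
    by apply: all_momentsB => //; apply: all_moments_cst.
  (* The fluctuations of [G] and the error on its mean are estimated separately, by the variance
     bound and by the count of zero-sum sets. *)
  apply: (@le_trans _ _ (Ex P (fun w => `|G w - Ex P G| + `|Ex P G - v|))).
    apply: Ex_le.
      by apply: all_moments_norm; apply: all_momentsB => //; apply: all_moments_cst.
      by apply: all_momentsD; [exact: all_moments_norm|exact: all_moments_cst].
    by move=> w; rewrite -/G (_ : G w - v = (G w - Ex P G) + (Ex P G - v)) ?ler_normD //; ring.
  rewrite ExD; [|exact: all_moments_norm|exact: all_moments_cst].
  rewrite Ex_cst addrC mulrDl; apply: lerD.
    rewrite (Ex_carre_du_champ indepX momX meanX varX (circ_coef0 _ _ _)).
    by apply: le_trans (sum_circ_coef_sqr D n a) _; apply: ler_wpM2l.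
  apply: le_trans (Ex_le_weighted_square hGc q0) _.
  rewrite mulrAC; apply: ler_wpM2r; first by rewrite invr_ge0.
  rewrite mulrDl mul1r lerD2l.
  have := variance_carre_du_champ indepX momX meanX D n a b1 hb4.
  rewrite -/C1 -/G -/(s n) => h.
  apply: le_trans (ler_wpM2l (_ : 0 <= (q n)^-1) h) _; first by rewrite invr_ge0 ltW.
  by rewrite mulrCA qi.
Qed.

End rate.

Lemma inv_sqrt_size_cvg0 (R : realType) (e : R) : 0 < e ->
  \forall n \near \oo, Num.sqrt (sqrt_size R n)^-1 < e.
Proof.
move=> e0; near=> n.
have s0 : 0 < (sqrt_size R n)^-1 by rewrite invr_gt0 sqrt_size_gt0.
(* The quantity is [N ^ (- 1/4)], so the comparison is made on fourth powers. *)
have : n.+1%:R^-1 < e ^+ 4.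
  rewrite -[ltRHS]invrK ltf_pV2 ?posrE ?invr_gt0 ?exprn_gt0 ?ltr0n //.
  apply: (@lt_le_trans _ _ n%:R); last by rewrite ler_nat.
  by near: n; exact: nbhs_infty_gtr.
rewrite -sqrt_size_sqr -exprVn => h.
rewrite ltNge; apply/negP => le.
have : e ^+ 4 <= (sqrt_size R n)^-1 ^+ 2.
  rewrite -[X in X ^+ 2](sqr_sqrtr (ltW s0)) -exprM.
  by apply: lerXn2r => //; rewrite nnegrE ?sqrtr_ge0 // ltW.
by rewrite leNgt h.
Unshelve. all: by end_near. Qed.

(** * Distribution functions between two ramps *)

Section cdf_ramp.
Context (d : measure_display) (T : measurableType d) (R : realType) (P : probability T R).
Variable Y : {RV P >-> R}.

Let ramp_moments (a b : R) : a < b -> all_moments P (fun w => ramp a b (Y w)).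
Proof.
move=> ab; apply: (@all_moments_bounded _ _ _ _ _ 1).
  by apply: measurableT_comp => //; apply: continuous_measurable_fun; exact: continuous_ramp.
by move=> w; have /andP[r0 r1] := ramp_itv a b (Y w); rewrite ger0_norm.
Qed.

Let preimage_measurable x : measurable (Y @^-1` `]-oo, x]).
Proof. by rewrite -[X in measurable X]setTI; apply: measurable_funP. Qed.

Let indic_moments x : all_moments P (\1_(Y @^-1` `]-oo, x]) : T -> R).
Proof.
apply: (@all_moments_bounded _ _ _ _ _ 1); first exact: measurable_indic.
by move=> w; rewrite indicE; case: (_ \in _); rewrite ?normr1 ?normr0 ?ler01.
Qed.

Let cdf_Ex x : cdf Y x = (Ex P (\1_(Y @^-1` `]-oo, x]) : T -> R))%:E.
Proof.
rewrite /Ex /Rintegral integral_indic // setIT fineK //.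
exact: fin_num_measure.
Qed.

Lemma cdf_le_ramp (x y : R) : x < y -> (cdf Y x <= (Ex P (fun w => ramp x y (Y w)))%:E)%E.
Proof.
move=> xy; rewrite cdf_Ex lee_fin; apply: Ex_le => [||w]; [exact: indic_moments|exact: ramp_moments|].
rewrite indicE; have [/set_mem /= |_] := boolP (w \in _).
  by rewrite in_itv /= => Yx; rewrite ramp1.
by case/andP: (ramp_itv x y (Y w)).
Qed.

Lemma ramp_le_cdf (x y : R) : x < y -> ((Ex P (fun w => ramp x y (Y w)))%:E <= cdf Y y)%E.
Proof.
move=> xy; rewrite cdf_Ex lee_fin; apply: Ex_le => [||w]; [exact: ramp_moments|exact: indic_moments|].
rewrite indicE; have [_|/negP] := boolP (w \in _); first by case/andP: (ramp_itv x y (Y w)).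
move=> Yy; rewrite ramp0 //; apply: ltW; rewrite ltNge; apply/negP => h; apply: Yy.
by rewrite inE /= in_itv.
Qed.

Lemma cdf_fin_num x : cdf Y x \is a fin_num. Proof. by rewrite cdf_Ex. Qed.

End cdf_ramp.

Theorem theorem1 (R : realType) (dT : measure_display) (T : measurableType dT)
    (P : probability T R) (X : nat -> {RV P >-> R})
    (d : nat) (a : nat -> R)
    (hd : (2 <= d)%N) (had : a d != 0)
    (indepX : independent_RVs X)
    (meanX : forall i : nat, ('E_P[X i] = 0)%E)
    (varX : forall i : nat, ('E_P[(fun w => X i w ^+ 2)%R] = 1)%E)
    (momX : forall k : nat, (3 <= k)%N ->
      (ereal_sup (range (fun i : nat => 'E_P[(fun w => `|X i w| ^+ k)%R]))
         < +oo)%E) :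
  cvg_in_distribution
    (fun n : nat => normalized_trace_stat X (poly_ge2 d a) n : {RV P >-> R})
    (normal_prob 0 (Num.sqrt (limit_variance d a))).
Proof.
have all_mom i := all_moments_RV momX i.
have mean0 i : Ex P (X i) = 0.
  by have := meanX i; rewrite unlock => e; rewrite /Ex /Rintegral e.
have var1 i : Ex P (fun w => X i w ^+ 2) = 1.
  by have := varX i; rewrite unlock => e; rewrite /Ex /Rintegral e.
have v0 : 0 < limit_variance d a := limit_variance_gt0 hd had.
have rate := ramp_rate indepX mean0 var1 all_mom (moments_bounded momX) hd had.
move: v0 rate; set v := limit_variance d a => v0 rate x _.
pose Y n : {RV P >-> R} := normalized_trace_stat X (poly_ge2 d a) n.
suff : cdf (Y n) x @[n --> \oo] --> (gcdf v x)%:E by rewrite -gcdfE.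
apply/fine_cvgP; split.
  by near=> n; exact: cdf_fin_num.
apply/cvgrPdist_lt => e e0.
have cG : {for x, continuous (gcdf v)}.
  apply: differentiable_continuous; apply/derivable1_diffP.
  by have [] := is_derive_gcdf v0 x.
have e2 : 0 < e / 2 by rewrite divr_gt0.
have [r /= r0 rP] : exists2 r : R, 0 < r & forall y, `|x - y| < r -> `|gcdf v x - gcdf v y| < e / 2.
  by have /cvgrPdist_lt/(_ _ e2) := cG; rewrite near_nbhs => -[r r0 rP]; exists r.
(* Half of the continuity radius keeps [x - t] and [x + t] inside it. The ramps on [[x - t, x]] and
   [[x, x + t]] enclose the indicator of []-oo, x]], and their Gaussian means lie between
   [gcdf v (x - t)] and [gcdf v (x + t)]. *)
pose t := r / 2.
have t0 : 0 < t by rewrite divr_gt0.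
have tr : `|t| < r by rewrite ger0_norm ?ltW // /t; lra.
have x1 : x - t < x by rewrite ltrBlDr ltrDl.
have x2 : x < x + t by rewrite ltrDl.
have [C1 HC1] := rate _ _ x1; have [C2 HC2] := rate _ _ x2.
have g1 : `|gcdf v x - gcdf v (x - t)| < e / 2 by apply: rP; rewrite opprB addrC subrK.
have g2 : `|gcdf v x - gcdf v (x + t)| < e / 2 by apply: rP; rewrite opprD addrA subrr add0r normrN.
have /andP[m1 _] := ramp_mean_itv v0 x1; have /andP[_ m2] := ramp_mean_itv v0 x2.
(* Dominates both rates; the added 1 makes it positive, for the division below. *)
pose C := `|C1| + `|C2| + 1.
have C0 : 0 < C by rewrite ltr_wpDl // addr_ge0.
near=> n.
have qn : C * Num.sqrt (sqrt_size R n)^-1 < e / 2.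
  rewrite mulrC -ltr_pdivlMr //; near: n; apply: inv_sqrt_size_cvg0.
  by rewrite divr_gt0.
have q0 : 0 <= Num.sqrt (sqrt_size R n)^-1 by exact: sqrtr_ge0.
have : `|Ex P (fun w => ramp (x - t) x (Y n w)) - ramp_mean v (x - t) x| <=
  C1 * Num.sqrt (sqrt_size R n)^-1 := HC1 n.
have : `|Ex P (fun w => ramp x (x + t) (Y n w)) - ramp_mean v x (x + t)| <=
  C2 * Num.sqrt (sqrt_size R n)^-1 := HC2 n.
move: qn q0; move: (Num.sqrt _) => q qn q0.
have := cdf_le_ramp (Y n) x2; have := ramp_le_cdf (Y n) x1.
rewrite -(fineK (cdf_fin_num (Y n) x)) !lee_fin.
set F := fine _; set E1 := Ex P _; set E2 := Ex P _ => h1 h2 k2 k1.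
have c1 : C1 * q <= `|C1| * q by apply: ler_wpM2r => //; exact: ler_norm.
have c2 : C2 * q <= `|C2| * q by apply: ler_wpM2r => //; exact: ler_norm.
have c3 : 0 <= `|C1| * q by rewrite mulr_ge0.
have c4 : 0 <= `|C2| * q by rewrite mulr_ge0.
move: qn; rewrite /C !mulrDl mul1r => qn.
move: k1 k2 g1 g2; rewrite !ler_norml !ltr_norml => /andP[k1 k1'] /andP[k2 k2'].
move=> /andP[g1 g1'] /andP[g2 g2'].
by rewrite /=; apply/andP; split; lra.
Unshelve. all: by end_near. Qed.
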